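(* Let $\mathfrak{g}$ be a (finite-dimensional) complex semisimple Lie algebra and $c\in U(\mathfrak{g})$ the quadratic Casimir. Take $i:\mathfrak{g}\oplus\mathbb{C}c\hookrightarrow U(\mathfrak{g})^+$ the inclusion, with the right adjoint action and coaction $\Delta_R=\Delta-1\otimes\mathrm{id}$. Any element $\theta^*\in\mathfrak{g}$ defines an augmented inner strongly bicovariant calculus $\Omega(U(\mathfrak{g}))=U(\mathfrak{g})\#B_-^{quad}(\mathfrak{g}\oplus\mathbb{C}c)$ with $$v\xi-\xi v=[v,\xi],\quad\mathrm{d}\xi=\theta^*\triangleleft\xi,\quad\delta v=0,\quad\delta c=\sum_i[\theta^*,t_i]\,t^i,\qquad\forall v\in\mathfrak{g}\subset\mathfrak{g}\oplus\mathbb{C}c,\ \xi\in\mathfrak{g}\subset U(\mathfrak{g}).$$ The Lie derivative $\mathcal{L}=\mathrm{d}i+i\mathrm{d}$ is $\mathcal{L}=[\theta^*,\ ]$.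
   Context: $U(\mathfrak{g})^+=\ker\epsilon$ is a right $U(\mathfrak{g})$-crossed module by the right adjoint action $a\triangleleft b=(Sb_{(1)})ab_{(2)}$ and coaction $\Delta_Ra=\Delta a-1\otimes a$, and $\Lambda^1=\mathfrak{g}\oplus\mathbb{C}c$ is a sub-crossed module: $v\triangleleft\xi=[v,\xi]$, $c\triangleleft\xi=0$, $\Delta_Rv=v\otimes1$, $\Delta_Rc=c\otimes1+2t$, where $t=\sum_it_i\otimes t^i\in\mathfrak{g}\otimes\mathfrak{g}$ is the split Casimir and $c=\sum_it_it^i$. The braiding is $\Psi(v\otimes w)=w_0\otimes v\triangleleft w_1$. (A right $A$-crossed module is a right module and comodule with $\Delta_R(v\triangleleft a)=v_0\triangleleft a_{(2)}\otimes(Sa_{(1)})v_1a_{(3)}$.) $B_-^{quad}(\Lambda^1)$ is the tensor algebra $T_-\Lambda^1$ (as a braided-super Hopf algebra with $\Lambda^1$ odd and primitive) modulo the ideal generated by $\ker(\mathrm{id}-\Psi)\subseteq\Lambda^1\otimes\Lambda^1$; $A\#\Lambda$ denotes the super-Hopf algebra $A\otimes\Lambda$ with $(a\otimes\eta)(b\otimes\zeta)=ab_{(1)}\otimes(\eta\triangleleft b_{(2)})\zeta$ and $\Delta(a\otimes\eta)=a_{(1)}\otimes(\eta^1)_0\otimes a_{(2)}(\eta^1)_1\otimes\eta^2$, where $\underline\Delta\eta=\eta^1\otimes\eta^2$ is the braided coproduct of $\Lambda$ and $\Delta_R\eta=\eta_0\otimes\eta_1$. The differential is $\mathrm{d}=[\theta^*,\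 \}$ (graded commutator) with $\theta^*\in\mathfrak{g}\subset\Lambda^1$, and $\delta$ is its restriction to $B_-^{quad}(\Lambda^1)$. In $\mathcal{L}=[\theta^*,\ ]$, $\theta^*$ is regarded as the element $i(\theta^* )\in\mathfrak{g}\subset U(\mathfrak{g})$ of degree $0$. An augmented inner strongly bicovariant calculus on a Hopf algebra $A$ is a graded super-Hopf algebra $\Omega$ with $\Omega^0=A$ (parity given by degree), with square-zero maps $\mathrm{d}$ of degree $1$ (of the form $[\theta,\ \}$ for some $\theta\in\Omega^1$) and $i$ of degree $-1$, each both a super-derivation and a super-coderivation ($\Delta\mathrm{d}=(\mathrm{d}\otimes\mathrm{id}+(-1)^{|\ |}\otimes\mathrm{d})\Delta$, and likewise for $i$). Here $i$ on $\Omega$ extends the given inclusion on $\Lambda^1$ as a left $U(\mathfrak g)$-module map and super-derivation. *)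

(* Defs.v *)
From HB Require Import structures.
From mathcomp Require Import all_boot all_order all_algebra.
From mathcomp Require Import generic_quotient ring_quotient.
From mathcomp Require Import boolp functions reals.
From mathcomp Require Import sesquilinear complex.

Set Implicit Arguments.
Unset Strict Implicit.
Unset Printing Implicit Defensive.

Import GRing.Theory.
Local Open Scope ring_scope.
Local Open Scope quotient_scope.

Notation bilinear_map f := (bilinear_for *:%R *:%R f).

Lemma linear_map0 (K : fieldType) (V Z : lmodType K) (h : V -> Z) :
  linear h -> h 0 = 0.
Proof. by move=> hl; have := hl (-1) 0 0; rewrite scaler0 addr0 scaleN1r addNr. Qed.

Lemma linear_mapZ (K : fieldType) (V Z : lmodType K) (h : V -> Z) a v :
  linear h -> h (a *: v) = a *: h v.
Proof. by move=> hl; have := hl a v 0; rewrite addr0 (linear_map0 hl) addr0. Qed.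

Section Tensor.
Variables (K : fieldType) (V W : lmodType K).
Implicit Types (s : seq (V * W)) (Z : lmodType K).

(* V (x) W is the set of formal sums of pairs, two of them being identified
   when no bilinear map, into any vector space, separates them. *)
Definition tens_eqv s s' : bool :=
  `[< forall (Z : lmodType K) (f : V -> W -> Z), bilinear_map f ->
        \sum_(p <- s) f p.1 p.2 = \sum_(p <- s') f p.1 p.2 >].

Lemma tens_eqv_class : equiv_class_of tens_eqv.
Proof.
split=> [s|s s'|s s' s''].
- by apply/asboolP.
- by apply/asboolP/asboolP => e Z f fb; rewrite e.
- move=> /asboolP e1 /asboolP e2; apply/asboolP => Z f fb.
  by rewrite e1 // e2.
Qed.

Canonical tens_equiv := EquivRelPack tens_eqv_class.
Canonical tens_enc := defaultEncModRel tens_eqv.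

Definition tens := {eq_quot tens_eqv}.
HB.instance Definition _ := EqQuotient.on tens.
HB.instance Definition _ := Choice.on tens.

Definition pure (v : V) (w : W) : tens := \pi_tens [:: (v, w)].

(* The linear map on V (x) W induced by f, when f is bilinear: this is
   Sweedler-style summation over a decomposition of z into pure tensors. *)
Definition tlift (Z : lmodType K) (f : V -> W -> Z) (z : tens) : Z :=
  \sum_(p <- repr z) f p.1 p.2.

Lemma tlift_pi Z (f : V -> W -> Z) s :
  bilinear_map f -> tlift f (\pi s) = \sum_(p <- s) f p.1 p.2.
Proof.
move=> fb; rewrite /tlift; case: piP => s' /eqP.
by rewrite eqmodE => /asboolP ->.
Qed.

Lemma tens_ext (x y : tens) :
  (forall Z (f : V -> W -> Z), bilinear_map f -> tlift f x = tlift f y) -> x = y.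
Proof.
move=> e; rewrite -[x]reprK -[y]reprK; apply/eqmodP/asboolP => Z f fb.
exact: e.
Qed.

Definition tens_zero : tens := \pi_tens [::].
Definition tens_add (x y : tens) : tens := \pi_tens (repr x ++ repr y).
Definition tens_scale a (x : tens) : tens :=
  \pi_tens [seq (a *: p.1, p.2) | p <- repr x].
Definition tens_opp (x : tens) := tens_scale (-1) x.

Lemma tlift_zero Z (f : V -> W -> Z) : bilinear_map f -> tlift f tens_zero = 0.
Proof. by move=> fb; rewrite tlift_pi // big_nil. Qed.
Lemma tlift_add Z (f : V -> W -> Z) x y : bilinear_map f ->
  tlift f (tens_add x y) = tlift f x + tlift f y.
Proof. by move=> fb; rewrite tlift_pi // big_cat. Qed.
Lemma tlift_scale Z (f : V -> W -> Z) a x : bilinear_map f ->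
  tlift f (tens_scale a x) = a *: tlift f x.
Proof.
move=> fb; rewrite tlift_pi // big_map scaler_sumr; apply: eq_bigr => p _ /=.
exact: (linear_mapZ _ _ (fb.1 p.2)).
Qed.

Local Definition tE := (tlift_add, tlift_zero, tlift_scale).

Lemma tens_addA : associative tens_add.
Proof. by move=> x y z; apply: tens_ext => Z f fb; rewrite !tE // addrA. Qed.
Lemma tens_addC : commutative tens_add.
Proof. by move=> x y; apply: tens_ext => Z f fb; rewrite !tE // addrC. Qed.
Lemma tens_add0 : left_id tens_zero tens_add.
Proof. by move=> x; apply: tens_ext => Z f fb; rewrite !tE // add0r. Qed.
Lemma tens_addN : left_inverse tens_zero tens_opp tens_add.
Proof. by move=> x; apply: tens_ext => Z f fb; rewrite !tE // scaleN1r addNr. Qed.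
HB.instance Definition _ :=
  GRing.isZmodule.Build tens tens_addA tens_addC tens_add0 tens_addN.

Lemma tens_scaleA a b (x : tens) :
  tens_scale a (tens_scale b x) = tens_scale (a * b) x.
Proof. by apply: tens_ext => Z f fb; rewrite !tE // scalerA. Qed.
Lemma tens_scale1 : left_id 1 tens_scale.
Proof. by move=> x; apply: tens_ext => Z f fb; rewrite !tE // scale1r. Qed.
Lemma tens_scaleDr : right_distributive tens_scale +%R.
Proof.
by move=> a x y; apply: tens_ext => Z f fb; rewrite [_ + _]/(tens_add _ _) !tE // scalerDr.
Qed.
Lemma tens_scaleDl (x : tens) : {morph tens_scale^~ x : a b / a + b}.
Proof.
move=> a b; apply: tens_ext => Z f fb.
by rewrite [tens_scale a x + _]/(tens_add _ _) !tE // scalerDl.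
Qed.
HB.instance Definition _ := GRing.Zmodule_isLmodule.Build K tens
  tens_scaleA tens_scale1 tens_scaleDr tens_scaleDl.

Lemma tliftE Z (f : V -> W -> Z) v w :
  bilinear_map f -> tlift f (pure v w) = f v w.
Proof. by move=> fb; rewrite tlift_pi // big_seq1. Qed.

Lemma tlift_linear Z (f : V -> W -> Z) : bilinear_map f -> linear (tlift f).
Proof.
move=> fb a x y; rewrite -(tlift_scale a x fb).
exact: (tlift_add (tens_scale a x) y fb).
Qed.

Lemma pure_bilinear : bilinear_map pure.
Proof.
split=> [w|v] a x y; apply: tens_ext => Z f fb.
  by rewrite (tlift_linear fb) !tliftE // fb.1.
by rewrite (tlift_linear fb) !tliftE // fb.2.
Qed.

Lemma tensP (z : tens) : exists s : seq (V * W), z = \sum_(p <- s) pure p.1 p.2.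
Proof.
exists (repr z); apply: tens_ext => Z f fb.
rewrite {1}/tlift; elim: (repr z) => [|p s IH].
  by rewrite !big_nil; apply/esym/tlift_zero.
rewrite !big_cons; apply/esym; have -> := tlift_add (pure p.1 p.2) _ fb.
by rewrite tliftE // -IH.
Qed.

End Tensor.

Arguments tens {K} (V W)%_type_scope.
Notation "V ⊗ W" := (tens V W) (at level 40, left associativity) : type_scope.
Notation "v ⊗ w" := (pure v w) (at level 40, left associativity) : ring_scope.

(* Sweedler notation: E, bilinear in (a, b), summed over z = sum of a ⊗ b. *)
Notation "\sw_ ( a , b <- z ) E" := (tlift (fun a b => E) z)
  (at level 41, a name, b name, E at level 41, right associativity,
   format "\sw_ ( a ,  b  <-  z )  E") : ring_scope.

Section TensorMaps.
Variable K : fieldType.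

Definition tmap (V W V' W' : lmodType K) (f : V -> V') (h : W -> W')
    (z : V ⊗ W) : V' ⊗ W' := \sw_(v, w <- z) f v ⊗ h w.

Definition tassoc (V W Z : lmodType K) (z : (V ⊗ W) ⊗ Z) : V ⊗ (W ⊗ Z) :=
  \sw_(x, u <- z) \sw_(v, w <- x) v ⊗ (w ⊗ u).

(* The product of the tensor product algebra A (x) B. *)
Definition tmul (A B : algType K) (z z' : A ⊗ B) : A ⊗ B :=
  \sw_(a, b <- z) \sw_(c, d <- z') (a * c) ⊗ (b * d).

End TensorMaps.

(* An associative unital algebra structure on a vector space; unlike algType,
   the zero algebra is allowed. *)
Record is_algebra (K : fieldType) (Z : lmodType K) (mul : Z -> Z -> Z) (one : Z) :
    Prop := IsAlgebra {
  is_alg_bilinear : bilinear_map mul;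
  is_algA : associative mul;
  is_alg1 : left_id one mul;
  is_algr1 : right_id one mul
}.

Lemma algType_is_algebra (K : fieldType) (A : algType K) :
  is_algebra (@GRing.mul A) 1.
Proof.
split; [|exact: mulrA|exact: mul1r|exact: mulr1].
by split=> w a x y; rewrite ?mulrDl ?mulrDr -?scalerAl -?scalerAr.
Qed.

Section TensorAlgebra.
Variables (K : fieldType) (V : lmodType K).

Definition fsum := seq (K * seq V).
Implicit Types s : fsum.

Definition fs_eval (Z : lmodType K) (mul : Z -> Z -> Z) (one : Z) (f : V -> Z) s : Z :=
  \sum_(p <- s) p.1 *: foldr (fun v => mul (f v)) one p.2.

(* T(V) is the set of formal linear combinations of words, two of them being
   identified when no linear map from V into an algebra separates them. *)
Definition fs_eqv s s' : bool :=
  `[< forall (Z : lmodType K) mul one (f : V -> Z), is_algebra mul one ->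
        linear f -> fs_eval mul one f s = fs_eval mul one f s' >].

Lemma fs_eqv_class : equiv_class_of fs_eqv.
Proof.
split=> [s|s s'|s s' s''].
- by apply/asboolP.
- by apply/asboolP/asboolP => e Z mul one f Za fl; rewrite e.
- move=> /asboolP e1 /asboolP e2; apply/asboolP => Z mul one f Za fl.
  by rewrite e1 // e2.
Qed.

Canonical fs_equiv := EquivRelPack fs_eqv_class.
Canonical fs_enc := defaultEncModRel fs_eqv.

Definition talg := {eq_quot fs_eqv}.
HB.instance Definition _ := EqQuotient.on talg.
HB.instance Definition _ := Choice.on talg.

Definition tgen (v : V) : talg := \pi_talg [:: (1, [:: v])].

(* When mul and one make Z an algebra and f is linear, this is the unique
   algebra map extending f. *)
Definition talg_lift (Z : lmodType K) (mul : Z -> Z -> Z) (one : Z) (f : V -> Z)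
  (x : talg) : Z := fs_eval mul one f (repr x).

Lemma talg_ext (x y : talg) :
  (forall (Z : lmodType K) mul one (f : V -> Z), is_algebra mul one -> linear f ->
    talg_lift mul one f x = talg_lift mul one f y) -> x = y.
Proof.
move=> e; rewrite -[x]reprK -[y]reprK; apply/eqmodP/asboolP => Z mul one f Za fl.
exact: e.
Qed.

Definition talg_zero : talg := \pi_talg [::].
Definition talg_one : talg := \pi_talg [:: (1, [::])].
Definition talg_add (x y : talg) : talg := \pi_talg (repr x ++ repr y).
Definition talg_scale a (x : talg) : talg :=
  \pi_talg [seq (a * p.1, p.2) | p <- repr x].
Definition talg_opp (x : talg) := talg_scale (-1) x.
Definition talg_mul (x y : talg) : talg :=
  \pi_talg [seq (p.1 * q.1, p.2 ++ q.2) | p <- repr x, q <- repr y].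

Section LiftE.
Variables (Z : lmodType K) (mul : Z -> Z -> Z) (one : Z) (f : V -> Z).
Hypotheses (Za : is_algebra mul one) (fl : linear f).
Local Notation lift := (talg_lift mul one f).

Lemma talg_lift_pi s : lift (\pi s) = fs_eval mul one f s.
Proof.
rewrite /talg_lift; case: piP => s' /eqP.
by rewrite eqmodE => /asboolP ->.
Qed.
Lemma talg_lift0 : lift talg_zero = 0.
Proof. by rewrite talg_lift_pi /fs_eval big_nil. Qed.
Lemma talg_lift1 : lift talg_one = one.
Proof. by rewrite talg_lift_pi /fs_eval big_seq1 scale1r. Qed.
Lemma talg_liftD x y : lift (talg_add x y) = lift x + lift y.
Proof. by rewrite talg_lift_pi /fs_eval big_cat. Qed.
Lemma talg_liftZ a x : lift (talg_scale a x) = a *: lift x.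
Proof.
rewrite talg_lift_pi /fs_eval big_map scaler_sumr.
by apply: eq_bigr => p _; rewrite scalerA.
Qed.
Lemma talg_liftM x y : lift (talg_mul x y) = mul (lift x) (lift y).
Proof.
have [mulb mA m1 _] := Za.
have suml I (r : seq I) F z : mul (\sum_(i <- r) F i) z = \sum_(i <- r) mul (F i) z.
  elim: r => [|i r IH]; first by rewrite !big_nil (linear_map0 (mulb.1 z)).
  rewrite !big_cons -IH.
  by have := mulb.1 z 1 (F i) (\sum_(j <- r) F j); rewrite /= !scale1r.
have sumr I (r : seq I) F z : mul z (\sum_(i <- r) F i) = \sum_(i <- r) mul z (F i).
  elim: r => [|i r IH]; first by rewrite !big_nil (linear_map0 (mulb.2 z)).
  rewrite !big_cons -IH.
  by have := mulb.2 z 1 (F i) (\sum_(j <- r) F j); rewrite /= !scale1r.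
rewrite talg_lift_pi /talg_lift /fs_eval big_allpairs_dep /= suml.
apply: eq_bigr => p _; rewrite sumr; apply: eq_bigr => q _.
rewrite (linear_mapZ _ _ (mulb.2 _)) (linear_mapZ _ _ (mulb.1 _)).
rewrite scalerA mulrC; congr (_ *: _).
by elim: p.2 => [|v w IH] /=; rewrite ?m1 // IH mA.
Qed.
Lemma talg_lift_gen v : lift (tgen v) = f v.
Proof. by rewrite talg_lift_pi /fs_eval big_seq1 /= scale1r (is_algr1 Za). Qed.
End LiftE.

Local Definition tlE := (talg_lift0, talg_lift1, talg_liftD, talg_liftZ, talg_liftM).

Lemma talg_addA : associative talg_add.
Proof. by move=> x y z; apply: talg_ext => Z mul one f Za fl; rewrite !tlE // addrA. Qed.
Lemma talg_addC : commutative talg_add.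
Proof. by move=> x y; apply: talg_ext => Z mul one f Za fl; rewrite !tlE // addrC. Qed.
Lemma talg_add0 : left_id talg_zero talg_add.
Proof. by move=> x; apply: talg_ext => Z mul one f Za fl; rewrite !tlE // add0r. Qed.
Lemma talg_addN : left_inverse talg_zero talg_opp talg_add.
Proof. by move=> x; apply: talg_ext => Z mul one f Za fl; rewrite !tlE // scaleN1r addNr. Qed.
HB.instance Definition _ :=
  GRing.isZmodule.Build talg talg_addA talg_addC talg_add0 talg_addN.

Lemma talg_mulA : associative talg_mul.
Proof. by move=> x y z; apply: talg_ext => Z mul one f Za fl; rewrite !tlE // (is_algA Za). Qed.
Lemma talg_mul1 : left_id talg_one talg_mul.
Proof. by move=> x; apply: talg_ext => Z mul one f Za fl; rewrite !tlE // (is_alg1 Za). Qed.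
Lemma talg_mulr1 : right_id talg_one talg_mul.
Proof. by move=> x; apply: talg_ext => Z mul one f Za fl; rewrite !tlE // (is_algr1 Za). Qed.
Lemma talg_mulDl : left_distributive talg_mul +%R.
Proof.
move=> x y z; apply: talg_ext => Z mul one f Za fl.
rewrite [x + y]/(talg_add x y) [_ + talg_mul y z]/(talg_add _ _) !tlE //.
by have /= := (is_alg_bilinear Za).1 (talg_lift mul one f z) 1 (talg_lift mul one f x) (talg_lift mul one f y); rewrite !scale1r.
Qed.
Lemma talg_mulDr : right_distributive talg_mul +%R.
Proof.
move=> x y z; apply: talg_ext => Z mul one f Za fl.
rewrite [y + z]/(talg_add y z) [_ + talg_mul x z]/(talg_add _ _) !tlE //.
by have /= := (is_alg_bilinear Za).2 (talg_lift mul one f x) 1 (talg_lift mul one f y) (talg_lift mul one f z); rewrite !scale1r.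
Qed.
Lemma talg_1neq0 : talg_one != 0.
Proof.
have l0 : linear (fun _ : V => 0 : K^o) by move=> a x y; rewrite scaler0 addr0.
apply/eqP => e1; move: (talg_lift1 (algType_is_algebra K^o) l0); rewrite e1.
by rewrite (talg_lift0 (algType_is_algebra K^o) l0 : talg_lift _ _ _ 0 = 0) => /eqP; rewrite eq_sym oner_eq0.
Qed.
HB.instance Definition _ := GRing.Zmodule_isNzRing.Build talg
  talg_mulA talg_mul1 talg_mulr1 talg_mulDl talg_mulDr talg_1neq0.

Lemma talg_scaleA a b (x : talg) :
  talg_scale a (talg_scale b x) = talg_scale (a * b) x.
Proof. by apply: talg_ext => Z mul one f Za fl; rewrite !tlE // scalerA. Qed.
Lemma talg_scale1 : left_id 1 talg_scale.
Proof. by move=> x; apply: talg_ext => Z mul one f Za fl; rewrite !tlE // scale1r. Qed.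
Lemma talg_scaleDr : right_distributive talg_scale +%R.
Proof.
move=> a x y; apply: talg_ext => Z mul one f Za fl.
rewrite [x + y]/(talg_add x y) [_ + talg_scale a y]/(talg_add _ _) !tlE //.
by rewrite scalerDr.
Qed.
Lemma talg_scaleDl (x : talg) : {morph talg_scale^~ x : a b / a + b}.
Proof.
move=> a b; apply: talg_ext => Z mul one f Za fl.
by rewrite [talg_scale a x + _]/(talg_add _ _) !tlE // scalerDl.
Qed.
HB.instance Definition _ := GRing.Zmodule_isLmodule.Build K talg
  talg_scaleA talg_scale1 talg_scaleDr talg_scaleDl.

Lemma talg_scaleAl a (x y : talg) : a *: (x * y) = (a *: x) * y.
Proof.
rewrite [LHS]/(talg_scale a (talg_mul x y)) [RHS]/(talg_mul (talg_scale a x) y).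
by apply: talg_ext => Z mul one f Za fl; rewrite !tlE //; apply/esym/(linear_mapZ _ _ ((is_alg_bilinear Za).1 _)).
Qed.
HB.instance Definition _ := GRing.Lmodule_isLalgebra.Build K talg talg_scaleAl.

Lemma talg_scaleAr a (x y : talg) : a *: (x * y) = x * (a *: y).
Proof.
rewrite [LHS]/(talg_scale a (talg_mul x y)) [RHS]/(talg_mul x (talg_scale a y)).
by apply: talg_ext => Z mul one f Za fl; rewrite !tlE //; apply/esym/(linear_mapZ _ _ ((is_alg_bilinear Za).2 _)).
Qed.
HB.instance Definition _ := GRing.Lalgebra_isAlgebra.Build K talg talg_scaleAr.

Lemma tgen_linear : linear tgen.
Proof.
move=> a x y; apply: talg_ext => Z mul one f Za fl.
have -> := talg_liftD Za fl (talg_scale a (tgen x)) (tgen y).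
by rewrite talg_liftZ // !talg_lift_gen // fl.
Qed.

End TensorAlgebra.

Definition augmentation (K : fieldType) (V : lmodType K) : talg V -> K :=
  talg_lift *%R (1 : K^o) (fun=> 0).

Inductive ideal_of (K : fieldType) (A : algType K) (S : A -> Prop) : A -> Prop :=
| Ideal0 : ideal_of S 0
| IdealD x y : ideal_of S x -> ideal_of S y -> ideal_of S (x + y)
| IdealM a x b : S x -> ideal_of S (a * x * b).

(* The condition on the augmentation only serves to make the quotient algebra
   T(V) / ideal_of relator nontrivial, as algType requires. *)
Record relators (K : fieldType) (V : lmodType K) := Relators {
  relator : talg V -> Prop;
  relator_aug : forall x, relator x -> augmentation x = 0
}.

(* The space L(V, W) of linear maps; tolin f is f if f is linear, 0 otherwise. *)
Section LinMap.
Variables (K : fieldType) (V W : lmodType K).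

Definition linear_pred : {pred V -> W} := fun f => `[< linear f >].

Lemma linear_pred_closed : submod_closed linear_pred.
Proof.
split=> [|a f h /asboolP fl /asboolP hl]; apply/asboolP => b x y /=.
  by rewrite scaler0 addr0.
rewrite !fctE fl hl !scalerDr !scalerA addrACA.
by rewrite (mulrC a).
Qed.
HB.instance Definition _ := GRing.isSubmodClosed.Build K (V -> W) linear_pred
  linear_pred_closed.

Record linmap := LinMap { linmap_fun :> V -> W; _ : linmap_fun \in linear_pred }.
HB.instance Definition _ := [isSub for linmap_fun].
HB.instance Definition _ := [Choice of linmap by <:].
HB.instance Definition _ := [SubChoice_isSubLmodule of linmap by <:].

Definition tolin (f : V -> W) : linmap := insubd (0 : linmap) f.

Lemma tolinE f : linear f -> tolin f = f :> (V -> W).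
Proof. by move=> fl; rewrite /tolin insubdK //; apply/asboolP. Qed.

End LinMap.

Section QuotientAlgebra.
Variables (K : fieldType) (V : lmodType K) (S : relators V).

Definition in_ideal : {pred talg V} := fun x => `[< ideal_of (relator S) x >].

Lemma ideal_ofM a b x : ideal_of (relator S) x -> ideal_of (relator S) (a * x * b).
Proof.
elim=> [|x1 x2 _ I1 _ I2|c y d Sy].
- by rewrite mulr0 mul0r; exact: Ideal0.
- by rewrite mulrDr mulrDl; exact: IdealD.
- have -> : a * (c * y * d) * b = (a * c) * y * (d * b) by rewrite !mulrA.
  exact: IdealM.
Qed.

Lemma in_ideal_closed : zmod_closed in_ideal.
Proof.
split=> [|x y /asboolP Ix /asboolP Iy]; first by apply/asboolP/Ideal0.
apply/asboolP/IdealD => //; have -> : - y = -1 * y * 1 by rewrite mulr1 mulN1r.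
exact: ideal_ofM.
Qed.
HB.instance Definition _ := GRing.isZmodClosed.Build (talg V) in_ideal in_ideal_closed.

Definition qalg := Quotient.quot in_ideal.
HB.instance Definition _ := GRing.Zmodule.on qalg.

Local Notation "[ x ]q" := (\pi_qalg x) (format "[ x ]q").

Lemma qalg_eqP x y : [x]q = [y]q <-> ideal_of (relator S) (x - y).
Proof.
split=> [/eqmodP|I]; first by move=> /asboolP.
by apply/eqmodP/asboolP.
Qed.

Definition qalg_mul (x y : qalg) : qalg := [repr x * repr y]q.
Definition qalg_scale a (x : qalg) : qalg := [a *: repr x]q.

Lemma qalgP (x : qalg) : exists u, x = [u]q.
Proof. by exists (repr x); rewrite reprK. Qed.

Lemma qalgB x : ideal_of (relator S) (repr [x]q - x).
Proof. by apply/qalg_eqP; rewrite reprK. Qed.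

Lemma qalg_piD x y : [x + y]q = [x]q + [y]q.
Proof. by rewrite !piE. Qed.

Lemma qalg_piM x y : [x * y]q = qalg_mul [x]q [y]q.
Proof.
apply/esym/qalg_eqP.
have -> : repr [x]q * repr [y]q - x * y =
   1 * (repr [x]q - x) * repr [y]q + x * (repr [y]q - y) * 1.
  by rewrite mul1r mulr1 mulrBl mulrBr addrA subrK.
by apply: IdealD; apply: ideal_ofM; exact: qalgB.
Qed.

Lemma qalg_piZ a x : [a *: x]q = qalg_scale a [x]q.
Proof.
apply/esym/qalg_eqP; rewrite -scalerBr.
have -> : a *: (repr [x]q - x) = (a *: 1) * (repr [x]q - x) * 1.
  by rewrite mulr1 -scalerAl mul1r.
by apply: ideal_ofM; exact: qalgB.
Qed.

Lemma qalg_mulA : associative qalg_mul.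
Proof. by move=> x y z; case: (qalgP x) (qalgP y) (qalgP z) => u -> [v ->] [w ->]; rewrite -!qalg_piM mulrA. Qed.
Lemma qalg_mul1 : left_id [1]q qalg_mul.
Proof. by move=> x; case: (qalgP x) => u ->; rewrite -!qalg_piM mul1r. Qed.
Lemma qalg_mulr1 : right_id [1]q qalg_mul.
Proof. by move=> x; case: (qalgP x) => u ->; rewrite -!qalg_piM mulr1. Qed.
Lemma qalg_mulDl : left_distributive qalg_mul +%R.
Proof.
move=> x y z; case: (qalgP x) (qalgP y) (qalgP z) => u -> [v ->] [w ->].
by rewrite -qalg_piD -!qalg_piM mulrDl qalg_piD.
Qed.
Lemma qalg_mulDr : right_distributive qalg_mul +%R.
Proof.
move=> x y z; case: (qalgP x) (qalgP y) (qalgP z) => u -> [v ->] [w ->].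
by rewrite -qalg_piD -!qalg_piM mulrDr qalg_piD.
Qed.

Let l0 : linear (fun _ : V => 0 : K^o).
Proof. by move=> a x y; rewrite scaler0 addr0. Qed.

Lemma ideal_aug x : ideal_of (relator S) x -> augmentation x = 0.
Proof.
elim=> [|x1 x2 _ I1 _ I2|c y d Sy]; first exact: talg_lift0 (algType_is_algebra K^o) l0.
  rewrite /augmentation; have -> := talg_liftD (algType_is_algebra K^o) l0 x1 x2.
  by rewrite [talg_lift _ _ _ _]I1 [talg_lift _ _ _ _]I2 addr0.
rewrite /augmentation; have -> := talg_liftM (algType_is_algebra K^o) l0 (c * y) d.
have -> := talg_liftM (algType_is_algebra K^o) l0 c y.
by rewrite [talg_lift _ _ _ y](relator_aug Sy) mulr0 mul0r.
Qed.

Lemma qalg_1neq0 : [1]q != 0.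
Proof.
have z : [0]q = 0.
  by apply: (addrI [0]q); rewrite -qalg_piD !addr0.
apply/eqP => e; have /qalg_eqP : [1]q = [0]q by rewrite z.
rewrite subr0 => /ideal_aug; rewrite [augmentation _](talg_lift1 (algType_is_algebra K^o) l0).
by move/eqP; rewrite oner_eq0.
Qed.
HB.instance Definition _ := GRing.Zmodule_isNzRing.Build qalg
  qalg_mulA qalg_mul1 qalg_mulr1 qalg_mulDl qalg_mulDr qalg_1neq0.

Lemma qalg_scaleA a b (x : qalg) :
  qalg_scale a (qalg_scale b x) = qalg_scale (a * b) x.
Proof. by case: (qalgP x) => u ->; rewrite -!qalg_piZ scalerA. Qed.
Lemma qalg_scale1 : left_id 1 qalg_scale.
Proof. by move=> x; case: (qalgP x) => u ->; rewrite -!qalg_piZ scale1r. Qed.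
Lemma qalg_scaleDr : right_distributive qalg_scale +%R.
Proof.
move=> a x y; case: (qalgP x) (qalgP y) => u -> [v ->].
by rewrite -qalg_piD -!qalg_piZ scalerDr qalg_piD.
Qed.
Lemma qalg_scaleDl (x : qalg) : {morph qalg_scale^~ x : a b / a + b}.
Proof. by move=> a b; case: (qalgP x) => u ->; rewrite -!qalg_piZ scalerDl qalg_piD. Qed.
HB.instance Definition _ := GRing.Zmodule_isLmodule.Build K qalg
  qalg_scaleA qalg_scale1 qalg_scaleDr qalg_scaleDl.

Lemma qalg_scaleAl a (x y : qalg) : a *: (x * y) = (a *: x) * y.
Proof.
case: (qalgP x) (qalgP y) => u -> [v ->].
change (qalg_scale a (qalg_mul [u]q [v]q) = qalg_mul (qalg_scale a [u]q) [v]q).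
by rewrite -qalg_piM -!qalg_piZ -qalg_piM scalerAl.
Qed.
HB.instance Definition _ := GRing.Lmodule_isLalgebra.Build K qalg qalg_scaleAl.

Lemma qalg_scaleAr a (x y : qalg) : a *: (x * y) = x * (a *: y).
Proof.
case: (qalgP x) (qalgP y) => u -> [v ->].
change (qalg_scale a (qalg_mul [u]q [v]q) = qalg_mul [u]q (qalg_scale a [v]q)).
by rewrite -qalg_piM -!qalg_piZ -qalg_piM scalerAr.
Qed.
HB.instance Definition _ := GRing.Lalgebra_isAlgebra.Build K qalg qalg_scaleAr.

Definition qgen (v : V) : qalg := [tgen v]q.

(* When mul and one make Z an algebra and f is linear and compatible with the
   relators, this is the unique algebra map extending f. *)
Definition qalg_lift (Z : lmodType K) (mul : Z -> Z -> Z) (one : Z) (f : V -> Z)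
  (x : qalg) : Z := talg_lift mul one f (repr x).

Lemma qgen_linear : linear qgen.
Proof. by move=> a x y; rewrite /qgen tgen_linear qalg_piD [[_ *: _]q]qalg_piZ. Qed.

Section LiftE.
Variables (Z : lmodType K) (mul : Z -> Z -> Z) (one : Z) (f : V -> Z).
Hypotheses (Za : is_algebra mul one) (fl : linear f).
Hypothesis fS : forall x, relator S x -> talg_lift mul one f x = 0.
Local Notation lift := (qalg_lift mul one f).

Lemma qalg_lift_pi x : lift [x]q = talg_lift mul one f x.
Proof.
have mb := is_alg_bilinear Za.
suff I0 y : ideal_of (relator S) y -> talg_lift mul one f y = 0.
  have /I0 := qalgB x; rewrite -[X in _ + X]scaleN1r.
  have -> := talg_liftD Za fl (repr [x]q) (talg_scale (-1) x).
  by rewrite talg_liftZ // scaleN1r => /eqP; rewrite subr_eq0 => /eqP.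
elim=> [|y1 y2 _ I1 _ I2|a z b Sz]; first exact: talg_lift0.
  by have -> := talg_liftD Za fl y1 y2; rewrite I1 I2 addr0.
have -> := talg_liftM Za fl (a * z) b; have -> := talg_liftM Za fl a z.
by rewrite (fS Sz) (linear_map0 (mb.2 _)) (linear_map0 (mb.1 _)).
Qed.
Lemma qalg_lift_linear : linear lift.
Proof.
move=> a x y; case: (qalgP x) (qalgP y) => u -> [v ->].
have <- : [a *: u + v]q = a *: ([u]q : qalg) + ([v]q : qalg) by rewrite qalg_piD [[_ *: _]q]qalg_piZ.
rewrite !qalg_lift_pi; have -> := talg_liftD Za fl (talg_scale a u) v.
by rewrite talg_liftZ.
Qed.
Lemma qalg_lift1 : lift 1 = one.
Proof. by rewrite [lift 1]qalg_lift_pi [LHS]talg_lift1. Qed.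
Lemma qalg_liftM x y : lift (x * y) = mul (lift x) (lift y).
Proof.
case: (qalgP x) (qalgP y) => u -> [v ->].
have <- : [u * v]q = ([u]q : qalg) * ([v]q : qalg) by exact: qalg_piM.
by rewrite !qalg_lift_pi; exact: talg_liftM.
Qed.
Lemma qalg_lift_gen v : lift (qgen v) = f v.
Proof. by rewrite qalg_lift_pi talg_lift_gen. Qed.
End LiftE.

End QuotientAlgebra.

(* Below, structure maps are plain functions; the axioms they should satisfy
   are collected in the predicates is_hopf, is_cmod, etc. *)

Record hopf_data (K : fieldType) := HopfData {
  hopf_alg :> algType K;
  cop : hopf_alg -> hopf_alg ⊗ hopf_alg;
  coun : hopf_alg -> K;
  antip : hopf_alg -> hopf_alg
}.
Arguments cop {K H} : rename.
Arguments coun {K H} : rename.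
Arguments antip {K H} : rename.

Record is_hopf (K : fieldType) (H : hopf_data K) : Prop := IsHopf {
  hopf_cop_linear : linear (@cop K H);
  hopf_cop1 : cop 1 = 1 ⊗ 1 :> H ⊗ H;
  hopf_copM : forall a b : H, cop (a * b) = tmul (cop a) (cop b);
  hopf_coassoc : forall a : H, tassoc (tmap cop id (cop a)) = tmap id cop (cop a);
  hopf_coun_linear : linear (coun : H -> K^o);
  hopf_coun1 : coun (1 : H) = 1;
  hopf_counM : forall a b : H, coun (a * b) = coun a * coun b;
  hopf_counl : forall a : H, \sw_(a1, a2 <- cop a) coun a1 *: a2 = a;
  hopf_counr : forall a : H, \sw_(a1, a2 <- cop a) coun a2 *: a1 = a;
  hopf_antip_linear : linear (@antip K H);
  hopf_antipl : forall a : H, \sw_(a1, a2 <- cop a) antip a1 * a2 = (coun a)%:A;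
  hopf_antipr : forall a : H, \sw_(a1, a2 <- cop a) a1 * antip a2 = (coun a)%:A
}.

Record cmod_data (K : fieldType) (H : hopf_data K) := CmodData {
  cmod_sp :> lmodType K;
  act : cmod_sp -> H -> cmod_sp;
  coact : cmod_sp -> cmod_sp ⊗ H
}.
Arguments act {K H} V : rename.
Arguments coact {K H} V : rename.

Record is_cmod (K : fieldType) (H : hopf_data K) (V : cmod_data H) : Prop := IsCmod {
  cmod_act_bilinear : bilinear_map (act V);
  cmod_act1 : forall v : V, act V v 1 = v;
  cmod_actM : forall (v : V) (a b : H), act V v (a * b) = act V (act V v a) b;
  cmod_coact_linear : linear (coact V);
  cmod_coassoc : forall v : V,
    tassoc (tmap (coact V) id (coact V v)) = tmap id cop (coact V v);
  cmod_coun : forall v : V, \sw_(v0, v1 <- coact V v) coun v1 *: v0 = v;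
  cmod_compat : forall (v : V) (a : H),
    coact V (act V v a) =
    \sw_(a1, a23 <- tmap id cop (cop a)) \sw_(a2, a3 <- a23)
      \sw_(v0, v1 <- coact V v) act V v0 a2 ⊗ (antip a1 * v1 * a3)
}.

Definition braid (K : fieldType) (H : hopf_data K) (V : cmod_data H) (z : V ⊗ V) :
    V ⊗ V :=
  \sw_(v, w <- z) \sw_(w0, w1 <- coact V w) w0 ⊗ act V v w1.

(* i is a map of crossed modules from V to ker(coun) with the right adjoint
   action and the coaction a |-> cop a - 1 ⊗ a. *)
Record is_cmod_map_to_aug (K : fieldType) (H : hopf_data K) (V : cmod_data H)
    (i : V -> H) : Prop := IsCmodMapToAug {
  aug_linear : linear i;
  aug_coun : forall v : V, coun (i v) = 0;
  aug_act : forall (v : V) (a : H),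
    i (act V v a) = \sw_(a1, a2 <- cop a) antip a1 * i v * a2;
  aug_coact : forall v : V, tmap i id (coact V v) = cop (i v) - 1 ⊗ i v
}.

(* deg n is the component of degree n and par the operator (-1)^deg. *)

Record is_graded (K : fieldType) (V : lmodType K) (deg : nat -> V -> Prop)
    (par : V -> V) : Prop := IsGraded {
  deg0 : forall n, deg n 0;
  deg_linear : forall n a x y, deg n x -> deg n y -> deg n (a *: x + y);
  deg_sum : forall x, exists N (F : nat -> V),
    (forall n, deg n (F n)) /\ x = \sum_(n < N) F n;
  deg_direct : forall N (F : nat -> V), (forall n, deg n (F n)) ->
    \sum_(n < N) F n = 0 -> forall n, (n < N)%N -> F n = 0;
  par_linear : linear par;
  par_deg : forall n x, deg n x -> par x = (-1) ^+ n *: x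
}.

Definition tens_deg (K : fieldType) (V : lmodType K) (deg : nat -> V -> Prop)
    n (z : V ⊗ V) : Prop :=
  exists s : seq (V * V), z = \sum_(p <- s) p.1 ⊗ p.2 /\
    forall p, p \in s -> exists k l, [/\ (k + l)%N = n, deg k p.1 & deg l p.2].

(* v ⊗ w |-> (-1)^(|v| |w|) v ⊗ w *)
Definition koszul (K : fieldType) (V : lmodType K) (par : V -> V) (z : V ⊗ V) :
    V ⊗ V :=
  2%:R^-1 *: (z + tmap par id z + tmap id par z - tmap par par z).

Record bsuper_data (K : fieldType) (H : hopf_data K) := BsuperData {
  bs_alg :> algType K;
  bs_act : bs_alg -> H -> bs_alg;
  bs_coact : bs_alg -> bs_alg ⊗ H;
  bs_cop : bs_alg -> bs_alg ⊗ bs_alg;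
  bs_coun : bs_alg -> K;
  bs_deg : nat -> bs_alg -> Prop;
  bs_par : bs_alg -> bs_alg
}.
Arguments bs_act {K H} L : rename.
Arguments bs_coact {K H} L : rename.
Arguments bs_cop {K H} L : rename.
Arguments bs_coun {K H} L : rename.
Arguments bs_deg {K H} L : rename.
Arguments bs_par {K H} L : rename.

Definition bs_cmod (K : fieldType) (H : hopf_data K) (L : bsuper_data H) :
    cmod_data H := CmodData (bs_act L) (bs_coact L).

(* The braided-super tensor product algebra:
   (a ⊗ b)(c ⊗ d) = (-1)^(|b| |c|) a Psi(b ⊗ c) d. *)
Definition bs_tmul (K : fieldType) (H : hopf_data K) (A : algType K)
    (act : A -> H -> A) (coact : A -> A ⊗ H) (par : A -> A) (z z' : A ⊗ A) : A ⊗ A :=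
  \sw_(a, b <- z) \sw_(c, d <- z')
    tmap ( *%R a) ( *%R^~ d) (braid (V := CmodData act coact) (koszul par (b ⊗ c))).

Record is_braided_super_hopf (K : fieldType) (H : hopf_data K) (L : bsuper_data H) :
    Prop := IsBraidedSuperHopf {
  bs_is_cmod : is_cmod (bs_cmod L);
  bs_is_graded : is_graded (bs_deg L) (bs_par L);
  bs_deg1 : bs_deg L 0%N 1;
  bs_degM : forall m n x y, bs_deg L m x -> bs_deg L n y -> bs_deg L (m + n)%N (x * y);
  bs_act_deg : forall n x u, bs_deg L n x -> bs_deg L n (bs_act L x u);
  bs_coact_deg : forall n x, bs_deg L n x -> exists s : seq (L * H),
    bs_coact L x = \sum_(p <- s) p.1 ⊗ p.2 /\ forall p, p \in s -> bs_deg L n p.1;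
  bs_act1 : forall u, bs_act L 1 u = (coun u)%:A;
  bs_actM : forall x y u,
    bs_act L (x * y) u = \sw_(u1, u2 <- cop u) bs_act L x u1 * bs_act L y u2;
  bs_coact1 : bs_coact L 1 = 1 ⊗ 1;
  bs_coactM : forall x y, bs_coact L (x * y) = tmul (bs_coact L x) (bs_coact L y);
  bs_cop_linear : linear (bs_cop L);
  bs_cop_deg : forall n x, bs_deg L n x -> tens_deg (bs_deg L) n (bs_cop L x);
  bs_cop1 : bs_cop L 1 = 1 ⊗ 1;
  bs_copM : forall x y,
    bs_cop L (x * y) =
    bs_tmul (bs_act L) (bs_coact L) (bs_par L) (bs_cop L x) (bs_cop L y);
  bs_coassoc : forall x,
    tassoc (tmap (bs_cop L) id (bs_cop L x)) = tmap id (bs_cop L) (bs_cop L x);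
  bs_cop_act : forall x u,
    bs_cop L (bs_act L x u) =
    \sw_(u1, u2 <- cop u) tmap (bs_act L ^~ u1) (bs_act L ^~ u2) (bs_cop L x);
  bs_cop_coact : forall x,
    tmap (bs_cop L) id (bs_coact L x) =
    \sw_(y, z <- bs_cop L x) \sw_(y0, y1 <- bs_coact L y)
      \sw_(z0, z1 <- bs_coact L z) (y0 ⊗ z0) ⊗ (y1 * z1);
  bs_coun_linear : linear (bs_coun L : L -> K^o);
  bs_coun1 : bs_coun L 1 = 1;
  bs_counM : forall x y, bs_coun L (x * y) = bs_coun L x * bs_coun L y;
  bs_coun_deg : forall n x, bs_deg L n.+1 x -> bs_coun L x = 0;
  bs_counl : forall x, \sw_(x1, x2 <- bs_cop L x) bs_coun L x1 *: x2 = x;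
  bs_counr : forall x, \sw_(x1, x2 <- bs_cop L x) bs_coun L x2 *: x1 = x;
  bs_antip : exists S : L -> L, [/\ linear S,
    forall n x, bs_deg L n x -> bs_deg L n (S x),
    forall x, \sw_(x1, x2 <- bs_cop L x) S x1 * x2 = (bs_coun L x)%:A &
    forall x, \sw_(x1, x2 <- bs_cop L x) x1 * S x2 = (bs_coun L x)%:A]
}.

Section Augmentation.
Variables (K : fieldType) (V : lmodType K).
Let l0 : linear (fun _ : V => 0 : K^o).
Proof. by move=> a x y; rewrite scaler0 addr0. Qed.
Let Ka := algType_is_algebra K^o.

Lemma augD (x y : talg V) : augmentation (x + y) = augmentation x + augmentation y.
Proof. exact: (talg_liftD Ka l0). Qed.
Lemma augN (x : talg V) : augmentation (- x) = - augmentation x.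
Proof. by have := talg_liftZ Ka l0 (-1) x; rewrite scaleN1r. Qed.
Lemma augM (x y : talg V) : augmentation (x * y) = augmentation x * augmentation y.
Proof. exact: (talg_liftM Ka l0). Qed.
Lemma aug_gen (v : V) : augmentation (tgen v) = 0.
Proof. exact: (talg_lift_gen Ka l0). Qed.
End Augmentation.

Section Bquad.
Variables (K : fieldType) (H : hopf_data K) (X : cmod_data H).

Definition quad_relator (z : talg X) : Prop :=
  exists w : X ⊗ X, w - braid w = 0 /\ z = \sw_(x, y <- w) tgen x * tgen y.

Lemma quad_relator_aug z : quad_relator z -> augmentation z = 0.
Proof.
case=> w [_ ->]; rewrite /tlift; elim: (repr w) => [|p s IH].
  by rewrite big_nil -[0](subrr (0 : talg X)) augD augN subrr.
by rewrite big_cons augD IH augM aug_gen mul0r addr0.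
Qed.

Definition Bquad_alg : algType K := qalg (Relators quad_relator_aug).
Definition bgen (x : X) : Bquad_alg := qgen _ x.

Definition Bquad_par : Bquad_alg -> Bquad_alg :=
  qalg_lift *%R 1 (fun x => - bgen x).

(* B is to be a right H-module algebra: (xy) <| u = (x <| u_1)(y <| u_2), so that
   the action is a map of algebras from B to L(H, B) with convolution. *)
Definition Bquad_act : Bquad_alg -> H -> Bquad_alg :=
  qalg_lift (Z := linmap H Bquad_alg)
    (fun F G => tolin (fun u => \sw_(u1, u2 <- cop u) F u1 * G u2))
    (tolin (fun u => (coun u)%:A)) (fun x => tolin (fun u => bgen (act X x u))).

Definition Bquad_coact : Bquad_alg -> Bquad_alg ⊗ H :=
  qalg_lift (@tmul K _ _) (1 ⊗ 1) (fun x => tmap bgen id (coact X x)).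

Definition Bquad_cop : Bquad_alg -> Bquad_alg ⊗ Bquad_alg :=
  qalg_lift (bs_tmul Bquad_act Bquad_coact Bquad_par) (1 ⊗ 1)
    (fun x => bgen x ⊗ 1 + 1 ⊗ bgen x).

Definition Bquad_coun : Bquad_alg -> K := qalg_lift *%R (1 : K^o) (fun=> 0).

Definition Bquad_deg n (z : Bquad_alg) : Prop :=
  exists s : seq (K * n.-tuple X), z = \sum_(p <- s) p.1 *: \prod_(x <- p.2) bgen x.

Definition Bquad : bsuper_data H :=
  BsuperData Bquad_act Bquad_coact Bquad_cop Bquad_coun Bquad_deg Bquad_par.

Record Bquad_extends : Prop := BquadExtends {
  Bquad_act_gen : forall x u, Bquad_act (bgen x) u = bgen (act X x u);
  Bquad_coact_gen : forall x, Bquad_coact (bgen x) = tmap bgen id (coact X x);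
  Bquad_cop_gen : forall x, Bquad_cop (bgen x) = bgen x ⊗ 1 + 1 ⊗ bgen x;
  Bquad_coun_gen : forall x, Bquad_coun (bgen x) = 0
}.

End Bquad.

Record shopf_data (K : fieldType) := ShopfData {
  sh_sp :> lmodType K;
  sh_mul : sh_sp -> sh_sp -> sh_sp;
  sh_one : sh_sp;
  sh_cop : sh_sp -> sh_sp ⊗ sh_sp;
  sh_coun : sh_sp -> K;
  sh_deg : nat -> sh_sp -> Prop;
  sh_par : sh_sp -> sh_sp
}.
Arguments sh_mul {K O} : rename.
Arguments sh_one {K} O : rename.
Arguments sh_cop {K} O : rename.
Arguments sh_coun {K} O : rename.
Arguments sh_deg {K} O : rename.
Arguments sh_par {K} O : rename.

Notation "x ∙ y" := (sh_mul x y) (at level 40, left associativity) : ring_scope.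

(* (a ⊗ b)(c ⊗ d) = (-1)^(|b| |c|) ac ⊗ bd *)
Definition sh_tmul (K : fieldType) (O : shopf_data K) (z z' : O ⊗ O) : O ⊗ O :=
  \sw_(a, b <- z) \sw_(c, d <- z') \sw_(b', c' <- koszul (sh_par O) (b ⊗ c))
    (a ∙ c') ⊗ (b' ∙ d).

Record is_super_hopf (K : fieldType) (O : shopf_data K) : Prop := IsSuperHopf {
  sh_is_graded : is_graded (sh_deg O) (sh_par O);
  sh_is_algebra : is_algebra (@sh_mul K O) (sh_one O);
  sh_deg1 : sh_deg O 0%N (sh_one O);
  sh_degM : forall m n x y,
    sh_deg O m x -> sh_deg O n y -> sh_deg O (m + n)%N (x ∙ y);
  sh_cop_linear : linear (sh_cop O);
  sh_cop_deg : forall n x, sh_deg O n x -> tens_deg (sh_deg O) n (sh_cop O x);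
  sh_cop1 : sh_cop O (sh_one O) = sh_one O ⊗ sh_one O;
  sh_copM : forall x y, sh_cop O (x ∙ y) = sh_tmul (sh_cop O x) (sh_cop O y);
  sh_coassoc : forall x,
    tassoc (tmap (sh_cop O) id (sh_cop O x)) = tmap id (sh_cop O) (sh_cop O x);
  sh_coun_linear : linear (sh_coun O : O -> K^o);
  sh_coun1 : sh_coun O (sh_one O) = 1;
  sh_counM : forall x y, sh_coun O (x ∙ y) = sh_coun O x * sh_coun O y;
  sh_coun_deg : forall n x, sh_deg O n.+1 x -> sh_coun O x = 0;
  sh_counl : forall x, \sw_(x1, x2 <- sh_cop O x) sh_coun O x1 *: x2 = x;
  sh_counr : forall x, \sw_(x1, x2 <- sh_cop O x) sh_coun O x2 *: x1 = x;
  sh_antip : exists S : O -> O, [/\ linear S,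
    forall n x, sh_deg O n x -> sh_deg O n (S x),
    forall x, \sw_(x1, x2 <- sh_cop O x) S x1 ∙ x2 = sh_coun O x *: sh_one O &
    forall x, \sw_(x1, x2 <- sh_cop O x) x1 ∙ S x2 = sh_coun O x *: sh_one O]
}.

Section Calculus.
Variables (K : fieldType) (O : shopf_data K).

Definition super_derivation (D : O -> O) :=
  forall x y, D (x ∙ y) = D x ∙ y + sh_par O x ∙ D y.

Definition super_coderivation (D : O -> O) :=
  forall x, sh_cop O (D x) = tmap D id (sh_cop O x) + tmap (sh_par O) D (sh_cop O x).

(* [theta, x} = theta x - (-1)^|x| x theta, for theta of degree 1 *)
Definition graded_comm (theta x : O) : O := theta ∙ x - sh_par O x ∙ theta.

(* j exhibits the Hopf algebra A as the degree 0 component of O. *)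
Record is_degree0 (A : hopf_data K) (j : A -> O) : Prop := IsDegree0 {
  zero_linear : linear j;
  zero_inj : injective j;
  zero_deg : forall x, sh_deg O 0%N x <-> exists a, x = j a;
  zero1 : j 1 = sh_one O;
  zeroM : forall a b, j (a * b) = j a ∙ j b;
  zero_cop : forall a, sh_cop O (j a) = tmap j j (cop a);
  zero_coun : forall a, sh_coun O (j a) = coun a
}.

Record is_aug_inner_calculus (A : hopf_data K) (j : A -> O) (d i : O -> O) :
    Prop := IsAugInnerCalculus {
  calc_super_hopf : is_super_hopf O;
  calc_degree0 : is_degree0 j;
  calc_inner : exists2 theta, sh_deg O 1%N theta & forall x, d x = graded_comm theta x;
  calc_d_linear : linear d;
  calc_d_deg : forall n x, sh_deg O n x -> sh_deg O n.+1 (d x);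
  calc_d_sq : forall x, d (d x) = 0;
  calc_d_der : super_derivation d;
  calc_d_coder : super_coderivation d;
  calc_i_linear : linear i;
  calc_i_deg0 : forall x, sh_deg O 0%N x -> i x = 0;
  calc_i_deg : forall n x, sh_deg O n.+1 x -> sh_deg O n (i x);
  calc_i_sq : forall x, i (i x) = 0;
  calc_i_der : super_derivation i;
  calc_i_coder : super_coderivation i
}.

End Calculus.

Section Smash.
Variables (K : fieldType) (H : hopf_data K) (L : bsuper_data H).

Definition smash_mul (z z' : H ⊗ L) : H ⊗ L :=
  \sw_(a, x <- z) \sw_(b, y <- z') \sw_(b1, b2 <- cop b)
    (a * b1) ⊗ (bs_act L x b2 * y).

Definition smash_cop (z : H ⊗ L) : (H ⊗ L) ⊗ (H ⊗ L) :=
  \sw_(a, x <- z) \sw_(a1, a2 <- cop a) \sw_(x1, x2 <- bs_cop L x)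
    \sw_(x10, x11 <- bs_coact L x1) (a1 ⊗ x10) ⊗ ((a2 * x11) ⊗ x2).

Definition smash_coun (z : H ⊗ L) : K :=
  tlift (Z := K^o) (fun a x => coun a * bs_coun L x) z.

Definition smash_deg n (z : H ⊗ L) : Prop :=
  exists s : seq (H * L), z = \sum_(p <- s) p.1 ⊗ p.2 /\
    forall p, p \in s -> bs_deg L n p.2.

Definition smash : shopf_data K :=
  ShopfData smash_mul (1 ⊗ 1) smash_cop smash_coun smash_deg (tmap id (bs_par L)).

End Smash.

HB.mixin Record Vector_isLie (K : fieldType) V of Vector K V := {
  lbr : V -> V -> V;
  lbr_bilinear : bilinear_map (lbr : (V : lmodType K) -> V -> V);
  lbr_alt : forall x, lbr x x = 0;
  jacobi : forall x y z, lbr x (lbr y z) + lbr y (lbr z x) + lbr z (lbr x y) = 0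
}.
#[short(type="lieAlgType")]
HB.structure Definition LieAlgebra (K : fieldType) :=
  {V of Vector K V & Vector_isLie K V}.

Notation "⟦ x , y ⟧" := (lbr x y) (at level 0, format "⟦ x ,  y ⟧") : ring_scope.

Section Lie.
Variables (K : fieldType) (g : lieAlgType K).

Definition lie_ideal (I : {vspace g}) := forall x y, y \in I -> ⟦x, y⟧ \in I.

Definition lbr_space (I J : {vspace g}) : {vspace g} :=
  <<[seq ⟦x, y⟧ | x <- vbasis I, y <- vbasis J]>>%VS.

Definition lie_solvable (I : {vspace g}) :=
  exists n, iter n (fun J => lbr_space J J) I = 0%VS.

Definition semisimple :=
  forall I : {vspace g}, lie_ideal I -> lie_solvable I -> I = 0%VS.

Definition killing (x y : g) : K :=
  \sum_i coord (vbasis {:g}) i ⟦x, ⟦y, (vbasis {:g})`_i⟧⟧.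

Definition killing_dual_bases n (t t' : 'I_n -> g) :=
  basis_of fullv (codom t) /\ forall i j, killing (t i) (t' j) = (i == j)%:R.

Definition env_relator (z : talg g) : Prop :=
  exists x y : g, z = tgen x * tgen y - tgen y * tgen x - tgen ⟦x, y⟧.

Lemma env_relator_aug z : env_relator z -> augmentation z = 0.
Proof.
by case=> x [y ->]; rewrite !augD !augN !augM !aug_gen mul0r !subr0.
Qed.

Definition env_alg : algType K := qalg (Relators env_relator_aug).
Definition ugen (x : g) : env_alg := qgen _ x.

Definition env : hopf_data K := HopfData
  (qalg_lift (@tmul K env_alg env_alg) (1 ⊗ 1) (fun x => ugen x ⊗ 1 + 1 ⊗ ugen x))
  (qalg_lift *%R (1 : K^o) (fun=> 0))
  (qalg_lift (fun a b : env_alg => b * a) 1 (fun x => - ugen x)).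

Record env_extends : Prop := EnvExtends {
  env_cop_gen : forall x, cop (ugen x : env) = ugen x ⊗ 1 + 1 ⊗ ugen x;
  env_coun_gen : forall x, coun (ugen x : env) = 0;
  env_antip_gen : forall x, antip (ugen x : env) = - ugen x
}.

Variables (n : nat) (t t' : 'I_n -> g).

Definition casimir : env := \sum_i ugen (t i) * ugen (t' i).

(* Lambda^1 = g + Cc, the pair (v, a) standing for v + a c *)
Definition Lambda1_sp : lmodType K := (g * K^o)%type.

(* The right action is an algebra map from U(g) to the opposite of L(Lambda^1,
   Lambda^1), with xi acting by v + a c |-> [v, xi]; on the coaction side,
   v + a c |-> (v + a c) ⊗ 1 + 2 a t. *)
Definition Lambda1 : cmod_data env := CmodData
  (fun (x : Lambda1_sp) (u : env) =>
     qalg_lift (Z := linmap Lambda1_sp Lambda1_sp) (fun F G => tolin (G \o F))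
       (tolin id) (fun xi => tolin (fun x => (⟦x.1, xi⟧, 0))) u x)
  (fun x : Lambda1_sp => x ⊗ (1 : env) +
     \sum_i (2%:R * x.2 : K) *: (((t i, 0) : Lambda1_sp) ⊗ (ugen (t' i) : env))).

Definition Lambda1_g (v : g) : Lambda1 := (v, 0).
Definition Lambda1_c : Lambda1 := (0, 1).

Definition Lambda1_incl (x : Lambda1) : env := ugen x.1 + x.2 *: casimir.

End Lie.

(* Main.v *)
(* Let X be g + Cc, B its quadratic algebra and O = U(g) # B. An identity that is
   linear in a tensor is checked on pure tensors, and one that is linear in an
   element of U(g) or of B is checked on words, by induction on their length.

   The structure maps of B are the algebra maps prescribed on generators. The
   delicate point is that the coaction kills the relators, which needs
   ker (id - Psi) ⊗ U to be the kernel of (id - Psi) ⊗ id; it follows from a map Q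
   with (id - Psi) Q (id - Psi) = id - Psi. For X one takes 1/2 on g ⊗ g, 1 on
   c ⊗ g and 0 on X ⊗ c. The homogeneous components are independent because
   doubling the generators extends to an algebra map, with eigenvalue 2^n in
   degree n.

   The contraction i is the second component of an algebra map from B to O x O,
   where (p, q)(p', q') = (p p', q p' + (-1)^|p| p q'). The relators are killed as
   i(y)_1 ⊗ i(y)_2 = i(y_0) ⊗ y_1 + 1 ⊗ i(y) and the sum of x <| i(y) vanishes over
   any fixed point of Psi. All other properties of i and d = [theta, } are
   identities between odd derivations, hence are checked on generators, and
   d i + i d = [i(theta), ] is formal.

   The Lie algebra enters only through the symmetry and the invariance of t, both
   consequences of the same properties of the Killing form. They make c central
   and give the crossed module condition, the formula for delta c and the
   vanishing needed for i. The inclusion of X in U(g) is injective because c has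
   trace dim g in the adjoint representation, while the adjoint representation
   itself is faithful. *)
Require Import Defs.
From HB Require Import structures.
From mathcomp Require Import all_boot all_order all_algebra.
From mathcomp Require Import generic_quotient ring_quotient.
From mathcomp Require Import boolp functions reals.
From mathcomp Require Import complex ring.

Set Implicit Arguments.
Unset Strict Implicit.
Unset Printing Implicit Defensive.

Import GRing.Theory.
Local Open Scope ring_scope.
Local Open Scope complex_scope.
Local Open Scope quotient_scope.

(** * Tensor calculus *)

(** The order of construction is forced. The coproduct of B is an algebra map into the braided
    tensor square of B, whose product already involves the action and the coaction of B and whose
    associativity rests on the module and comodule algebra laws. So B is first made a crossed module
    algebra, then given its coproduct, and last its antipode, which is not an algebra map but is
    read off one into End(B).

    Psi is in general not an involution on X: on v ⊗ c it is the flip plus 2 s_v, where s_v, the sum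
    of t_i ⊗ [v, t^i], satisfies Psi(s_v) = - s_v. Hence 1/2 alone does not invert id - Psi on its
    image and Q has to treat the c-components separately. An explicit Q also avoids choosing a basis
    of the infinite-dimensional U.

    The crossed module condition enters mostly in its antipode-free form, which is compatible with
    products both in the crossed module and in the acting algebra; this is what makes inductions on
    words possible. Signs are handled through the parity operator, so that vectors only have to be
    split into even and odd parts. *)

Definition trilinear (K : fieldType) (U V W Z : lmodType K) (f : U -> V -> W -> Z) :=
  [/\ forall v w, linear (fun u => f u v w), forall u w, linear (fun v => f u v w)
    & forall u v, linear (f u v)].

Definition quadrilinear (K : fieldType) (T U V W Z : lmodType K)
    (f : T -> U -> V -> W -> Z) :=
  [/\ forall u v w, linear (fun t => f t u v w), forall t v w, linear (fun u => f t u v w),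
      forall t u w, linear (fun v => f t u v w) & forall t u v, linear (f t u v)].

Section LinearMaps.
Variable K : fieldType.
Implicit Types U V W Z : lmodType K.

Lemma lin_id V : linear (fun x : V => x). Proof. by []. Qed.
Lemma lin_eta V W (f : V -> W) : linear f -> linear (fun x => f x). Proof. by []. Qed.
Lemma lin0 V W : linear (fun _ : V => 0 : W).
Proof. by move=> a x y; rewrite scaler0 addr0. Qed.
Lemma lin_comp V W Z (h : W -> Z) (f : V -> W) :
  linear h -> linear f -> linear (fun x => h (f x)).
Proof. by move=> hl fl a x y; rewrite fl hl. Qed.
Lemma linD V W (f h : V -> W) : linear f -> linear h -> linear (fun x => f x + h x).
Proof. by move=> fl hl a x y; rewrite fl hl scalerDr addrACA. Qed.
Lemma linN V W (f : V -> W) : linear f -> linear (fun x => - f x).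
Proof. by move=> fl a x y; rewrite fl opprD scalerN. Qed.
Lemma linZ V W c (f : V -> W) : linear f -> linear (fun x => c *: f x).
Proof. by move=> fl a x y; rewrite fl scalerDr !scalerA mulrC. Qed.
Lemma linZl V W (k : V -> K^o) (w : W) : linear k -> linear (fun x => (k x : K) *: w).
Proof. by move=> kl a x y; rewrite kl scalerDl scalerA. Qed.
Lemma lin_sum V W I (r : seq I) (P : pred I) (f : I -> V -> W) :
  (forall i, linear (f i)) -> linear (fun x => \sum_(i <- r | P i) f i x).
Proof.
move=> fl a x y; rewrite scaler_sumr -big_split; apply: eq_bigr => i _.
exact: fl.
Qed.
Lemma lin_if V W (e : bool) (f h : V -> W) :
  linear f -> linear h -> linear (fun x => if e then f x else h x).
Proof. by case: e. Qed.

Lemma bilinearP V W Z (f : V -> W -> Z) :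
  (forall w, linear (fun v => f v w)) -> (forall v, linear (f v)) -> bilinear_map f.
Proof. by []. Qed.
Lemma bilin_l V W Z (f : V -> W -> Z) w : bilinear_map f -> linear (fun v => f v w).
Proof. by case=> fl _; exact: fl. Qed.
Lemma bilin_r V W Z (f : V -> W -> Z) v : bilinear_map f -> linear (f v).
Proof. by case=> _; exact. Qed.
Lemma bilin_compl U V W Z (f : V -> W -> Z) (h : U -> V) w :
  bilinear_map f -> linear h -> linear (fun u => f (h u) w).
Proof. by move=> /(bilin_l w) fl hl; exact: (lin_comp (h := fun v => f v w) fl hl). Qed.
Lemma bilin_compr U V W Z (f : V -> W -> Z) (h : U -> W) v :
  bilinear_map f -> linear h -> linear (fun u => f v (h u)).
Proof. by move=> /(bilin_r v) fl hl; exact: (lin_comp fl hl). Qed.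
Lemma linMl V (A : algType K) (f : V -> A) a : linear f -> linear (fun x => f x * a).
Proof. by move=> fl; apply: bilin_compl => //; exact: is_alg_bilinear (algType_is_algebra A). Qed.
Lemma linMr V (A : algType K) (f : V -> A) a : linear f -> linear (fun x => a * f x).
Proof. by move=> fl; apply: bilin_compr => //; exact: is_alg_bilinear (algType_is_algebra A). Qed.
Lemma lin_purel U V W (f : U -> V) (w : W) : linear f -> linear (fun x => f x ⊗ w).
Proof. by move=> fl; apply: bilin_compl => //; exact: pure_bilinear. Qed.
Lemma lin_purer U V W (f : U -> W) (v : V) : linear f -> linear (fun x => v ⊗ f x).
Proof. by move=> fl; apply: bilin_compr => //; exact: pure_bilinear. Qed.

(* tlift f z is a finite sum over a representative of z, hence linear in f
   without any assumption on f. *)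
Lemma lin_tliftl U V W Z (f : U -> V -> W -> Z) z :
  (forall v w, linear (fun x => f x v w)) -> linear (fun x => tlift (f x) z).
Proof. by move=> fl; apply: lin_sum => p; exact: fl. Qed.
Lemma lin_tliftr U V W Z (f : V -> W -> Z) (h : U -> V ⊗ W) :
  bilinear_map f -> linear h -> linear (fun x => tlift f (h x)).
Proof. by move=> /tlift_linear fl hl; exact: (lin_comp fl hl). Qed.

Lemma lin_tmap V W V' W' (f : V -> V') (h : W -> W') :
  linear f -> linear h -> linear (tmap f h).
Proof.
move=> fl hl; apply: tlift_linear; split=> [w|v].
  exact: lin_purel.
exact: lin_purer.
Qed.
Lemma lin_tmap_comp U V W V' W' (f : V -> V') (h : W -> W') (z : U -> V ⊗ W) :
  linear f -> linear h -> linear z -> linear (fun x => tmap f h (z x)).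
Proof. by move=> fl hl zl; exact: lin_comp (lin_tmap fl hl) zl. Qed.

Lemma lin_mul (A : algType K) (a : A) : linear ( *%R a).
Proof. exact: linMr (@lin_id A). Qed.
Lemma lin_pure V W (v : V) : linear (pure v : W -> V ⊗ W).
Proof. exact: bilin_r (@pure_bilinear K V W). Qed.
Lemma lin_scale V c : linear ( *:%R c : V -> V).
Proof. exact: linZ (@lin_id V). Qed.
Lemma lin_opp V : linear (-%R : V -> V).
Proof. exact: linN (@lin_id V). Qed.

End LinearMaps.

Create HintDb lin.

Ltac term_head t := lazymatch t with ?f _ => term_head f | _ => t end.

Ltac lin_hyp := match goal with
  | H : GRing.linear_for _ ?g |- GRing.linear_for _ ?f =>
      let hf := term_head f in let hg := term_head g in constr_eq hf hg; exact H
  | H : bilinear_for _ _ ?g |- bilinear_for _ _ ?f =>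
      let hf := term_head f in let hg := term_head g in constr_eq hf hg; exact H
  | H : forall x, GRing.linear_for _ _ |- GRing.linear_for _ _ => exact: H
  | H : forall x y, GRing.linear_for _ _ |- GRing.linear_for _ _ => exact: H
  | H : forall x y z, GRing.linear_for _ _ |- GRing.linear_for _ _ => exact: H
  end.

Ltac lin_fact := solve [lin_hyp | auto 2 with lin nocore].

Ltac lin_fun :=
  lazymatch goal with
  | |- GRing.linear_for _ id => apply: lin_id
  | |- GRing.linear_for _ (GRing.mul _) => apply: lin_mul
  | |- GRing.linear_for _ (pure _) => apply: lin_pure
  | |- GRing.linear_for _ (GRing.scale _) => apply: lin_scale
  | |- GRing.linear_for _ Algebra.opp => apply: lin_opp
  | |- _ => first [lin_fact | apply: bilin_r; lin_fact]
  end.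

(* Calls k on the value of the constant function f, and fails if f is not
   syntactically constant; dispatching on dependence in this way avoids failing
   higher-order unifications, which can be very slow. *)
Ltac with_const f k := lazymatch f with (fun _ => ?c) => k c end.

(** Linearity is proved by recursion on the body of the abstraction. Under a bilinear operation the
    variable may occur on one side only; the leaves are closed by hypotheses or by the [lin]
    hints. *)
Ltac lin :=
  cbv beta;
  lazymatch goal with
  | |- bilinear_for _ _ _ => first [lin_fact | apply: bilinearP => ?; lin]
  | |- trilinear _ => split=> ? ?; lin
  | |- quadrilinear _ => split=> ? ? ?; lin
  | |- GRing.linear_for _ (fun x => x) => apply: lin_id
  | |- GRing.linear_for _ (fun _ => 0) => apply: lin0
  | |- GRing.linear_for _ (fun x => Algebra.add (@?f x) (@?h x)) =>
      apply: (linD (f := f) (h := h)); lin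
  | |- GRing.linear_for _ (fun x => Algebra.opp (@?f x)) => apply: (linN (f := f)); lin
  | |- GRing.linear_for _ (fun x => if _ then _ else _) => apply: lin_if; lin
  | |- GRing.linear_for _ (fun x => bigop.body _ _ _) => apply: lin_sum => ?; lin
  | |- GRing.linear_for _ (fun x => GRing.scale (@?f x) (@?h x)) =>
      first [ with_const f ltac:(fun c => apply: (linZ c (f := h)))
            | with_const h ltac:(fun c => apply: (linZl (k := f) c))]; lin
  | |- GRing.linear_for _ (fun x => GRing.mul (@?f x) (@?h x)) =>
      first [ with_const h ltac:(fun c => apply: (linMl (f := f) c))
            | with_const f ltac:(fun c => apply: (linMr (f := h) c))]; lin
  | |- GRing.linear_for _ (fun x => pure (@?f x) (@?h x)) =>
      first [ with_const h ltac:(fun c => apply: (lin_purel (f := f) c))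
            | with_const f ltac:(fun c => apply: (lin_purer (f := h) c))]; lin
  | |- GRing.linear_for _ (fun x => tlift (@?f x) (@?h x)) =>
      first [ with_const h ltac:(fun c => apply: (lin_tliftl (f := f) c) => ? ?)
            | with_const f ltac:(fun c => apply: (lin_tliftr (f := c) (h := h)))]; lin
  | |- GRing.linear_for _ (fun x => tmap (@?f x) (@?h x) (@?z x)) =>
      first [ with_const f ltac:(fun c => with_const h ltac:(fun c' =>
                apply: (lin_tmap_comp (f := c) (h := c') (z := z))))
            | rewrite /tmap; apply: lin_tliftl => ? ?]; lin
  | |- GRing.linear_for _ (fun x => _) =>
      first [ lin_fact
            | lazymatch goal with
              | |- GRing.linear_for _ (fun x => ?f x) =>
                let _ := constr:(f) in apply: lin_eta; lin_fun
              end
            | lazymatch goal with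
              | |- GRing.linear_for _ (fun x => ?f (@?h x)) =>
                let _ := constr:(f) in apply: (lin_comp (f := h)); [lin_fun | lin]
              end
            | lazymatch goal with
              | |- GRing.linear_for _ (fun x => ?f (@?h x) (@?k x)) =>
                first
                [ with_const k ltac:(fun c => apply: (bilin_compl (f := f) (h := h) c))
                | with_const h ltac:(fun c => apply: (bilin_compr (f := f) (h := k) c))];
                [lin_fact | lin]
              end ]
  | |- GRing.linear_for _ (tlift _) => apply: tlift_linear; lin
  | |- GRing.linear_for _ (tmap _ _) => apply: lin_tmap; lin
  | |- GRing.linear_for _ _ => lin_fun
  end.

Section TensorCalculus.
Variable K : fieldType.
Implicit Types U V W Z : lmodType K.

Lemma tens_eq_ind V W Z (F G : V ⊗ W -> Z) :
  linear F -> linear G -> (forall v w, F (v ⊗ w) = G (v ⊗ w)) -> forall z, F z = G z.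
Proof.
move=> Fl Gl e z; have [s ->] := tensP z.
elim: s => [|p s IH]; first by rewrite big_nil (linear_map0 Fl) (linear_map0 Gl).
rewrite big_cons -[pure _ _]scale1r; have -> := Fl 1 (p.1 ⊗ p.2) (\sum_(q <- s) q.1 ⊗ q.2).
by rewrite Gl IH e.
Qed.

Lemma eq_tlift V W Z (f h : V -> W -> Z) z :
  (forall v w, f v w = h v w) -> tlift f z = tlift h z.
Proof. by move=> e; apply: eq_bigr => p _; exact: e. Qed.

Lemma linear_map_sum V W (h : V -> W) I (r : seq I) (P : pred I) F :
  linear h -> h (\sum_(i <- r | P i) F i) = \sum_(i <- r | P i) h (F i).
Proof.
move=> hl; elim/big_rec2: _ => [|i y x _ <-]; first exact: linear_map0.
by have := hl 1 (F i) x; rewrite !scale1r.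
Qed.

Lemma linear_mapD V W (h : V -> W) x y : linear h -> h (x + y) = h x + h y.
Proof. by move=> hl; have := hl 1 x y; rewrite !scale1r. Qed.

Lemma linear_mapN V W (h : V -> W) x : linear h -> h (- x) = - h x.
Proof. by move=> hl; rewrite -scaleN1r linear_mapZ // scaleN1r. Qed.

Lemma linear_tlift V W Z Z' (h : Z -> Z') (f : V -> W -> Z) z :
  linear h -> h (tlift f z) = tlift (fun v w => h (f v w)) z.
Proof. by move=> hl; exact: linear_map_sum. Qed.

Lemma tlift_eq0 V W Z (f : V -> W -> Z) z :
  (forall v w, f v w = 0) -> tlift f z = 0.
Proof. by move=> e; apply: big1 => p _; exact: e. Qed.

Lemma tlift_exchange V W V' W' Z (f : V -> W -> V' -> W' -> Z) z z' :
  \sw_(v, w <- z) \sw_(v', w' <- z') f v w v' w' =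
  \sw_(v', w' <- z') \sw_(v, w <- z) f v w v' w'.
Proof. exact: exchange_big. Qed.

Lemma tlift_split V W Z (f h : V -> W -> Z) z :
  tlift (fun v w => f v w + h v w) z = tlift f z + tlift h z.
Proof. exact: big_split. Qed.

Lemma tliftD V W Z (f : V -> W -> Z) x y :
  bilinear_map f -> tlift f (x + y) = tlift f x + tlift f y.
Proof. by move=> fb; exact: linear_mapD (tlift_linear fb). Qed.

Lemma tmapE V W V' W' (f : V -> V') (h : W -> W') v w :
  linear f -> linear h -> tmap f h (v ⊗ w) = f v ⊗ h w.
Proof. by move=> fl hl; rewrite /tmap tliftE //; lin. Qed.

Lemma tassoc_linear V W Z : linear (@tassoc K V W Z).
Proof. by rewrite /tassoc; lin. Qed.

Lemma tassocE V W Z (v : V) (w : W) (z : Z) : tassoc ((v ⊗ w) ⊗ z) = v ⊗ (w ⊗ z).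
Proof. by rewrite /tassoc tliftE; [rewrite tliftE //; lin | lin]. Qed.

Lemma tmap_comp V W V' W' V'' W'' (f : V -> V') (h : W -> W')
    (f' : V' -> V'') (h' : W' -> W'') z :
  linear f -> linear h -> linear f' -> linear h' ->
  tmap f' h' (tmap f h z) = tmap (fun v => f' (f v)) (fun w => h' (h w)) z.
Proof.
move=> fl hl f'l h'l; move: z; apply: tens_eq_ind; [lin|lin|] => v w.
by rewrite !tmapE //; lin.
Qed.

Lemma tmap_id V W (z : V ⊗ W) : tmap id id z = z.
Proof. by move: z; apply: tens_eq_ind; [lin|lin|] => v w; rewrite tmapE. Qed.

Lemma pureDl V W (v v' : V) (w : W) : (v + v') ⊗ w = v ⊗ w + v' ⊗ w.
Proof. by rewrite (linear_mapD (h := fun v => v ⊗ w)) //; lin. Qed.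
Lemma pureDr V W (v : V) (w w' : W) : v ⊗ (w + w') = v ⊗ w + v ⊗ w'.
Proof. by rewrite linear_mapD //; lin. Qed.
Lemma pureZl V W a (v : V) (w : W) : (a *: v) ⊗ w = a *: (v ⊗ w).
Proof. by rewrite (linear_mapZ (h := fun v => v ⊗ w)) //; lin. Qed.
Lemma pureZr V W a (v : V) (w : W) : v ⊗ (a *: w) = a *: (v ⊗ w).
Proof. by rewrite linear_mapZ //; lin. Qed.
Lemma pureNl V W (v : V) (w : W) : (- v) ⊗ w = - (v ⊗ w).
Proof. by rewrite -scaleN1r pureZl scaleN1r. Qed.
Lemma pureNr V W (v : V) (w : W) : v ⊗ (- w) = - (v ⊗ w).
Proof. by rewrite -scaleN1r pureZr scaleN1r. Qed.
Lemma pure0l V W (w : W) : (0 : V) ⊗ w = 0.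
Proof. by rewrite -(scale0r 0) pureZl scale0r. Qed.
Lemma pure0r V W (v : V) : v ⊗ (0 : W) = 0.
Proof. by rewrite -(scale0r 0) pureZr scale0r. Qed.

End TensorCalculus.

(* The two sides being linear in the tensor z, it may be assumed to be pure. *)
Tactic Notation "sweedler" constr(z) "as" ident(a) ident(b) :=
  generalize z; apply: tens_eq_ind; [lin | lin | move=> a b].

Ltac pureE := repeat first
  [ rewrite tliftE; [|lin] | rewrite tmapE; [|lin|lin] | rewrite tassocE ].

(* Evaluates the sums over pure tensors that occur inside nested sums. *)
Ltac nested_pure :=
  lazymatch goal with
  | |- tlift ?f (_ ⊗ _) = _ => etransitivity; [apply: tliftE; lin | cbv beta; nested_pure]
  | |- tlift ?f ?z = _ =>
      let a := fresh in let b := fresh in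
      refine (eq_tlift (f := f) z _); intros a b; cbv beta; nested_pure
  | |- _ => reflexivity
  end.

Ltac nested_pureE :=
  etransitivity; [nested_pure | symmetry; etransitivity; [nested_pure | symmetry]].

#[export] Hint Extern 0 (GRing.linear_for _ (@tassoc _ _ _ _)) => exact: tassoc_linear : lin.

Section TensorAlgebras.
Variables (K : fieldType) (A B : algType K).

Lemma tmul_bilinear : bilinear_map (@tmul K A B).
Proof. by rewrite /tmul; lin. Qed.

Lemma tmulE (a c : A) (b d : B) : tmul (a ⊗ b) (c ⊗ d) = (a * c) ⊗ (b * d).
Proof. by rewrite /tmul; pureE. Qed.

Local Hint Extern 0 (bilinear_for _ _ (@tmul _ _ _)) => exact: tmul_bilinear : lin.

Lemma tmul_is_algebra : is_algebra (@tmul K A B) (1 ⊗ 1).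
Proof.
split; first exact: tmul_bilinear.
- move=> x y z; sweedler x as a a'; sweedler y as b b'; sweedler z as c c'.
  by rewrite !tmulE !mulrA.
- by move=> x; sweedler x as a a'; rewrite tmulE !mul1r.
- by move=> x; sweedler x as a a'; rewrite tmulE !mulr1.
Qed.

End TensorAlgebras.

#[export] Hint Extern 0 (bilinear_for _ _ (@tmul _ _ _)) => exact: tmul_bilinear : lin.

Section TensorAssociativity.
Variables (K : fieldType) (V V0 V1 V2 W Z : lmodType K).
Variables (a : V -> V0 ⊗ V1) (b : W -> V1 ⊗ V2) (z : V ⊗ V2) (z' : V0 ⊗ W).
Hypotheses (al : linear a) (bl : linear b).
Hypothesis e : tassoc (tmap a id z) = tmap id b z'.

(** Two maps [a], [b] and two tensors are allowed so that the coassociativity of a Hopf coproduct,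
    of a coaction and of a braided coproduct are all instances. The tensors are fixed, hence an
    induction hypothesis about a single element can serve as [e]. *)
Lemma sw_assoc (f : V0 -> V1 -> V2 -> Z) : trilinear f ->
  \sw_(v, w <- z) \sw_(x, y <- a v) f x y w = \sw_(v, w <- z') \sw_(x, y <- b w) f v x y.
Proof.
case=> f1 f2 f3.
pose g (t : V0 ⊗ (V1 ⊗ V2)) := \sw_(v, w <- t) \sw_(x, y <- w) f v x y.
have gl : linear g by rewrite /g; lin.
transitivity (g (tmap id b z')); last first.
  by sweedler z' as v w; pureE; rewrite /g; pureE.
rewrite -e; sweedler z as v w; pureE.
by sweedler (a v) as x y; pureE; rewrite /g; pureE.
Qed.
End TensorAssociativity.

(** * Spaces and algebras of linear maps *)

Section LinMaps.
Variables (K : fieldType).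
Implicit Types U V W : lmodType K.

Lemma linmap_linear V W (F : linmap V W) : linear F.
Proof. by case: F => F /= /asboolP. Qed.

Lemma linmapP V W (F G : linmap V W) : (forall v, F v = G v) -> F = G.
Proof. by move=> e; apply/val_inj/funext. Qed.

Lemma tolin_app V W (f : V -> W) v : linear f -> tolin f v = f v.
Proof. by move=> fl; rewrite tolinE. Qed.

Lemma linmapDE V W (F G : linmap V W) v : (F + G) v = F v + G v.
Proof. by []. Qed.

Lemma linmapZE V W c (F : linmap V W) v : (c *: F) v = c *: F v.
Proof. by []. Qed.

Lemma linmap_eval V W (v : V) : linear (fun F : linmap V W => F v).
Proof. by []. Qed.

Lemma lin_tolin U V W (f : U -> V -> W) : (forall u, linear (f u)) ->
  (forall v, linear (fun u => f u v)) -> linear (fun u => tolin (f u)).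
Proof. by move=> fl fr a x y; apply: linmapP => v; rewrite linmapDE linmapZE !tolin_app //; exact: fr. Qed.

Lemma linmap_compl U V W (h : U -> linmap V W) v : linear h -> linear (fun u => h u v).
Proof. by move=> hl a x y; rewrite hl. Qed.
End LinMaps.

#[export] Hint Extern 0 (GRing.linear_for _ (linmap_fun _)) => exact: linmap_linear : lin.
#[export] Hint Extern 2 (GRing.linear_for _ (fun x => linmap_fun _ _)) =>
  (apply: linmap_compl; lin) : lin.

Section EndAlgebra.
Variables (K : fieldType) (V : lmodType K).
Implicit Types F G : linmap V V.

Lemma end_is_algebra : is_algebra (fun F G => tolin (F \o G)) (tolin (@id V)).
Proof.
split.
- apply: bilinearP => G; apply: lin_tolin => F; rewrite /comp; lin.
- move=> F G E; apply: linmapP => v.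
  by rewrite !(tolin_app, tolinE) //=; rewrite /comp; lin.
- by move=> F; apply: linmapP => v; rewrite !(tolin_app, tolinE) //=; rewrite /comp; lin.
- by move=> F; apply: linmapP => v; rewrite !(tolin_app, tolinE) //=; rewrite /comp; lin.
Qed.

Lemma endop_is_algebra : is_algebra (fun F G => tolin (G \o F)) (tolin (@id V)).
Proof.
split.
- apply: bilinearP => G; apply: lin_tolin => F; rewrite /comp; lin.
- move=> F G E; apply: linmapP => v.
  by rewrite !(tolin_app, tolinE) //=; rewrite /comp; lin.
- by move=> F; apply: linmapP => v; rewrite !(tolin_app, tolinE) //=; rewrite /comp; lin.
- by move=> F; apply: linmapP => v; rewrite !(tolin_app, tolinE) //=; rewrite /comp; lin.
Qed.
End EndAlgebra.

(** * Induction on words in the generators *)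

Section Words.
Variables (K : fieldType) (V : lmodType K).

Lemma talg_lift_linear (Z : lmodType K) mul one (f : V -> Z) :
  is_algebra mul one -> linear f -> linear (talg_lift mul one f).
Proof.
move=> Za fl a x y; have -> := talg_liftD Za fl (talg_scale a x) y.
by rewrite talg_liftZ.
Qed.

(** The elements of the tensor algebra are separated by their lifts, and every lift gives both sides
    the same value. This turns a representative into an honest noncommutative polynomial, on which
    induction is possible. *)
Lemma talg_words (x : talg V) :
  x = \sum_(p <- repr x) p.1 *: foldr (fun v => *%R (tgen v)) 1 p.2.
Proof.
apply: talg_ext => Z mul one f Za fl; have ll := talg_lift_linear Za fl.
rewrite (linear_map_sum (h := talg_lift mul one f)) //.
apply: eq_bigr => -[a s] _ /=.
rewrite (linear_mapZ (h := talg_lift mul one f)) //.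
congr (_ *: _).
elim: s => [|v s IH] /=; first by rewrite [RHS]talg_lift1.
by rewrite [RHS](talg_liftM Za fl (tgen v)) talg_lift_gen // IH.
Qed.

Variable S : relators V.

(** Formulated for predicates and not only for equations between linear maps: compatibility with the
    action has to be proved for all acting elements at once, since the induction step changes the
    acting element. *)
Lemma qalg_ind (P : qalg S -> Prop) :
  (forall a x y, P x -> P y -> P (a *: x + y)) -> P 0 -> P 1 ->
  (forall v y, P y -> P (qgen S v * y)) -> forall x, P x.
Proof.
move=> PL P0 P1 Pg x; have [u ->] := qalgP x; rewrite (talg_words u).
elim: (repr u) => [|p s IH]; first by rewrite big_nil; have -> : \pi_(qalg S) 0 = 0 by rewrite !piE.
rewrite big_cons qalg_piD [\pi_(qalg S) (_ *: _)]qalg_piZ; apply: PL => //.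
elim: p.2 => [|v w IHw] //=; rewrite [\pi_(qalg S) _]qalg_piM.
exact: Pg.
Qed.

Lemma qalg_eq_ind (Z : lmodType K) (F G : qalg S -> Z) : linear F -> linear G ->
  F 1 = G 1 -> (forall v y, F y = G y -> F (qgen S v * y) = G (qgen S v * y)) ->
  forall x, F x = G x.
Proof.
move=> Fl Gl e1 eg; apply: qalg_ind => // [a x y ex ey|].
  by rewrite Fl Gl ex ey.
by rewrite !linear_map0.
Qed.

End Words.

(** * Hopf algebras and crossed modules *)

#[export] Hint Extern 0 (GRing.linear_for _ (@cop _ _)) =>
  match goal with Hh : is_hopf _ |- _ => exact: (hopf_cop_linear Hh) end : lin.
#[export] Hint Extern 0 (GRing.linear_for _ (@coun _ _)) =>
  match goal with Hh : is_hopf _ |- _ => exact: (hopf_coun_linear Hh) end : lin.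
#[export] Hint Extern 0 (GRing.linear_for _ (@antip _ _)) =>
  match goal with Hh : is_hopf _ |- _ => exact: (hopf_antip_linear Hh) end : lin.
#[export] Hint Extern 0 (bilinear_for _ _ (@act _ _ _)) =>
  match goal with Hc : is_cmod _ |- _ => exact: (cmod_act_bilinear Hc) end : lin.
#[export] Hint Extern 0 (GRing.linear_for _ (@coact _ _ _)) =>
  match goal with Hc : is_cmod _ |- _ => exact: (cmod_coact_linear Hc) end : lin.

Lemma braid_linear (K : fieldType) (H : hopf_data K) (V : cmod_data H) :
  is_cmod V -> linear (@braid K H V).
Proof. by move=> Hc; rewrite /braid; lin. Qed.
#[export] Hint Extern 0 (GRing.linear_for _ (@braid _ _ _)) =>
  match goal with Hc : is_cmod _ |- _ => exact: (braid_linear Hc) end : lin.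

Lemma braidE (K : fieldType) (H : hopf_data K) (V : cmod_data H) (v w : V) :
  is_cmod V -> braid (v ⊗ w) = \sw_(w0, w1 <- coact V w) w0 ⊗ act V v w1.
Proof. by move=> Hc; rewrite /braid; pureE. Qed.

Section Hopf.
Variables (K : fieldType) (H : hopf_data K).
Hypothesis Hh : is_hopf H.

Lemma cop_sw_coassoc (Z : lmodType K) (f : H -> H -> H -> Z) (a : H) : trilinear f ->
  \sw_(a1, a2 <- cop a) \sw_(b, c <- cop a1) f b c a2 =
  \sw_(a1, a2 <- cop a) \sw_(b, c <- cop a2) f a1 b c.
Proof. by apply: sw_assoc; [lin | lin | exact: hopf_coassoc]. Qed.

(** The four legs are regrouped so that the two middle ones come from a single coproduct, which is
    the position where the crossed module condition can be applied. *)
Lemma cop_sw_coassoc4 (Z : lmodType K) (f : H -> H -> H -> H -> Z) (a : H) :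
  quadrilinear f ->
  \sw_(a1, a2 <- cop a) \sw_(b, c <- cop a1) \sw_(d, e <- cop a2) f b c d e =
  \sw_(a1, a2 <- cop a) \sw_(b, e <- cop a2) \sw_(c, d <- cop b) f a1 c d e.
Proof.
case=> f1 f2 f3 f4.
rewrite (cop_sw_coassoc (f := fun b c x => \sw_(d, e <- cop x) f b c d e)); last by lin.
apply: eq_tlift => a1 a2.
by rewrite -(cop_sw_coassoc (f := f a1)) //; lin.
Qed.

Lemma cop_sw_counl (Z : lmodType K) (f : H -> Z) (a : H) : linear f ->
  \sw_(a1, a2 <- cop a) coun a1 *: f a2 = f a.
Proof.
move=> fl; rewrite -[in RHS](hopf_counl Hh a); sweedler (cop a) as b c; pureE.
by rewrite linear_mapZ.
Qed.

Lemma cop_sw_counr (Z : lmodType K) (f : H -> Z) (a : H) : linear f ->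
  \sw_(a1, a2 <- cop a) coun a2 *: f a1 = f a.
Proof.
move=> fl; rewrite -[in RHS](hopf_counr Hh a); sweedler (cop a) as b c; pureE.
by rewrite linear_mapZ.
Qed.

Lemma cop_sw_antipl (Z : lmodType K) (f : H -> Z) (a : H) : linear f ->
  \sw_(a1, a2 <- cop a) f (antip a1 * a2) = coun a *: f 1.
Proof.
move=> fl; rewrite -(linear_mapZ _ _ fl) -(hopf_antipl Hh a).
by sweedler (cop a) as b c; pureE.
Qed.

Lemma cop_sw_antipr (Z : lmodType K) (f : H -> Z) (a : H) : linear f ->
  \sw_(a1, a2 <- cop a) f (a1 * antip a2) = coun a *: f 1.
Proof.
move=> fl; rewrite -(linear_mapZ _ _ fl) -(hopf_antipr Hh a).
by sweedler (cop a) as b c; pureE.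
Qed.

Lemma cop_sw_mul (Z : lmodType K) (f : H -> H -> Z) (a b : H) : bilinear_map f ->
  \sw_(c1, c2 <- cop (a * b)) f c1 c2 =
  \sw_(a1, a2 <- cop a) \sw_(b1, b2 <- cop b) f (a1 * b1) (a2 * b2).
Proof.
move=> fb; rewrite (hopf_copM Hh).
sweedler (cop a) as a1 a2; sweedler (cop b) as b1 b2.
by rewrite tmulE; pureE.
Qed.

Lemma convolution_is_algebra (A : algType K) :
  is_algebra (fun F G : linmap H A => tolin (fun u => \sw_(u1, u2 <- cop u) F u1 * G u2))
    (tolin (fun u : H => (coun u)%:A)).
Proof.
have ml (F G : linmap H A) : linear (fun u => \sw_(u1, u2 <- cop u) F u1 * G u2).
  by lin.
have ol : linear (fun u : H => (coun u)%:A : A) by lin.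
split.
- by apply: bilinearP => G; apply: lin_tolin => F; lin.
- move=> F G E; apply: linmapP => u; rewrite !tolin_app //.
  transitivity (\sw_(u1, u2 <- cop u) \sw_(b, c <- cop u2) F u1 * (G b * E c)).
    apply: eq_tlift => u1 u2; rewrite tolin_app //.
    by sweedler (cop u2) as b c; pureE.
  rewrite -(@cop_sw_coassoc _ (fun u1 b c => F u1 * (G b * E c))); last by lin.
  apply: eq_tlift => u1 u2; rewrite tolin_app //.
  by sweedler (cop u1) as b c; pureE; rewrite mulrA.
- move=> F; apply: linmapP => u; rewrite tolin_app //.
  rewrite -[RHS](@cop_sw_counl _ F); last by lin.
  by apply: eq_tlift => u1 u2; rewrite tolin_app // mulr_algl.
- move=> F; apply: linmapP => u; rewrite tolin_app //.
  rewrite -[RHS](@cop_sw_counr _ F); last by lin.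
  by apply: eq_tlift => u1 u2; rewrite tolin_app // mulr_algr.
Qed.

Variable V : cmod_data H.
Hypothesis Hc : is_cmod V.

Lemma coact_sw_coassoc (Z : lmodType K) (f : V -> H -> H -> Z) (v : V) : trilinear f ->
  \sw_(v0, h <- coact V v) \sw_(v1, h' <- coact V v0) f v1 h' h =
  \sw_(v0, h <- coact V v) \sw_(h1, h2 <- cop h) f v0 h1 h2.
Proof. by apply: sw_assoc; [lin | lin | exact: cmod_coassoc]. Qed.

Lemma coact_sw_coun (Z : lmodType K) (f : V -> Z) (v : V) : linear f ->
  \sw_(v0, v1 <- coact V v) coun v1 *: f v0 = f v.
Proof.
move=> fl; rewrite -[in RHS](cmod_coun Hc v); sweedler (coact V v) as w h; pureE.
by rewrite linear_mapZ.
Qed.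

(* The crossed module condition in its antipode-free form. *)
Lemma cmod_compat_sw (Z : lmodType K) (f : V -> H -> Z) (v : V) (a : H) :
  bilinear_map f ->
  \sw_(a1, a2 <- cop a) \sw_(v0, v1 <- coact V (act V v a2)) f v0 (a1 * v1) =
  \sw_(a1, a2 <- cop a) \sw_(v0, v1 <- coact V v) f (act V v0 a1) (v1 * a2).
Proof.
move=> fb.
(* Expanding the coaction of [act V v a2] by [cmod_compat] puts [antip] of one leg next to the
   preceding leg; after reassociation the two collapse to the counit. *)
pose g (b c d : H) := \sw_(d1, d2 <- cop d) \sw_(v0, v1 <- coact V v)
  f (act V v0 d1) (b * antip c * v1 * d2).
transitivity (\sw_(a1, a2 <- cop a) \sw_(b, c <- cop a2) g a1 b c).
  apply: eq_tlift => a1 a2; rewrite cmod_compat // /g.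
  sweedler (cop a2) as b c; pureE.
  sweedler (cop c) as d1 d2; pureE.
  by sweedler (coact V v) as v0 v1; pureE; rewrite !mulrA.
rewrite -(cop_sw_coassoc (f := g)); last by rewrite /g; lin.
transitivity (\sw_(a1, a2 <- cop a) coun a1 *:
   \sw_(d1, d2 <- cop a2) \sw_(v0, v1 <- coact V v) f (act V v0 d1) (v1 * d2)).
  apply: eq_tlift => a1 a2; pose h x := \sw_(d1, d2 <- cop a2)
    \sw_(v0, v1 <- coact V v) f (act V v0 d1) (x * v1 * d2).
  transitivity (coun a1 *: h 1).
    by rewrite -cop_sw_antipr //; rewrite /h; lin.
  congr (_ *: _); rewrite /h; apply: eq_tlift => d1 d2; apply: eq_tlift => v0 v1.
  by rewrite mul1r.
by rewrite (cop_sw_counl (f := fun a => \sw_(d1, d2 <- cop a) \sw_(v0, v1 <- coact V v) f (act V v0 d1) (v1 * d2))) //; lin.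
Qed.

End Hopf.

(** * Parity and the Koszul sign *)

Section Koszul.
Variables (K : fieldType) (V : lmodType K) (par : V -> V).
Hypotheses (K2 : 2%:R != 0 :> K) (parl : linear par) (parK : involutive par).

(** Parity is recorded by a Boolean, [true] meaning odd: signs depend on the eigenspaces of [par]
    and not on the degree itself. *)
Definition homog e (v : V) := par v = if e then - v else v.
Definition sgn (e : bool) (v : V) := if e then par v else v.

(** Since 2 is invertible and [par] is an involution, each vector is the sum of its even part (v +
    par v)/2 and its odd part (v - par v)/2. *)
Lemma homog_ind (Z : lmodType K) (F G : V -> Z) : linear F -> linear G ->
  (forall e v, homog e v -> F v = G v) -> forall v, F v = G v.
Proof.
move=> Fl Gl e v.
have -> : v = 2%:R^-1 *: (v + par v) + 2%:R^-1 *: (v - par v).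
  rewrite -scalerDr addrACA subrr addr0 -mulr2n -scaler_nat scalerA mulVf //.
  by rewrite scale1r.
have e0 : F (v + par v) = G (v + par v).
  by apply: (e false); rewrite /homog linear_mapD // parK addrC.
have e1 : F (v - par v) = G (v - par v).
  by apply: (e true); rewrite /homog linear_mapD // linear_mapN // parK opprB addrC.
by rewrite Fl Gl (linear_mapZ _ _ Fl) (linear_mapZ _ _ Gl) e0 e1.
Qed.

(** Once the first factor is homogeneous the whole sign can be carried by the second one, which
    therefore may be arbitrary. *)
Lemma koszulE e v w : homog e v -> koszul par (v ⊗ w) = v ⊗ sgn e w.
Proof.
have half (x : V ⊗ V) : 2%:R^-1 *: (x + x) = x.
  by rewrite -mulr2n -scaler_nat scalerA mulVf // scale1r.
move=> hv; rewrite /koszul !tmapE //; try lin; rewrite hv /sgn; case: e {hv}.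
  by rewrite !pureNl opprK subrr add0r half.
by rewrite addrK half.
Qed.

Lemma koszul_linear : linear (koszul par).
Proof. by rewrite /koszul; lin. Qed.

Lemma sgn_linear e : linear (sgn e).
Proof. by rewrite /sgn; lin. Qed.

Lemma sgn_addb e e' v : sgn (e (+) e') v = sgn e (sgn e' v).
Proof. by case: e e' => -[] //=; rewrite /sgn parK. Qed.

Lemma homogN e v : homog e v -> homog e (par v).
Proof. by rewrite /homog => hv; rewrite parK hv; case: e {hv}; rewrite ?opprK. Qed.

End Koszul.

#[export] Hint Extern 0 (GRing.linear_for _ (koszul _)) => (apply: koszul_linear; lin_fact) : lin.
#[export] Hint Extern 0 (GRing.linear_for _ (sgn _ _)) => (apply: sgn_linear; lin_fact) : lin.

(** Sweedler form of the colinearity of a coproduct. It speaks of bare maps at one element [x], so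
    that it applies to an induction hypothesis while colinearity is still being proved. *)
Lemma cop_coact_sw (K : fieldType) (H : hopf_data K) (A Z : lmodType K)
    (c : A -> A ⊗ A) (d : A -> A ⊗ H) (f : A -> A -> H -> Z) x :
  linear c -> linear d ->
  tmap c id (d x) = \sw_(y, z <- c x) \sw_(y0, y1 <- d y)
    \sw_(z0, z1 <- d z) (y0 ⊗ z0) ⊗ (y1 * z1) -> trilinear f ->
  \sw_(z0, z1 <- d x) \sw_(p, q <- c z0) f p q z1 =
  \sw_(p, q <- c x) \sw_(p0, p1 <- d p) \sw_(q0, q1 <- d q) f p0 q0 (p1 * q1).
Proof.
move=> cl dl e [f1 f2 f3].
pose F (t : (A ⊗ A) ⊗ H) := \sw_(w, h <- t) \sw_(p, q <- w) f p q h.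
have Fl : linear F by rewrite /F; lin.
transitivity (F (tmap c id (d x))).
  by sweedler (d x) as z0 z1; pureE; rewrite /F; pureE.
rewrite e; sweedler (c x) as p q; pureE.
sweedler (d p) as p0 p1; sweedler (d q) as q0 q1; pureE.
by rewrite /F; pureE.
Qed.

(** Converse of [cmod_compat_sw]: applying the antipode of an additional leg from the left cancels
    the factor [a1] and recovers the condition with the antipode. *)
Lemma cmod_compat_of_sw (K : fieldType) (H : hopf_data K) (V : cmod_data H) :
  is_hopf H -> bilinear_map (act V) -> linear (coact V) ->
  (forall (v : V) (a : H),
    \sw_(a1, a2 <- cop a) \sw_(v0, v1 <- coact V (act V v a2)) v0 ⊗ (a1 * v1) =
    \sw_(a1, a2 <- cop a) \sw_(v0, v1 <- coact V v) act V v0 a1 ⊗ (v1 * a2)) ->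
  forall (v : V) (a : H), coact V (act V v a) =
    \sw_(a1, a23 <- tmap id cop (cop a)) \sw_(a2, a3 <- a23)
      \sw_(v0, v1 <- coact V v) act V v0 a2 ⊗ (antip a1 * v1 * a3).
Proof.
move=> Hh ab cl e v a; symmetry.
transitivity (\sw_(a1, a2 <- cop a) tmap id ( *%R (antip a1))
  (\sw_(b, c <- cop a2) \sw_(v0, v1 <- coact V v) act V v0 b ⊗ (v1 * c))).
  sweedler (cop a) as a1 a2; pureE; sweedler (cop a2) as b c; pureE.
  by sweedler (coact V v) as v0 v1; pureE; rewrite mulrA.
pose g (b c d : H) := \sw_(v0, v1 <- coact V (act V v d)) v0 ⊗ ((antip b * c) * v1).
transitivity (\sw_(a1, a2 <- cop a) \sw_(b, c <- cop a2) g a1 b c).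
  apply: eq_tlift => a1 a2; rewrite -e /g; sweedler (cop a2) as b c; pureE.
  by sweedler (coact V (act V v c)) as v0 v1; pureE; rewrite mulrA.
rewrite -(cop_sw_coassoc Hh (f := g)); last by rewrite /g; lin.
transitivity (\sw_(a1, a2 <- cop a) coun a1 *: coact V (act V v a2)).
  apply: eq_tlift => a1 a2.
  rewrite (cop_sw_antipl Hh (f := fun x => \sw_(v0, v1 <- coact V (act V v a2)) v0 ⊗ (x * v1))); last by lin.
  by congr (_ *: _); sweedler (coact V (act V v a2)) as v0 v1; pureE; rewrite mul1r.
by rewrite (cop_sw_counl Hh (f := fun a => coact V (act V v a))) //; lin.
Qed.

(** These are the laws needed for the braided tensor square to be an associative algebra. They are
    kept apart from [is_braided_super_hopf] because this associativity must be known before the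
    coproduct can be defined as an algebra map. *)
Record super_cmod_alg (K : fieldType) (H : hopf_data K) (A : algType K)
    (act : A -> H -> A) (coact : A -> A ⊗ H) (par : A -> A) : Prop := SuperCmodAlg {
  sca_cmod : is_cmod (CmodData act coact);
  sca_act1 : forall u, act 1 u = (coun u)%:A;
  sca_actM : forall x y u, act (x * y) u = \sw_(u1, u2 <- cop u) act x u1 * act y u2;
  sca_coact1 : coact 1 = 1 ⊗ 1;
  sca_coactM : forall x y, coact (x * y) = tmul (coact x) (coact y);
  sca_par : linear par;
  sca_parK : involutive par;
  sca_par1 : par 1 = 1;
  sca_parM : forall x y, par (x * y) = par x * par y;
  sca_act_par : forall x u, act (par x) u = par (act x u);
  sca_coact_par : forall x, coact (par x) = tmap par id (coact x)
}.

(** * The braided-super tensor square *)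

Section BraidedTensorSquare.
Variables (K : fieldType) (H : hopf_data K) (A : algType K).
Variables (Act : A -> H -> A) (Coact : A -> A ⊗ H) (par : A -> A).
Hypotheses (K2 : 2%:R != 0 :> K) (Hh : is_hopf H) (HA : super_cmod_alg Act Coact par).

Let X := CmodData Act Coact.
Let Hc : is_cmod X := sca_cmod HA.
Let actb : bilinear_map Act := cmod_act_bilinear Hc.
Let coactl : linear Coact := cmod_coact_linear Hc.
Let parl := sca_par HA.
Let actM : forall x a b, Act x (a * b) = Act (Act x a) b := cmod_actM Hc.
Let actr1 : forall x, Act x 1 = x := cmod_act1 Hc.
Local Notation bmul := (bs_tmul Act Coact par).

Lemma bs_tmul_bilinear : bilinear_map bmul.
Proof. by rewrite /bs_tmul; lin. Qed.
Local Hint Extern 0 (bilinear_for _ _ (bs_tmul _ _ _)) => exact: bs_tmul_bilinear : lin.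

Lemma bs_tmulE e a b c d : homog par e b -> bmul (a ⊗ b) (c ⊗ d) =
  \sw_(c0, c1 <- Coact (sgn par e c)) (a * c0) ⊗ (Act b c1 * d).
Proof.
move=> hb; rewrite /bs_tmul; pureE; rewrite (koszulE K2 parl c hb) braidE //=.
by sweedler (Coact (sgn par e c)) as c0 c1; pureE.
Qed.

Lemma sgnM e x y : sgn par e (x * y) = sgn par e x * sgn par e y.
Proof. by case: e => //=; exact: (sca_parM HA). Qed.

Lemma coact_sgn e x : Coact (sgn par e x) = tmap (sgn par e) id (Coact x).
Proof. by case: e; [exact: sca_coact_par HA x | exact/esym/tmap_id]. Qed.

Lemma coact_sw_mul (Z : lmodType K) (f : A -> H -> Z) x y : bilinear_map f ->
  \sw_(c, h <- Coact (x * y)) f c h =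
  \sw_(x0, x1 <- Coact x) \sw_(y0, y1 <- Coact y) f (x0 * y0) (x1 * y1).
Proof.
move=> fb; rewrite (sca_coactM HA).
sweedler (Coact x) as x0 x1; sweedler (Coact y) as y0 y1.
by rewrite tmulE; pureE.
Qed.

Lemma homogM e e' x y : homog par e x -> homog par e' y -> homog par (e (+) e') (x * y).
Proof.
rewrite /homog (sca_parM HA) => -> ->.
by case: e e' => -[] //=; rewrite ?mulrNN ?mulrN ?mulNr.
Qed.

Lemma homog_act e x u : homog par e x -> homog par e (Act x u).
Proof.
rewrite /homog -(sca_act_par HA) => ->; case: e => //.
by rewrite (linear_mapN (h := fun x => Act x u)) //; lin.
Qed.

(** On one side [p] is coacted on twice, once for each of [b] and [d]; on the other it is coacted on
    once and its leg acts on the product of [d] with the image of [b]. Coassociativity of the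
    coaction and the module algebra law identify the two, and the signs combine as [e (+) e']. *)
Lemma bs_tmulA : associative bmul.
Proof.
move=> x y z; sweedler x as a b; sweedler y as c d; sweedler z as p q.
move: d; apply: (homog_ind K2 parl (sca_parK HA)); [lin | lin | move=> e' d hd].
move: b; apply: (homog_ind K2 parl (sca_parK HA)); [lin | lin | move=> e b hb].
rewrite (bs_tmulE a c d hb) (bs_tmulE c p q hd).
rewrite (linear_tlift (h := bmul (a ⊗ b))); last by lin.
rewrite (linear_tlift (h := fun t => bmul t (p ⊗ q))); last by lin.
set c' := sgn par e c; set p' := sgn par (e (+) e') p.
transitivity (\sw_(c0, c1 <- Coact c') \sw_(p0, p1 <- Coact p')
  \sw_(p00, p01 <- Coact p0) (a * (c0 * p00)) ⊗ (Act b (c1 * p01) * (Act d p1 * q))).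
  transitivity (\sw_(p0, p1 <- Coact (sgn par e' p)) \sw_(c0, c1 <- Coact c')
    \sw_(p00, p01 <- Coact (sgn par e p0)) (a * (c0 * p00)) ⊗ (Act b (c1 * p01) * (Act d p1 * q))).
    apply: eq_tlift => p0 p1; rewrite (bs_tmulE _ _ _ hb) sgnM coact_sw_mul //; lin.
  sweedler (Coact c') as c0 c1; pureE.
  rewrite /p' (sgn_addb (sca_parK HA)) [in RHS]coact_sgn.
  sweedler (Coact (sgn par e' p)) as p0 p1; pureE.
  by [].
apply: eq_tlift => c0 c1; rewrite (bs_tmulE _ _ _ (homogM (homog_act c1 hb) hd)).
rewrite (coact_sw_coassoc Hh Hc (f := fun p0 h1 h2 =>
  (a * (c0 * p0)) ⊗ (Act b (c1 * h1) * (Act d h2 * q)))); last by lin.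
apply: eq_tlift => p0 p1; rewrite (sca_actM HA).
sweedler (cop p1) as h1 h2; pureE.
by rewrite !mulrA actM.
Qed.

Lemma homog1 : homog par false 1.
Proof. exact: sca_par1 HA. Qed.

Lemma bs_tmul1l a c d : bmul (a ⊗ 1) (c ⊗ d) = (a * c) ⊗ d.
Proof.
rewrite (bs_tmulE _ _ _ homog1) /sgn.
transitivity (\sw_(c0, c1 <- Coact c) coun c1 *: ((a * c0) ⊗ d)).
  by apply: eq_tlift => c0 c1; rewrite (sca_act1 HA) mulr_algl pureZr.
by rewrite (coact_sw_coun Hh Hc (f := fun c => (a * c) ⊗ d)) //; lin.
Qed.

Lemma bs_tmul1r a b d : bmul (a ⊗ b) (1 ⊗ d) = a ⊗ (b * d).
Proof.
move: b; apply: (homog_ind K2 parl (sca_parK HA)); [lin | lin | move=> e b hb].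
have s1 : sgn par e 1 = 1 by case: e {hb} => //; exact: sca_par1 HA.
by rewrite (bs_tmulE _ _ _ hb) s1 (sca_coact1 HA); pureE; rewrite mulr1 actr1.
Qed.

Lemma bs_tmul_is_algebra : is_algebra bmul (1 ⊗ 1).
Proof.
split; first exact: bs_tmul_bilinear; first exact: bs_tmulA.
- by move=> x; sweedler x as a b; rewrite bs_tmul1l mul1r.
- by move=> x; sweedler x as a b; rewrite bs_tmul1r mulr1.
Qed.

End BraidedTensorSquare.

(** * The quadratic algebra of a crossed module *)

#[export] Hint Extern 0 (GRing.linear_for _ (@bgen _ _ _)) => exact: qgen_linear : lin.
#[export] Hint Extern 0 (GRing.linear_for _ (@qgen _ _ _)) => exact: qgen_linear : lin.

(* A generalised inverse Q of id - braid makes the kernel of id - braid stable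
   under - ⊗ H, so that the coaction passes to the quadratic algebra. *)
Definition braid_regular (K : fieldType) (H : hopf_data K) (X : cmod_data H) :=
  exists2 Q : X ⊗ X -> X ⊗ X, linear Q &
    forall z, Q (z - braid z) - braid (Q (z - braid z)) = z - braid z.

Section QuadraticAlgebra.
Variables (K : fieldType) (H : hopf_data K) (X : cmod_data H).
Hypotheses (Hh : is_hopf H) (Hc : is_cmod X).

Local Notation B := (Bquad_alg X).
Local Notation bg := (@bgen K H X).
Local Notation S := (Relators (@quad_relator_aug K H X)).

(** The common interface for maps out of the quadratic algebra: for each structure map, only the
    fixed points of the braiding remain to be examined. *)
Lemma quad_relator_lift (Z : lmodType K) mul one (f : X -> Z) :
  is_algebra mul one -> linear f ->
  (forall w : X ⊗ X, braid w = w -> \sw_(x, y <- w) mul (f x) (f y) = 0) ->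
  forall z, relator S z -> talg_lift mul one f z = 0.
Proof.
move=> Za fl fw z [w [/eqP]]; rewrite subr_eq0 => /eqP/esym/fw e ->.
have ll := talg_lift_linear Za fl.
rewrite (linear_tlift (h := talg_lift mul one f)) // -[RHS]e.
apply: eq_tlift => x y; rewrite [LHS](talg_liftM Za fl (tgen x) (tgen y)).
by rewrite !talg_lift_gen.
Qed.

Lemma bgen_rel (w : X ⊗ X) : braid w = w -> \sw_(x, y <- w) bg x * bg y = 0.
Proof.
move=> e;
pose p (z : talg X) : B := \pi_(qalg S) z.
have pl : linear p.
  by move=> a x y; rewrite /p qalg_piD [\pi_(qalg S) (_ *: _)]qalg_piZ.
transitivity (p (\sw_(x, y <- w) tgen x * tgen y)).
  rewrite (linear_tlift (h := p)) //; apply: eq_tlift => x y.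
  by rewrite /p [RHS]qalg_piM.
have <- : p 0 = 0 by rewrite (linear_map0 pl).
apply/qalg_eqP; rewrite subr0 -[X in ideal_of _ X]mulr1 -[X in ideal_of _ X]mul1r mulrA.
by apply: IdealM; exists w; rewrite e subrr.
Qed.

Section Scaling.
Variable c : K.

(** The grading automorphisms, acting by [c ^+ n] in degree n. The value -1 gives the parity, the
    value 2 separates the degrees. *)
Definition Bscale : B -> B := qalg_lift *%R 1 (fun x => c *: bg x).

Let Ba := algType_is_algebra B.
Let scl : linear (fun x => c *: bg x).
Proof. by lin. Qed.
Let screl z : relator S z -> talg_lift *%R 1 (fun x => c *: bg x) z = 0.
Proof.
apply: quad_relator_lift => // w e.
transitivity ((c * c) *: (\sw_(x, y <- w) bg x * bg y)).
  rewrite (linear_tlift (h := GRing.scale (c * c))); last by lin.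
  by apply: eq_tlift => x y; rewrite -scalerAl -scalerAr scalerA.
by rewrite bgen_rel // scaler0.
Qed.

Lemma Bscale_linear : linear Bscale. Proof. exact: qalg_lift_linear. Qed.
Lemma Bscale1 : Bscale 1 = 1. Proof. exact: qalg_lift1. Qed.
Lemma BscaleM x y : Bscale (x * y) = Bscale x * Bscale y. Proof. exact: qalg_liftM. Qed.
Lemma Bscale_gen x : Bscale (bg x) = c *: bg x. Proof. exact: qalg_lift_gen. Qed.

End Scaling.

Local Notation par := (@Bquad_par K H X).

Lemma Bquad_parE : par = Bscale (-1).
Proof. by rewrite /par /Bscale; congr qalg_lift; apply/funext => x; rewrite scaleN1r. Qed.

Lemma Bpar_linear : linear par. Proof. by rewrite Bquad_parE; exact: Bscale_linear. Qed.
Lemma Bpar1 : par 1 = 1. Proof. by rewrite Bquad_parE Bscale1. Qed.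
Lemma BparM x y : par (x * y) = par x * par y.
Proof. by rewrite Bquad_parE BscaleM. Qed.
Lemma Bpar_gen x : par (bg x) = - bg x.
Proof. by rewrite Bquad_parE Bscale_gen scaleN1r. Qed.
Hint Extern 0 (GRing.linear_for _ (@Bquad_par _ _ _)) => exact: Bpar_linear : lin.

Lemma BparK : involutive par.
Proof.
apply: qalg_eq_ind => [|||v y IH]; [lin | lin | by rewrite !Bpar1 |].
by rewrite !BparM IH Bpar_gen (linear_mapN _ Bpar_linear) Bpar_gen opprK.
Qed.

(** Psi is linear for the diagonal action, by the crossed module condition. Its fixed points
    therefore form a submodule, and the action passes to B. *)
Lemma braid_act (w : X ⊗ X) (u : H) :
  braid (\sw_(x, y <- w) \sw_(u1, u2 <- cop u) act X x u1 ⊗ act X y u2) =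
  \sw_(x, y <- braid w) \sw_(u1, u2 <- cop u) act X x u1 ⊗ act X y u2.
Proof.
sweedler w as x y; pureE; rewrite braidE //.
rewrite (linear_tlift (h := @braid K H X)); last by lin.
pose f y0 (h : H) : X ⊗ X := y0 ⊗ act X x h.
transitivity (\sw_(u1, u2 <- cop u) \sw_(y0, y1 <- coact X (act X y u2)) f y0 (u1 * y1)).
  apply: eq_tlift => u1 u2; rewrite braidE //; apply: eq_tlift => y0 y1.
  by rewrite /f cmod_actM.
rewrite (cmod_compat_sw Hh Hc); last by rewrite /f; lin.
rewrite /f; sweedler (coact X y) as y0 y1; pureE.
by sweedler (cop u) as u1 u2; pureE; rewrite cmod_actM.
Qed.

(** Psi is also colinear for the diagonal coaction. Here this only says that the coaction of a fixed
    tensor is fixed by Psi ⊗ id; that such a tensor is killed in B ⊗ H is where [braid_regular] is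
    required. *)
Lemma braid_coact (w : X ⊗ X) :
  tmap (@braid K H X) id (\sw_(x, y <- w) \sw_(x0, x1 <- coact X x)
     \sw_(y0, y1 <- coact X y) (x0 ⊗ y0) ⊗ (x1 * y1)) =
  \sw_(x, y <- braid w) \sw_(x0, x1 <- coact X x)
     \sw_(y0, y1 <- coact X y) (x0 ⊗ y0) ⊗ (x1 * y1).
Proof.
sweedler w as x y; pureE; rewrite braidE //.
pose f (y0 : X) (h h' : H) : (X ⊗ X) ⊗ H :=
  \sw_(z0, z1 <- coact X (act X x h')) (y0 ⊗ z0) ⊗ (h * z1).
pose f' (y0 : X) (h h' : H) : (X ⊗ X) ⊗ H :=
  \sw_(x0, x1 <- coact X x) (y0 ⊗ act X x0 h) ⊗ (x1 * h').
symmetry; transitivity (\sw_(y0, h <- coact X y) \sw_(y1, h' <- coact X y0) f y1 h' h).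
  by rewrite /f; sweedler (coact X y) as y0 y1; pureE.
rewrite (coact_sw_coassoc Hh Hc); last by rewrite /f; lin.
transitivity (\sw_(y0, h <- coact X y) \sw_(h1, h2 <- cop h) f' y0 h1 h2).
  apply: eq_tlift => y0 h; rewrite /f /f'.
  by rewrite (cmod_compat_sw Hh Hc (f := fun z0 h => (y0 ⊗ z0) ⊗ h)) //; lin.
rewrite -(coact_sw_coassoc Hh Hc); last by rewrite /f'; lin.
rewrite /f'; sweedler (coact X y) as y0 y1; pureE.
rewrite (linear_tlift (h := tmap _ _)); last by lin.
sweedler (coact X x) as x0 x1; pureE; rewrite braidE //.
by sweedler (coact X y0) as z0 z1; pureE.
Qed.

Section Action.
Local Notation conv := (fun F G : linmap H B =>
  tolin (fun u => \sw_(u1, u2 <- cop u) F u1 * G u2)).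
Local Notation cone := (tolin (fun u : H => (coun u)%:A : B)).
Local Notation cgen := (fun x => tolin (fun u => bg (act X x u))).
Let Ca := convolution_is_algebra Hh B.

Let cl : linear cgen.
Proof. by apply: lin_tolin => x; lin. Qed.

Let crel z : relator S z -> talg_lift conv cone cgen z = 0.
Proof.
apply: (quad_relator_lift Ca cl) => w e; apply: linmapP => u.
rewrite (linear_tlift (h := fun F : linmap H B => F u)) //.
pose m (z : X ⊗ X) := \sw_(x, y <- z) bg x * bg y.
have := @bgen_rel (\sw_(x, y <- w) \sw_(u1, u2 <- cop u) act X x u1 ⊗ act X y u2).
have -> : (0 : linmap H B) u = 0 by [].
rewrite braid_act e => /(_ erefl) <-.
rewrite [RHS](linear_tlift (h := m)); last by rewrite /m; lin.
apply: eq_tlift => x y; rewrite tolin_app; last by lin.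
rewrite [RHS](linear_tlift (h := m)); last by rewrite /m; lin.
apply: eq_tlift => u1 u2; rewrite /m !tolin_app; try lin.
by pureE.
Qed.

Lemma Bact_bilinear : bilinear_map (@Bquad_act K H X).
Proof.
apply: bilinearP => u.
  by move=> a x y; rewrite /Bquad_act (qalg_lift_linear Ca cl crel).
exact: linmap_linear.
Qed.

Lemma Bact1 u : Bquad_act (1 : B) u = (coun u)%:A.
Proof. by rewrite /Bquad_act (qalg_lift1 Ca cl crel) tolin_app //; lin. Qed.

Lemma BactM (x y : B) u :
  Bquad_act (x * y) u = \sw_(u1, u2 <- cop u) Bquad_act x u1 * Bquad_act y u2.
Proof. by rewrite /Bquad_act (qalg_liftM Ca cl crel) tolin_app //; lin. Qed.

Lemma Bact_gen x u : Bquad_act (bg x) u = bg (act X x u).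
Proof. by rewrite /Bquad_act (qalg_lift_gen Ca cl crel) tolin_app //; lin. Qed.

End Action.

Hypothesis flat : braid_regular X.

Section Coaction.
Local Notation cgen := (fun x => tmap bg (@id H) (coact X x)).
Let Ta := tmul_is_algebra B H.
Let cl : linear cgen.
Proof. by lin. Qed.

Let crel z : relator S z -> talg_lift (@tmul K B H) (1 ⊗ 1) cgen z = 0.
Proof.
apply: quad_relator_lift => // w e.
have [Q Ql FQF] := flat.
pose F (z : X ⊗ X) := z - braid z.
have Fl : linear F by rewrite /F; lin.
pose m (z : X ⊗ X) := \sw_(x, y <- z) bg x * bg y.
have ml : linear m by rewrite /m; lin.
(* The difference of z0 and [Q (F z0)] is fixed by Psi, hence killed by the product [m] of B. So [m]
   factors through [F], and [tmap m id] kills everything that [tmap F id] kills. *)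
have mQF z0 : m z0 = m (Q (F z0)).
  apply/eqP; rewrite -subr_eq0; apply/eqP.
  rewrite -(linear_mapN _ ml) -(linear_mapD _ _ ml) /m bgen_rel //.
  apply/eqP; rewrite -subr_eq0 -oppr_eq0 opprB -/(F _) (linear_mapD _ _ Fl) (linear_mapN _ Fl).
  by rewrite /F FQF subrr.
pose D := \sw_(x, y <- w) \sw_(x0, x1 <- coact X x) \sw_(y0, y1 <- coact X y)
   (x0 ⊗ y0) ⊗ (x1 * y1).
have FD : tmap F id D = 0.
  have -> : tmap F id D = D - tmap (@braid K H X) id D.
    by sweedler D as a b; pureE; rewrite /F pureDl pureNl.
  by rewrite /D braid_coact e subrr.
transitivity (tmap m id D).
  rewrite (linear_tlift (h := tmap m id)); last by lin.
  apply: eq_tlift => x y; sweedler (coact X x) as x0 x1; pureE.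
  sweedler (coact X y) as y0 y1; pureE.
  by rewrite tmulE /m; pureE.
transitivity (tmap (fun z => m (Q z)) id (tmap F id D)).
  rewrite tmap_comp //; try lin.
  by apply: eq_tlift => a b; rewrite -mQF.
by rewrite FD linear_map0 //; lin.
Qed.

Lemma Bcoact_linear : linear (@Bquad_coact K H X).
Proof. exact: qalg_lift_linear Ta cl crel. Qed.

Lemma Bcoact1 : Bquad_coact (1 : B) = 1 ⊗ 1.
Proof. exact: qalg_lift1 Ta cl crel. Qed.

Lemma BcoactM (x y : B) : Bquad_coact (x * y) = tmul (Bquad_coact x) (Bquad_coact y).
Proof. exact: qalg_liftM Ta cl crel _ _. Qed.

Lemma Bcoact_gen x : Bquad_coact (bg x) = tmap bg id (coact X x).
Proof. exact: qalg_lift_gen Ta cl crel _. Qed.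

End Coaction.
End QuadraticAlgebra.

(** * The quadratic algebra as a crossed module *)

Section QuadraticCrossedModule.
Variables (K : fieldType) (H : hopf_data K) (X : cmod_data H).
Hypotheses (Hh : is_hopf H) (Hc : is_cmod X).
Hypothesis flat : braid_regular X.

Local Notation B := (Bquad_alg X).
Local Notation bg := (@bgen K H X).
Local Notation par := (@Bquad_par K H X).
Local Notation Act := (@Bquad_act K H X).
Local Notation Coact := (@Bquad_coact K H X).
Let parl : linear par := @Bpar_linear K H X.
Let actb : bilinear_map Act := Bact_bilinear Hh Hc.
Let coactl : linear Coact := Bcoact_linear Hh Hc flat.
Let actM := BactM Hh Hc.
Let act_gen := Bact_gen Hh Hc.
Let coactM := BcoactM Hh Hc flat.
Let coact_gen := Bcoact_gen Hh Hc flat.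

Lemma Bact_one (x : B) : Act x 1 = x.
Proof.
move: x; apply: qalg_eq_ind => [|||v y IH]; [lin | by [] | |].
  by rewrite Bact1 // hopf_coun1 // scale1r.
by rewrite actM (hopf_cop1 Hh); pureE; rewrite IH act_gen cmod_act1.
Qed.

Lemma Bact_mul (x : B) a b : Act x (a * b) = Act (Act x a) b.
Proof.
move: x a b; apply: qalg_ind => [c x y ex ey a b|a b|a b|v y IH a b].
- by rewrite !(bilin_l _ actb) ex ey.
- by rewrite !(linear_map0 (bilin_l _ actb)).
- by rewrite !Bact1 // hopf_counM // (linear_mapZ _ _ (bilin_l _ actb)) Bact1 // scalerA.
rewrite !actM (cop_sw_mul Hh); last by lin.
rewrite (linear_tlift (h := Act^~ b)); last by lin.
apply: eq_tlift => a1 a2; rewrite actM; apply: eq_tlift => b1 b2.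
by rewrite IH !act_gen cmod_actM.
Qed.

Lemma Bcoact_coassoc (x : B) :
  tassoc (tmap Coact id (Coact x)) = tmap id cop (Coact x).
Proof.
move: x; apply: qalg_eq_ind => [|||v y IH]; [lin | lin | |].
  by rewrite Bcoact1 //; pureE; rewrite Bcoact1 // (hopf_cop1 Hh); pureE.
(* [m3] is the product of B ⊗ (H ⊗ H). Both sides are multiplicative for it, which leaves only the
   generators. *)
pose m3 (z z' : B ⊗ (H ⊗ H)) := \sw_(a, p <- z) \sw_(b, q <- z') (a * b) ⊗ tmul p q.
have m3b : bilinear_map m3 by rewrite /m3; lin.
have lM (x x' : B) : tassoc (tmap Coact id (Coact (x * x'))) =
    m3 (tassoc (tmap Coact id (Coact x))) (tassoc (tmap Coact id (Coact x'))).
  rewrite coactM; sweedler (Coact x) as x0 x1; sweedler (Coact x') as y0 y1.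
  rewrite tmulE; pureE; rewrite coactM.
  sweedler (Coact x0) as a b; sweedler (Coact y0) as c d.
  by rewrite tmulE; pureE; rewrite /m3; pureE; rewrite tmulE.
have rM (x x' : B) : tmap id cop (Coact (x * x')) =
    m3 (tmap id cop (Coact x)) (tmap id cop (Coact x')).
  rewrite coactM; sweedler (Coact x) as x0 x1; sweedler (Coact x') as y0 y1.
  by rewrite tmulE; pureE; rewrite (hopf_copM Hh) /m3; pureE.
rewrite lM rM IH; congr m3; rewrite coact_gen.
transitivity (tmap bg id (tassoc (tmap (coact X) id (coact X v)))).
  sweedler (coact X v) as w h; pureE; rewrite coact_gen.
  by sweedler (coact X w) as w' h'; pureE.
by rewrite cmod_coassoc //; sweedler (coact X v) as w h; pureE.
Qed.

Lemma Bcoact_coun (x : B) : \sw_(x0, x1 <- Coact x) coun x1 *: x0 = x.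
Proof.
move: x; apply: qalg_eq_ind => [|||v y IH]; [lin | by [] | |].
  by rewrite Bcoact1 //; pureE; rewrite hopf_coun1 // scale1r.
rewrite -[in RHS]IH coactM coact_gen -[in RHS](cmod_coun Hc v).
sweedler (coact X v) as v0 v1; sweedler (Coact y) as y0 y1.
pureE; rewrite tmulE; pureE; rewrite hopf_counM //.
by rewrite (linear_mapZ _ _ (@qgen_linear _ _ _)) -scalerAl -scalerAr scalerA.
Qed.

Lemma Bact_par (x : B) u : Act (par x) u = par (Act x u).
Proof.
move: x u; apply: qalg_ind => [c x y ex ey u|u|u|v y IH u].
- by rewrite parl !(bilin_l _ actb) ex ey parl.
- by rewrite !(linear_map0 parl, linear_map0 (bilin_l _ actb)).
- by rewrite Bpar1 // Bact1 // (linear_mapZ _ _ parl) Bpar1.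
rewrite BparM // !actM (linear_tlift (h := par)) //.
apply: eq_tlift => u1 u2; rewrite BparM // IH.
by rewrite Bpar_gen // (linear_mapN _ (bilin_l _ actb)) act_gen Bpar_gen.
Qed.

Lemma Bcoact_par (x : B) : Coact (par x) = tmap par id (Coact x).
Proof.
move: x; apply: qalg_eq_ind => [|||v y IH]; [lin | lin | |].
  by rewrite Bpar1 // Bcoact1 //; pureE; rewrite Bpar1.
rewrite BparM // !coactM IH Bpar_gen // (linear_mapN _ coactl) coact_gen.
sweedler (coact X v) as v0 v1; sweedler (Coact y) as y0 y1.
by pureE; rewrite -pureNl !tmulE; pureE; rewrite BparM // Bpar_gen.
Qed.

(** The antipode-free condition is multiplicative: the acting element is moved past the generator
    [v] (from [g1] to [g2]), then past [y] by the induction hypothesis (from [g2] to [g3]), with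
    coassociativity in between. *)
Lemma Bcompat (x : B) (a : H) :
  \sw_(a1, a2 <- cop a) \sw_(x0, x1 <- Coact (Act x a2)) x0 ⊗ (a1 * x1) =
  \sw_(a1, a2 <- cop a) \sw_(x0, x1 <- Coact x) Act x0 a1 ⊗ (x1 * a2).
Proof.
have sl : forall Z : lmodType K, forall (f : B -> H -> Z) x y, bilinear_map f ->
    \sw_(c, h <- Coact (x * y)) f c h =
    \sw_(x0, x1 <- Coact x) \sw_(y0, y1 <- Coact y) f (x0 * y0) (x1 * y1).
  move=> Z f x' y fb; rewrite coactM.
  sweedler (Coact x') as x0 x1; sweedler (Coact y) as y0 y1.
  by rewrite tmulE; pureE.
pose F a z := \sw_(a1, a2 <- cop a) \sw_(x0, x1 <- Coact (Act z a2)) x0 ⊗ (a1 * x1).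
pose G a z := \sw_(a1, a2 <- cop a) \sw_(x0, x1 <- Coact z) Act x0 a1 ⊗ (x1 * a2).
have Fl b : linear (F b) by rewrite /F; lin.
have Gl b : linear (G b) by rewrite /G; lin.
rewrite -/(F a x) -/(G a x); move: x a.
apply: qalg_ind => [c x y ex ey a|a|a|v y IH a]; rewrite ?Fl ?Gl ?ex ?ey //.
- by rewrite !linear_map0.
- rewrite /F /G; transitivity ((1 : B) ⊗ a).
    transitivity (\sw_(a1, a2 <- cop a) coun a2 *: ((1 : B) ⊗ a1)).
      apply: eq_tlift => a1 a2; rewrite Bact1 // (linear_mapZ _ _ coactl) Bcoact1 //.
      rewrite (linear_mapZ (h := tlift _)); last by lin.
      by pureE; rewrite mulr1.
    by rewrite (cop_sw_counr Hh (f := fun a => (1 : B) ⊗ a)) //; lin.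
  rewrite -(cop_sw_counl Hh (f := fun a => (1 : B) ⊗ a)); last by lin.
  apply: eq_tlift => a1 a2; rewrite Bcoact1 //; pureE.
  by rewrite Bact1 // pureZl mul1r.
have IHs (Z : lmodType K) (f : B -> H -> Z) b : bilinear_map f ->
    \sw_(a1, a2 <- cop b) \sw_(x0, x1 <- Coact (Act y a2)) f x0 (a1 * x1) =
    \sw_(a1, a2 <- cop b) \sw_(x0, x1 <- Coact y) f (Act x0 a1) (x1 * a2).
  move=> fb; transitivity (tlift f (F b y)); last rewrite IH.
    rewrite (linear_tlift (h := tlift f)); last by lin.
    by apply: eq_tlift => a1 a2; sweedler (Coact (Act y a2)) as x0 x1; pureE.
  rewrite (linear_tlift (h := tlift f)); last by lin.
  by apply: eq_tlift => a1 a2; sweedler (Coact y) as x0 x1; pureE.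
rewrite /F /G; pose g1 b c d := \sw_(v0, v1 <- coact X (act X v c)) \sw_(y0, y1 <- Coact (Act y d))
  (bg v0 * y0) ⊗ (b * v1 * y1).
pose g2 b c d := \sw_(v0, v1 <- coact X v) \sw_(y0, y1 <- Coact (Act y d))
  (bg (act X v0 b) * y0) ⊗ (v1 * c * y1).
pose g3 b c d := \sw_(v0, v1 <- coact X v) \sw_(y0, y1 <- Coact y)
  (bg (act X v0 b) * Act y0 c) ⊗ (v1 * y1 * d).
transitivity (\sw_(a1, a2 <- cop a) \sw_(b, c <- cop a2) g1 a1 b c).
  apply: eq_tlift => a1 a2; rewrite actM (linear_tlift (h := Coact)) //.
  rewrite (linear_tlift (h := tlift _)); last by lin.
  apply: eq_tlift => b c; rewrite sl; last by lin.
  rewrite act_gen coact_gen /g1; sweedler (coact X (act X v b)) as v0 v1; pureE.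
  by apply: eq_tlift => y0 y1; rewrite mulrA.
rewrite -(cop_sw_coassoc Hh (f := g1)); last by rewrite /g1; lin.
transitivity (\sw_(a1, a2 <- cop a) \sw_(b, c <- cop a1) g2 b c a2).
  apply: eq_tlift => a1 a2; rewrite /g1 /g2.
  by rewrite (cmod_compat_sw Hh Hc (f := fun v0 h =>
    \sw_(y0, y1 <- Coact (Act y a2)) (bg v0 * y0) ⊗ (h * y1))) //; lin.
rewrite (cop_sw_coassoc Hh (f := g2)); last by rewrite /g2; lin.
transitivity (\sw_(a1, a2 <- cop a) \sw_(b, c <- cop a2) g3 a1 b c).
  apply: eq_tlift => a1 a2; rewrite /g2 /g3.
  transitivity (\sw_(b, c <- cop a2) \sw_(y0, y1 <- Coact (Act y c))
     (fun y0 h => \sw_(v0, v1 <- coact X v) (bg (act X v0 a1) * y0) ⊗ (v1 * h)) y0 (b * y1)).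
    sweedler (coact X v) as v0 v1; pureE.
    apply: eq_tlift => b c; pureE.
    by apply: eq_tlift => y0 y1; pureE; rewrite mulrA.
  rewrite (IHs _ (fun y0 h => \sw_(v0, v1 <- coact X v) (bg (act X v0 a1) * y0) ⊗ (v1 * h))); last by lin.
  apply: eq_tlift => b c; sweedler (coact X v) as v0 v1; pureE.
  by apply: eq_tlift => y0 y1; pureE; rewrite mulrA.
rewrite -(cop_sw_coassoc Hh (f := g3)); last by rewrite /g3; lin.
apply: eq_tlift => a1 a2; rewrite sl; last by lin.
rewrite /g3 coact_gen; sweedler (coact X v) as v0 v1; sweedler (Coact y) as y0 y1.
pureE; rewrite actM; sweedler (cop a1) as b c; pureE.
by rewrite act_gen.
Qed.

End QuadraticCrossedModule.

(** * The braided coproduct of the quadratic algebra *)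

Section QuadraticBraidedHopf.
Variables (K : fieldType) (H : hopf_data K) (X : cmod_data H).
Hypotheses (K2 : 2%:R != 0 :> K) (Hh : is_hopf H) (Hc : is_cmod X).
Hypothesis flat : braid_regular X.

Local Notation B := (Bquad_alg X).
Local Notation bg := (@bgen K H X).
Local Notation S := (Relators (@quad_relator_aug K H X)).
Local Notation par := (@Bquad_par K H X).
Local Notation Act := (@Bquad_act K H X).
Local Notation Coact := (@Bquad_coact K H X).
Local Notation Cop := (@Bquad_cop K H X).
Let parl : linear par := @Bpar_linear K H X.
Let actb : bilinear_map Act := Bact_bilinear Hh Hc.
Let coactl : linear Coact := Bcoact_linear Hh Hc flat.
Let act_gen := Bact_gen Hh Hc.
Let coact_gen := Bcoact_gen Hh Hc flat.

Lemma Bis_cmod : is_cmod (CmodData Act Coact).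
Proof.
split=> //=.
- exact: Bact_one.
- exact: Bact_mul.
- exact: Bcoact_coassoc.
- exact: Bcoact_coun.
- exact: (cmod_compat_of_sw (V := CmodData Act Coact) Hh actb coactl (Bcompat Hh Hc flat)).
Qed.

Lemma Bsuper_cmod_alg : super_cmod_alg Act Coact par.
Proof.
split=> //.
- exact: Bis_cmod.
- exact: Bact1.
- exact: BactM.
- exact: Bcoact1.
- exact: BcoactM.
- exact: BparK.
- exact: Bpar1.
- exact: BparM.
- exact: Bact_par.
- exact: Bcoact_par.
Qed.

Let HB := Bsuper_cmod_alg.
Local Notation bmul := (bs_tmul Act Coact par).
Let bmulb : bilinear_map bmul := bs_tmul_bilinear HB.
Let Bc : is_cmod (CmodData Act Coact) := Bis_cmod.

Lemma homog_gen x : homog par true (bg x).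
Proof. exact: Bpar_gen. Qed.

Lemma coact_sw_par (Z : lmodType K) (f : B -> H -> Z) x : bilinear_map f ->
  \sw_(y, h <- Coact (par x)) f y h = \sw_(y, h <- Coact x) f (par y) h.
Proof. by move=> fb; rewrite Bcoact_par //; sweedler (Coact x) as y h; pureE. Qed.

Lemma coact_sw_gen (Z : lmodType K) (f : B -> H -> Z) v : bilinear_map f ->
  \sw_(y, h <- Coact (bg v)) f y h = \sw_(w, h <- coact X v) f (bg w) h.
Proof. by move=> fb; rewrite coact_gen; sweedler (coact X v) as y h; pureE. Qed.

Let csM := coact_sw_mul HB.

Lemma Bcoact_sw_coassoc (Z : lmodType K) (f : B -> H -> H -> Z) x : trilinear f ->
  \sw_(y, h <- Coact x) \sw_(z, h' <- Coact y) f z h' h =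
  \sw_(y, h <- Coact x) \sw_(h1, h2 <- cop h) f y h1 h2.
Proof. exact: (coact_sw_coassoc Hh Bc). Qed.

Lemma Bcompat_sw (Z : lmodType K) (f : B -> H -> Z) x a : bilinear_map f ->
  \sw_(a1, a2 <- cop a) \sw_(y, h <- Coact (Act x a2)) f y (a1 * h) =
  \sw_(a1, a2 <- cop a) \sw_(y, h <- Coact x) f (Act y a1) (h * a2).
Proof. exact: (cmod_compat_sw Hh Bc). Qed.

(** This is v ⊗ 1 + 1 ⊗ v times y ⊗ z in the braided tensor square. In the second term the odd
    generator [v] has been carried past [y], whence the parity and the coaction. The inductions
    about the coproduct rest on this formula. *)
Definition Bcop_gen_mul (v : X) (y z : B) : B ⊗ B :=
  (bg v * y) ⊗ z + \sw_(y0, y1 <- Coact (par y)) y0 ⊗ (bg (act X v y1) * z).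

Lemma Bcop_gen_mulE v y z :
  bmul (bg v ⊗ 1 + 1 ⊗ bg v) (y ⊗ z) = Bcop_gen_mul v y z.
Proof.
rewrite (linear_mapD (h := fun x => bmul x (y ⊗ z))); last by lin.
rewrite (bs_tmul1l K2 Hh HB) (bs_tmulE K2 HB _ _ _ (homog_gen v)) /sgn.
congr (_ + _); apply: eq_tlift => y0 y1.
by rewrite mul1r act_gen.
Qed.

Lemma Bcop_gen_mul_trilinear : trilinear Bcop_gen_mul.
Proof. by rewrite /Bcop_gen_mul; lin. Qed.

Section Coproduct.
Local Notation cgen := (fun x => bg x ⊗ 1 + 1 ⊗ bg x).
Let Ta := bs_tmul_is_algebra K2 Hh HB.
Let cl : linear cgen.
Proof. by lin. Qed.

Let crel z : relator S z -> talg_lift bmul (1 ⊗ 1) cgen z = 0.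
Proof.
apply: (quad_relator_lift Ta cl) => w e.
pose m (z : X ⊗ X) := \sw_(x, y <- z) bg x * bg y.
have ml : linear m by rewrite /m; lin.
(* The product of two primitive elements has the mixed terms w - Psi(w), the minus sign being the
   Koszul sign of two odd generators. For fixed w they cancel, and the outer terms are relators. *)
transitivity (m w ⊗ 1 + tmap bg bg w + (1 ⊗ m w - tmap bg bg (braid w))).
  sweedler w as x y; pureE; rewrite /m; pureE.
  rewrite (linear_mapD (h := bmul (cgen x))); last by lin.
  rewrite !Bcop_gen_mulE /Bcop_gen_mul !Bpar_gen Bpar1 mulr1.
  have -> : \sw_(y0, y1 <- Coact (- bg y)) y0 ⊗ (bg (act X x y1) * 1) =
      - tmap bg bg (braid (x ⊗ y)).
    rewrite (linear_mapN _ coactl) (linear_mapN (h := tlift _)); last by lin.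
    congr (- _); rewrite braidE // coact_sw_gen; last by lin.
    by sweedler (coact X y) as y0 y1; pureE; rewrite mulr1.
  rewrite Bcoact1 //; pureE.
  by rewrite cmod_act1 // addrACA [- _ + _]addrC.
by rewrite /m !bgen_rel // pure0l pure0r e add0r sub0r subrr.
Qed.

Lemma Bcop_linear : linear Cop. Proof. exact: qalg_lift_linear Ta cl crel. Qed.
Lemma Bcop1 : Cop 1 = 1 ⊗ 1. Proof. exact: qalg_lift1 Ta cl crel. Qed.
Lemma BcopM x y : Cop (x * y) = bmul (Cop x) (Cop y).
Proof. exact: qalg_liftM Ta cl crel x y. Qed.
Lemma Bcop_gen v : Cop (bg v) = bg v ⊗ 1 + 1 ⊗ bg v.
Proof. exact: qalg_lift_gen Ta cl crel v. Qed.
End Coproduct.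

Let copl : linear Cop := Bcop_linear.

Lemma Bcop_sw_gen_mul (Z : lmodType K) (f : B -> B -> Z) v x : bilinear_map f ->
  \sw_(y, z <- Cop (bg v * x)) f y z =
  \sw_(y, z <- Cop x) (f (bg v * y) z +
     \sw_(y0, y1 <- Coact (par y)) f y0 (bg (act X v y1) * z)).
Proof.
move=> fb; rewrite BcopM Bcop_gen; sweedler (Cop x) as y z.
rewrite Bcop_gen_mulE /Bcop_gen_mul; pureE; rewrite tliftD //.
congr (_ + _); first by pureE.
by sweedler (Coact (par y)) as y0 y1; pureE.
Qed.

Lemma Bcop_gen_mul_sw v x :
  Cop (bg v * x) = \sw_(y, z <- Cop x) Bcop_gen_mul v y z.
Proof.
have [f1 f2 f3] := Bcop_gen_mul_trilinear.
by rewrite BcopM Bcop_gen; sweedler (Cop x) as y z; rewrite Bcop_gen_mulE; pureE.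
Qed.

Lemma Bcop_par x : Cop (par x) = tmap par par (Cop x).
Proof.
move: x; apply: qalg_eq_ind => [|||v y IH]; [lin | lin | |].
  by rewrite !Bpar1 Bcop1; pureE; rewrite !Bpar1.
rewrite BparM Bpar_gen mulNr (linear_mapN _ copl) !Bcop_gen_mul_sw IH.
have [f1 f2 f3] := Bcop_gen_mul_trilinear.
sweedler (Cop y) as p q; pureE; rewrite /Bcop_gen_mul.
rewrite (linear_mapD (h := tmap par par)); last by lin.
pureE; rewrite BparM Bpar_gen mulNr pureNl opprD; congr (_ + _).
rewrite !coact_sw_par; try lin.
sweedler (Coact p) as p0 p1; pureE.
by rewrite BparM Bpar_gen mulNr pureNr.
Qed.

Lemma Bcop_coact x : tmap Cop id (Coact x) =
  \sw_(y, z <- Cop x) \sw_(y0, y1 <- Coact y)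
    \sw_(z0, z1 <- Coact z) (y0 ⊗ z0) ⊗ (y1 * z1).
Proof.
move: x; apply: qalg_eq_ind => [|||v y IH]; [lin | lin | |].
  by rewrite Bcoact1 //; pureE; rewrite Bcop1; pureE; rewrite Bcoact1 //; pureE; rewrite mulr1.
pose E v0 p q := (bg v0 * p) ⊗ q + \sw_(z0, z1 <- Coact (par p)) z0 ⊗ (bg (act X v0 z1) * q).
transitivity (\sw_(v0, v1 <- coact X v) \sw_(y0, y1 <- Coact y) \sw_(p, q <- Cop y0)
    E v0 p q ⊗ (v1 * y1)).
  rewrite BcoactM // coact_gen /E.
  sweedler (coact X v) as v0 v1; sweedler (Coact y) as y0 y1; pureE.
  rewrite tmulE; pureE; rewrite Bcop_gen_mul_sw /Bcop_gen_mul.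
  by sweedler (Cop y0) as p q; pureE.
transitivity (\sw_(v0, v1 <- coact X v) \sw_(p, q <- Cop y) \sw_(p0, p1 <- Coact p)
    \sw_(q0, q1 <- Coact q) E v0 p0 q0 ⊗ (v1 * (p1 * q1))).
  apply: eq_tlift => v0 v1.
  by rewrite (cop_coact_sw copl coactl IH (f := fun p q h => E v0 p q ⊗ (v1 * h))) // /E; lin.
pose R (y z : B) := \sw_(y0, y1 <- Coact y) \sw_(z0, z1 <- Coact z) (y0 ⊗ z0) ⊗ (y1 * z1).
have Rb : bilinear_map R by rewrite /R; lin.
rewrite -[RHS]/(\sw_(y, z <- Cop (bg v * y)) R y z) Bcop_sw_gen_mul //.
rewrite /E; sweedler (Cop y) as p q; pureE.
transitivity
  (\sw_(v0, v1 <- coact X v) \sw_(p0, p1 <- Coact p) \sw_(q0, q1 <- Coact q)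
     ((bg v0 * p0) ⊗ q0) ⊗ (v1 * (p1 * q1)) +
   \sw_(v0, v1 <- coact X v) \sw_(p0, p1 <- Coact p) \sw_(q0, q1 <- Coact q)
     (\sw_(z0, z1 <- Coact (par p0)) z0 ⊗ (bg (act X v0 z1) * q0)) ⊗ (v1 * (p1 * q1))).
  sweedler (coact X v) as v0 v1; pureE.
  sweedler (Coact p) as p0 p1; pureE; sweedler (Coact q) as q0 q1.
  by pureE; rewrite pureDl.
congr (_ + _).
  rewrite /R csM; last by lin.
  rewrite coact_gen; sweedler (coact X v) as v0 v1; sweedler (Coact p) as p0 p1.
  by sweedler (Coact q) as q0 q1; pureE; rewrite mulrA.
(* In the term where [v] has passed the first leg, [g] coacts on [v] before it is acted on and [k]
   afterwards. The crossed module condition for [v] exchanges the two. *)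
pose g (p0 : B) (h1 h2 : H) := \sw_(v0, v1 <- coact X v) \sw_(q0, q1 <- Coact q)
  (p0 ⊗ (bg (act X v0 h1) * q0)) ⊗ (v1 * (h2 * q1)).
pose k (z0 : B) (z1 h : H) := \sw_(c0, c1 <- Coact (bg (act X v h) * q)) (z0 ⊗ c0) ⊗ (z1 * c1).
have gt : trilinear g by rewrite /g; lin.
have kt : trilinear k by rewrite /k; lin.
have [[g1 g2 g3] [k1 k2 k3]] := (gt, kt).
transitivity (\sw_(p0, h <- Coact (par p)) \sw_(h1, h2 <- cop h) g p0 h1 h2).
  rewrite -(Bcoact_sw_coassoc (f := g)) // [RHS]coact_sw_par; last by lin.
  rewrite /g; sweedler (coact X v) as v0 v1; pureE; sweedler (Coact p) as p0 p1; pureE.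
  sweedler (Coact (par p0)) as z0 z1; pureE.
  by sweedler (Coact q) as q0 q1; pureE.
symmetry; transitivity (\sw_(p0, h <- Coact (par p)) \sw_(h1, h2 <- cop h) k p0 h1 h2).
  by rewrite -(Bcoact_sw_coassoc (f := k)).
apply: eq_tlift => y0 h.
pose f (w : X) (h : H) := \sw_(q0, q1 <- Coact q) (y0 ⊗ (bg w * q0)) ⊗ (h * q1).
transitivity (\sw_(h1, h2 <- cop h) \sw_(w0, w1 <- coact X (act X v h2)) f w0 (h1 * w1)).
  apply: eq_tlift => h1 h2; rewrite /k csM; last by lin.
  rewrite coact_gen /f; sweedler (coact X (act X v h2)) as w0 w1; pureE.
  by apply: eq_tlift => q0 q1; rewrite mulrA.
rewrite (cmod_compat_sw Hh Hc (f := f)); last by rewrite /f; lin.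
apply: eq_tlift => h1 h2; apply: eq_tlift => v0 v1.
by apply: eq_tlift => q0 q1; rewrite mulrA.
Qed.

Lemma Bcop_act x u :
  Cop (Act x u) = \sw_(u1, u2 <- cop u) tmap (Act^~ u1) (Act^~ u2) (Cop x).
Proof.
pose F u x := \sw_(u1, u2 <- cop u) tmap (Act^~ u1) (Act^~ u2) (Cop x).
have Fl w : linear (F w) by rewrite /F; lin.
rewrite -/(F u x); move: x u.
apply: qalg_ind => [c x y ex ey u|u|u|v y IH u].
- by rewrite (bilin_l _ actb) copl ex ey Fl.
- by rewrite (linear_map0 (bilin_l _ actb)) (linear_map0 copl) linear_map0.
- rewrite Bact1 // (linear_mapZ _ _ copl) Bcop1 /F.
  rewrite -(cop_sw_counl Hh (f := fun u => coun u *: (1 ⊗ 1))); last by lin.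
  apply: eq_tlift => u1 u2; rewrite Bcop1; pureE.
  by rewrite !Bact1 // pureZl pureZr.
have [f1 f2 f3] := Bcop_gen_mul_trilinear.
have gb w : bilinear_map (Bcop_gen_mul w) by split.
rewrite /F Bcop_gen_mul_sw BactM // (linear_tlift (h := Cop)) //.
transitivity (\sw_(u1, u2 <- cop u) \sw_(c1, c2 <- cop u2) \sw_(p, q <- Cop y)
    Bcop_gen_mul (act X v u1) (Act p c1) (Act q c2)).
  apply: eq_tlift => u1 u2; rewrite act_gen Bcop_gen_mul_sw IH /F.
  rewrite (linear_tlift (h := tlift (Bcop_gen_mul (act X v u1)))); last by lin.
  by apply: eq_tlift => c1 c2; sweedler (Cop y) as p q; pureE.
sweedler (Cop y) as p q; pureE.
(* The term [g0] agrees on both sides. In [g1] the first leg is acted on before its coaction is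
   taken, in [g2] afterwards; the crossed module condition of B relates them. *)
pose g0 a b c := (bg (act X v a) * Act p b) ⊗ Act q c.
pose g1 a b c := \sw_(z0, z1 <- Coact (Act (par p) b))
  z0 ⊗ (bg (act X v (a * z1)) * Act q c).
pose g2 a b c := \sw_(z0, z1 <- Coact (par p))
  Act z0 a ⊗ (bg (act X v (z1 * b)) * Act q c).
transitivity (\sw_(u1, u2 <- cop u) \sw_(c1, c2 <- cop u2) (g0 u1 c1 c2 + g1 u1 c1 c2)).
  apply: eq_tlift => u1 u2; apply: eq_tlift => c1 c2; pureE.
  rewrite /Bcop_gen_mul; congr (_ + _).
  rewrite -Bact_par // /g1; apply: eq_tlift => z0 z1.
  by rewrite cmod_actM.
rewrite -(cop_sw_coassoc Hh (f := fun a b c => g0 a b c + g1 a b c)); last first.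
  by rewrite /g0 /g1; lin.
transitivity (\sw_(u1, u2 <- cop u) (\sw_(c1, c2 <- cop u1) g0 c1 c2 u2 +
   \sw_(c1, c2 <- cop u1) g2 c1 c2 u2)).
  apply: eq_tlift => u1 u2; rewrite tlift_split; congr (_ + _).
  by rewrite /g1 (Bcompat_sw (f := fun z h => z ⊗ (bg (act X v h) * Act q u2))) //; lin.
rewrite tlift_split.
rewrite (cop_sw_coassoc Hh (f := g2)); last by rewrite /g2; lin.
rewrite -tlift_split; apply: eq_tlift => u1 u2.
rewrite /Bcop_gen_mul (linear_mapD (h := tmap _ _)); last by lin.
congr (_ + _); rewrite /g0 /g2; pureE.
  by rewrite BactM //; sweedler (cop u1) as c1 c2; pureE; rewrite act_gen.
sweedler (Coact (par p)) as z0 z1; pureE; rewrite BactM //.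
by sweedler (cop u2) as c1 c2; pureE; rewrite act_gen cmod_actM.
Qed.

Lemma Bcop_coassoc x : tassoc (tmap Cop id (Cop x)) = tmap id Cop (Cop x).
Proof.
move: x; apply: qalg_eq_ind => [|||v y IH]; [lin | lin | |].
  by rewrite Bcop1; pureE; rewrite Bcop1; pureE.
have [f1 f2 f3] := Bcop_gen_mul_trilinear.
have gb w : bilinear_map (Bcop_gen_mul w) by split.
(* The three terms insert [v] into the first, second or third factor of a triple tensor, after
   carrying it past the factors on its left. On the left-hand side this form is reached through the
   colinearity of the coproduct. *)
pose G (p q r : B) := (bg v * p) ⊗ (q ⊗ r) +
  \sw_(z0, z1 <- Coact (par p)) z0 ⊗ ((bg (act X v z1) * q) ⊗ r) +
  \sw_(p0, p1 <- Coact (par p)) \sw_(q0, q1 <- Coact (par q))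
     p0 ⊗ (q0 ⊗ (bg (act X v (p1 * q1)) * r)).
have Gt : trilinear G by rewrite /G; lin.
rewrite Bcop_gen_mul_sw (linear_tlift (h := tmap Cop id)); last by lin.
rewrite (linear_tlift (h := @tassoc K B B B)); last by lin.
rewrite (linear_tlift (h := tmap id Cop)); last by lin.
transitivity (\sw_(y1, y2 <- Cop y) \sw_(p, q <- Cop y1) G p q y2).
  apply: eq_tlift => y1 y2.
  transitivity (\sw_(p, q <- Cop y1) tassoc (Bcop_gen_mul v p q ⊗ y2) +
     \sw_(z0, z1 <- Coact (par y1)) \sw_(p, q <- Cop z0)
        p ⊗ (q ⊗ (bg (act X v z1) * y2))).
    rewrite {1}/Bcop_gen_mul !(linear_mapD (h := tmap _ _)); last by lin.
    rewrite !(linear_mapD (h := @tassoc _ _ _ _)); last by lin.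
    congr (_ + _); pureE.
      by rewrite Bcop_gen_mul_sw; sweedler (Cop y1) as p q; pureE.
    sweedler (Coact (par y1)) as z0 z1; pureE.
    by sweedler (Cop z0) as p q; pureE.
  rewrite (cop_coact_sw copl coactl (Bcop_coact (par y1)) (f := fun p q h =>
    p ⊗ (q ⊗ (bg (act X v h) * y2)))); last by lin.
  rewrite Bcop_par /G; sweedler (Cop y1) as p q; pureE.
  rewrite /Bcop_gen_mul pureDl (linear_mapD (h := @tassoc _ _ _ _)); last by lin.
  pureE; congr (_ + _ + _).
  by sweedler (Coact (par p)) as z0 z1; pureE.
have [G1 G2 G3] := Gt.
rewrite (sw_assoc copl copl IH Gt); apply: eq_tlift => y1 y2.
rewrite {1}/Bcop_gen_mul (linear_mapD (h := tmap _ _)); last by lin.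
pureE; rewrite /G; symmetry.
transitivity ((bg v * y1) ⊗ Cop y2 + \sw_(z0, z1 <- Coact (par y1))
  \sw_(q, r <- Cop y2) z0 ⊗ Bcop_gen_mul (act X v z1) q r).
  rewrite /Bcop_gen_mul; congr (_ + _); sweedler (Coact (par y1)) as z0 z1; pureE.
  by rewrite Bcop_gen_mul_sw /Bcop_gen_mul; sweedler (Cop y2) as q r; pureE.
rewrite /Bcop_gen_mul; sweedler (Cop y2) as q r; pureE.
rewrite -addrA; congr (_ + _).
sweedler (Coact (par y1)) as z0 z1; pureE.
rewrite pureDr; congr (_ + _).
sweedler (Coact (par q)) as q0 q1; pureE.
by rewrite cmod_actM.
Qed.

End QuadraticBraidedHopf.

(** * Degrees *)

Section PureSpan.
Variables (K : fieldType) (V W : lmodType K).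

(** The common shape of [tens_deg], of [smash_deg] and of the degree condition on coactions, all of
    which are instances by conversion. *)
Definition pure_span (R : V * W -> Prop) (z : V ⊗ W) : Prop :=
  exists s : seq (V * W), z = \sum_(p <- s) p.1 ⊗ p.2 /\ forall p, p \in s -> R p.

Variable R : V * W -> Prop.

Lemma pure_span0 : pure_span R 0.
Proof. by exists [::]; rewrite big_nil. Qed.

Lemma pure_span_pure v w : R (v, w) -> pure_span R (v ⊗ w).
Proof. by exists [:: (v, w)]; rewrite big_seq1; split=> // p; rewrite inE => /eqP ->. Qed.

Lemma pure_spanD x y : pure_span R x -> pure_span R y -> pure_span R (x + y).
Proof.
case=> s [-> hs] [s' [-> hs']]; exists (s ++ s'); rewrite big_cat; split=> // p.
by rewrite mem_cat => /orP[/hs|/hs'].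
Qed.

Lemma pure_span_sum I (r : seq I) (F : I -> V ⊗ W) :
  (forall i, pure_span R (F i)) -> pure_span R (\sum_(i <- r) F i).
Proof.
move=> hF; elim: r => [|i r IH]; first by rewrite big_nil; exact: pure_span0.
by rewrite big_cons; apply: pure_spanD.
Qed.

Lemma pure_span_tlift (V' W' : lmodType K) (f : V' -> W' -> V ⊗ W) z :
  (forall v w, pure_span R (f v w)) -> pure_span R (tlift f z).
Proof. by move=> hf; apply: pure_span_sum. Qed.

Hypothesis RZ : forall a v w, R (v, w) -> R (a *: v, w).

Lemma pure_spanZ a x : pure_span R x -> pure_span R (a *: x).
Proof.
case=> s [-> hs]; rewrite scaler_sumr big_seq.
elim/big_ind: _ => [|x1 x2|[v w] /hs h]; [exact: pure_span0 | exact: pure_spanD |].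
by rewrite -pureZl; apply: pure_span_pure; exact: RZ.
Qed.

Lemma pure_span_linear a x y :
  pure_span R x -> pure_span R y -> pure_span R (a *: x + y).
Proof. by move=> hx hy; apply: pure_spanD => //; exact: pure_spanZ. Qed.
End PureSpan.

Lemma pure_span_tlift_in (K : fieldType) (V W V' W' : lmodType K)
    (R' : V' * W' -> Prop) (R : V * W -> Prop) (f : V' -> W' -> V ⊗ W) z :
  bilinear_map f -> pure_span R' z -> (forall v w, R' (v, w) -> pure_span R (f v w)) ->
  pure_span R (tlift f z).
Proof.
move=> fb [s [-> hs]] hf; rewrite (linear_map_sum _ _ _ (tlift_linear fb)) big_seq.
elim/big_ind: _ => [|x1 x2|[v w] /hs h]; [exact: pure_span0 | exact: pure_spanD |].
by rewrite tliftE //; exact: hf.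
Qed.

Section Grading.
Variables (K : fieldType) (V : lmodType K) (deg : nat -> V -> Prop) (phi : V -> V).
Hypothesis K0 : forall n, n.+1%:R != 0 :> K.
Hypotheses (phil : linear phi) (phi_deg : forall n x, deg n x -> phi x = 2%:R ^+ n *: x).
Hypothesis degZ : forall n a x, deg n x -> deg n (a *: x).

Lemma graded_direct N (F : nat -> V) : (forall n, deg n (F n)) ->
  \sum_(n < N) F n = 0 -> forall n, (n < N)%N -> F n = 0.
Proof.
elim: N F => [|N IH] F hF e n //.
(* Subtracting [2%:R ^+ N] times the relation from its image under [phi] removes the top component
   and multiplies the others by nonzero scalars. *)
have e2 : \sum_(m < N) (2%:R ^+ m - 2%:R ^+ N) *: F m = 0.
  transitivity (phi (\sum_(m < N.+1) F m) - 2%:R ^+ N *: \sum_(m < N.+1) F m).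
    rewrite (linear_map_sum _ _ _ phil) scaler_sumr -sumrB big_ord_recr /=.
    rewrite (phi_deg (hF N)) subrr addr0; apply: eq_bigr => m _.
    by rewrite (phi_deg (hF m)) scalerBl.
  by rewrite e (linear_map0 phil) scaler0 subrr.
have FN m : (m < N)%N -> F m = 0.
  move=> lt_mN; have := IH (fun m => (2%:R ^+ m - 2%:R ^+ N) *: F m) _ e2 m lt_mN.
  move=> /(_ (fun k => degZ _ (hF k))) /eqP; rewrite scaler_eq0 => /orP[|/eqP //].
  have l2 : (2 ^ m < 2 ^ N)%N by rewrite ltn_exp2l.
  rewrite -opprB oppr_eq0 -!natrX -natrB 1?ltnW //.
  by rewrite -(prednK (n := (2 ^ N - 2 ^ m)%N)) ?subn_gt0 // (negPf (K0 _)).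
rewrite ltnS leq_eqVlt => /orP[/eqP ->|/FN //].
by move: e; rewrite big_ord_recr /= big1 ?add0r // => i _; exact: FN.
Qed.
End Grading.

Section QuadraticGrading.
Variables (K : fieldType) (H : hopf_data K) (X : cmod_data H).

Local Notation B := (Bquad_alg X).
Local Notation bg := (@bgen K H X).
Local Notation deg := (@Bquad_deg K H X).

Lemma Bdeg0 n : deg n 0.
Proof. by exists [::]; rewrite big_nil. Qed.

Lemma Bdeg_word n (w : n.-tuple X) : deg n (\prod_(x <- w) bg x).
Proof. by exists [:: (1, w)]; rewrite big_seq1 scale1r. Qed.

Lemma Bdeg_linear n a x y : deg n x -> deg n y -> deg n (a *: x + y).
Proof.
case=> s -> [s' ->]; exists ([seq (a * p.1, p.2) | p <- s] ++ s').
rewrite big_cat big_map scaler_sumr; congr (_ + _).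
by apply: eq_bigr => p _; rewrite scalerA.
Qed.

Lemma BdegZ n a x : deg n x -> deg n (a *: x).
Proof. by move=> hx; rewrite -[_ *: _]addr0; apply: Bdeg_linear => //; exact: Bdeg0. Qed.

Lemma BdegD n x y : deg n x -> deg n y -> deg n (x + y).
Proof. by move=> hx hy; rewrite -[x]scale1r; exact: Bdeg_linear. Qed.

Lemma BdegN n x : deg n x -> deg n (- x).
Proof. by move=> hx; rewrite -scaleN1r; exact: BdegZ. Qed.

Lemma Bdeg_sum n I (r : seq I) F : (forall i, deg n (F i)) -> deg n (\sum_(i <- r) F i).
Proof.
move=> hF; elim: r => [|i r IH]; first by rewrite big_nil; exact: Bdeg0.
by rewrite big_cons; apply: BdegD.
Qed.

Lemma Bdeg_tlift n (V W : lmodType K) (f : V -> W -> B) z :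
  (forall v w, deg n (f v w)) -> deg n (tlift f z).
Proof. by move=> hf; exact: Bdeg_sum. Qed.

Lemma Bdeg_genM n v y : deg n y -> deg n.+1 (bg v * y).
Proof.
case=> s ->; rewrite mulr_sumr; apply: Bdeg_sum => p; rewrite -scalerAr; apply: BdegZ.
have := Bdeg_word [tuple of v :: p.2].
by rewrite /= big_cons.
Qed.

Lemma Bdeg_one : deg 0%N 1.
Proof. by have := Bdeg_word [tuple]; rewrite big_nil. Qed.

Lemma Bdeg_ind (P : nat -> B -> Prop) : (forall n, P n 0) ->
  (forall n a x y, P n x -> P n y -> P n (a *: x + y)) -> P 0%N 1 ->
  (forall n v y, deg n y -> P n y -> P n.+1 (bg v * y)) -> forall n x, deg n x -> P n x.
Proof.
move=> P0 PL P1 Pg n x [s ->].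
have Pw m (w : m.-tuple X) : P m (\prod_(y <- w) bg y).
  elim: m w => [|m IH] w; first by rewrite tuple0 big_nil.
  rewrite (tuple_eta w) big_cons; apply: Pg; last exact: (IH (behead_tuple w)).
  exact: (Bdeg_word (behead_tuple w)).
elim: s => [|p s IH]; first by rewrite big_nil.
by rewrite big_cons; apply: PL.
Qed.

Lemma Bdeg0P x : deg 0%N x -> exists a, x = a%:A.
Proof.
case=> s ->; exists (\sum_(p <- s) p.1); rewrite scaler_suml.
by apply: eq_bigr => p _; rewrite tuple0 big_nil.
Qed.

Lemma BdegM m n x y : deg m x -> deg n y -> deg (m + n)%N (x * y).
Proof.
move=> hx; elim/Bdeg_ind: hx n y => [k n y|k a x1 x2 h1 h2 n y hy|n y|k v z _ h n y hy].
- by rewrite mul0r => _; exact: Bdeg0.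
- by rewrite mulrDl -scalerAl; apply: Bdeg_linear; [exact: h1 | exact: h2].
- by rewrite mul1r add0n.
by rewrite -mulrA addSn; apply: Bdeg_genM; exact: h.
Qed.

Lemma Bdeg_gen v : deg 1%N (bg v).
Proof. by rewrite -[bg v]mulr1; apply: Bdeg_genM; exact: Bdeg_one. Qed.

(** The components are required to vanish from N on so that two decompositions can be brought to a
    common length and added. *)
Lemma Bdeg_decomp x : exists N (F : nat -> B),
  [/\ forall n, deg n (F n), forall n, (N <= n)%N -> F n = 0 & x = \sum_(n < N) F n].
Proof.
have widen N M (F : nat -> B) : (forall n, (N <= n)%N -> F n = 0) -> (N <= M)%N ->
    \sum_(n < M) F n = \sum_(n < N) F n.
  move=> F0 leNM; rewrite -!(big_mkord xpredT F) (big_cat_nat (leq0n N) leNM) /=.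
  by rewrite [X in _ + X]big1_seq ?addr0 // => n /andP[_]; rewrite mem_index_iota => /andP[/F0 ->].
move: x; apply: qalg_ind => [a x y [N [F [hF F0 ->]]] [M [G [hG G0 ->]]]|||].
- exists (maxn N M), (fun n => a *: F n + G n); split=> [n|n|].
  + exact: Bdeg_linear.
  + by rewrite geq_max => /andP[/F0 -> /G0 ->]; rewrite scaler0 addr0.
  by rewrite big_split -scaler_sumr (widen N (maxn N M)) ?leq_maxl // (widen M (maxn N M)) ?leq_maxr.
- by exists 0%N, (fun=> 0); rewrite big_ord0; split=> // n; exact: Bdeg0.
- exists 1%N, (fun n => if n is 0%N then 1 else 0); rewrite big_ord1; split=> // -[|n] //.
    exact: Bdeg_one.
  exact: Bdeg0.
move=> v y [N [F [hF F0 ->]]].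
exists N.+1, (fun n => if n is m.+1 then bg v * F m else 0); split=> [[|n]|[|n]|] //.
- exact: Bdeg0.
- exact: Bdeg_genM.
- by rewrite ltnS => /F0 ->; rewrite mulr0.
by rewrite big_ord_recl add0r mulr_sumr.
Qed.

Lemma Bscale_deg c n x : deg n x -> Bscale c x = c ^+ n *: x.
Proof.
elim/Bdeg_ind => [k|k a x1 x2 h1 h2||k v y _ h].
- by rewrite (linear_map0 (Bscale_linear c)) scaler0.
- by rewrite Bscale_linear h1 h2 scalerDr !scalerA mulrC.
- by rewrite Bscale1 scale1r.
by rewrite BscaleM Bscale_gen h -scalerAl -scalerAr scalerA exprS.
Qed.

Lemma Bis_graded : (forall n, n.+1%:R != 0 :> K) -> is_graded deg (@Bquad_par K H X).
Proof.
move=> K0; split.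
- exact: Bdeg0.
- exact: Bdeg_linear.
- by move=> x; have [N [F [hF _ e]]] := Bdeg_decomp x; exists N, F.
- move=> N F; apply: (graded_direct K0 (Bscale_linear 2%:R)) => n; first exact: Bscale_deg.
  exact: BdegZ.
- exact: Bpar_linear.
- by move=> n x hx; rewrite Bquad_parE (Bscale_deg _ hx).
Qed.

End QuadraticGrading.

(** * Counit and antipode of the quadratic algebra *)

Section QuadraticAntipode.
Variables (K : fieldType) (H : hopf_data K) (X : cmod_data H).
Hypotheses (K0 : forall n, n.+1%:R != 0 :> K) (Hh : is_hopf H) (Hc : is_cmod X).
Hypothesis flat : braid_regular X.

Local Notation B := (Bquad_alg X).
Local Notation bg := (@bgen K H X).
Local Notation S := (Relators (@quad_relator_aug K H X)).
Local Notation par := (@Bquad_par K H X).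
Local Notation Act := (@Bquad_act K H X).
Local Notation Coact := (@Bquad_coact K H X).
Local Notation Cop := (@Bquad_cop K H X).
Local Notation Coun := (@Bquad_coun K H X).
Local Notation deg := (@Bquad_deg K H X).
Let K2 : 2%:R != 0 :> K := K0 1.
Let parl : linear par := @Bpar_linear K H X.
Let actb : bilinear_map Act := Bact_bilinear Hh Hc.
Let coactl : linear Coact := Bcoact_linear Hh Hc flat.
Let copl : linear Cop := Bcop_linear K2 Hh Hc flat.
Let act_gen := Bact_gen Hh Hc.
Let coact_gen := Bcoact_gen Hh Hc flat.
Let Bc : is_cmod (CmodData Act Coact) := Bis_cmod Hh Hc flat.

Section Counit.
Let Ka := algType_is_algebra K^o.
Let l0 : linear (fun _ : X => 0 : K^o).
Proof. exact: lin0. Qed.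
Let crel z : relator S z -> talg_lift *%R (1 : K^o) (fun=> 0) z = 0.
Proof.
apply: (quad_relator_lift Ka l0) => w _.
by apply: tlift_eq0 => x y; rewrite mul0r.
Qed.

Lemma Bcoun_linear : linear (Coun : B -> K^o). Proof. exact: qalg_lift_linear Ka l0 crel. Qed.
Lemma Bcoun1 : Coun 1 = 1. Proof. exact: qalg_lift1 Ka l0 crel. Qed.
Lemma BcounM x y : Coun (x * y) = Coun x * Coun y.
Proof. exact: qalg_liftM Ka l0 crel x y. Qed.
Lemma Bcoun_gen v : Coun (bg v) = 0. Proof. exact: qalg_lift_gen Ka l0 crel v. Qed.
End Counit.
Hint Extern 0 (GRing.linear_for _ (@Bquad_coun _ _ _)) => exact: Bcoun_linear : lin.

Lemma Bcoun_genM v x : Coun (bg v * x) = 0.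
Proof. by rewrite BcounM Bcoun_gen mul0r. Qed.

(** The counit is colinear: it kills every word of positive length and the coaction preserves
    length, so only the unit contributes. *)
Lemma Bcoact_coun_l (Z : lmodType K) (f : H -> Z) x : linear f ->
  \sw_(y, h <- Coact x) Coun y *: f h = Coun x *: f 1.
Proof.
move=> fl; move: x; apply: qalg_eq_ind => [|||v y IH]; [lin | lin | |].
  by rewrite Bcoact1 //; pureE; rewrite Bcoun1.
rewrite BcoactM // coact_gen Bcoun_genM scale0r.
transitivity (\sw_(v0, v1 <- coact X v) \sw_(y0, y1 <- Coact y) (0 : Z)).
  sweedler (coact X v) as v0 v1; sweedler (Coact y) as y0 y1.
  by pureE; rewrite tmulE; pureE; rewrite Bcoun_genM scale0r.
by do 2!apply: tlift_eq0 => ? ?.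
Qed.

Lemma Bcoun_par x : Coun (par x) = Coun x.
Proof.
have pl := Bcoun_linear.
move: x; apply: (qalg_eq_ind (Z := K^o)) => [|||v y IH]; [lin | lin | by rewrite Bpar1 |].
by rewrite BparM Bpar_gen mulNr (linear_mapN _ Bcoun_linear) !Bcoun_genM oppr0.
Qed.

Lemma Bcop_counl x : \sw_(x1, x2 <- Cop x) Coun x1 *: x2 = x.
Proof.
move: x; apply: qalg_eq_ind => [|||v y IH]; [lin | by [] | |].
  by rewrite Bcop1 //; pureE; rewrite Bcoun1 scale1r.
rewrite (Bcop_sw_gen_mul K2 Hh Hc flat); last by lin.
rewrite -[in RHS]IH; sweedler (Cop y) as p q; pureE.
rewrite Bcoun_genM scale0r add0r.
rewrite (Bcoact_coun_l (f := fun h => bg (act X v h) * q)); last by lin.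
by rewrite cmod_act1 // Bcoun_par scalerAr.
Qed.

Lemma Bcop_counr x : \sw_(x1, x2 <- Cop x) Coun x2 *: x1 = x.
Proof.
move: x; apply: qalg_eq_ind => [|||v y IH]; [lin | by [] | |].
  by rewrite Bcop1 //; pureE; rewrite Bcoun1 scale1r.
rewrite (Bcop_sw_gen_mul K2 Hh Hc flat); last by lin.
rewrite -[in RHS]IH; sweedler (Cop y) as p q; pureE.
rewrite -scalerAr -[RHS]addr0; congr (_ + _).
by apply: tlift_eq0 => r h; rewrite Bcoun_genM scale0r.
Qed.

(* The antipode should satisfy S(v y) = ± S(y)_0 S(v <| S(y)_1); hence S(x) is
   the value at 1 of the image of x under the algebra map to End(B) that sends
   v to the following operator. *)
Definition Bantip_op (v : X) (z : B) : B :=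
  - \sw_(z0, z1 <- Coact (par z)) z0 * bg (act X v z1).

Lemma Bantip_op_bilinear : bilinear_map Bantip_op.
Proof. by rewrite /Bantip_op; lin. Qed.

Lemma Bantip_op_par v z : par (Bantip_op v z) = - Bantip_op v (par z).
Proof.
rewrite /Bantip_op opprK BparK (Bcoact_par Hh Hc flat) (linear_mapN _ parl) (linear_tlift _ _ parl).
sweedler (Coact z) as z0 z1; pureE.
by rewrite BparM Bpar_gen BparK mulrN opprK.
Qed.

Lemma Bantip_op_sw v z : Bantip_op v (par z) = - \sw_(z0, z1 <- Coact z) z0 * bg (act X v z1).
Proof. by rewrite /Bantip_op BparK. Qed.

(** The pair formed by w_0 <| h_1 and v <| (w_1 h_2) is Psi(v ⊗ w) acted on diagonally by h.
    Composing two operators thus produces a braiding, which is why they respect the relators. *)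
Lemma Bantip_op_comp v w z : Bantip_op v (Bantip_op w z) =
  - \sw_(z0, h <- Coact z) \sw_(h1, h2 <- cop h) \sw_(w0, w1 <- coact X w)
      z0 * (bg (act X w0 h1) * bg (act X v (w1 * h2))).
Proof.
have ob := Bantip_op_bilinear.
rewrite -[Bantip_op w z](BparK) Bantip_op_sw Bantip_op_par Bantip_op_sw opprK; congr (- _).
pose g z0 h h' := \sw_(w0, w1 <- coact X (act X w h'))
  z0 * (bg w0 * bg (act X v (h * w1))).
transitivity (\sw_(z0, h <- Coact z) \sw_(z1, h' <- Coact z0) g z1 h' h).
  rewrite (linear_tlift _ _ coactl) (linear_tlift (h := tlift _)); last by lin.
  apply: eq_tlift => z0 h; rewrite (coact_sw_mul (Bsuper_cmod_alg Hh Hc flat)); last by lin.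
  rewrite coact_gen /g; sweedler (coact X (act X w h)) as w0 w1; pureE.
  by apply: eq_tlift => z1 h'; pureE; rewrite mulrA.
rewrite (Bcoact_sw_coassoc Hh Hc flat); last by rewrite /g; lin.
apply: eq_tlift => z0 h; rewrite /g.
by rewrite (cmod_compat_sw Hh Hc (f := fun w0 h => z0 * (bg w0 * bg (act X v h)))) //; lin.
Qed.

Section AntipodeLift.
Local Notation opgen := (fun v => tolin (Bantip_op v)).
Let Ea := end_is_algebra B.
Let ol : linear opgen.
Proof. by have ob := Bantip_op_bilinear; apply: lin_tolin => v; lin. Qed.

Let orel r : relator S r ->
  talg_lift (fun F G : linmap B B => tolin (F \o G)) (tolin id) opgen r = 0.
Proof.
have ob := Bantip_op_bilinear.
apply: (quad_relator_lift Ea ol) => w e; apply: linmapP => z.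
rewrite (linear_tlift (h := fun F : linmap B B => F z)) //.
have -> : (0 : linmap B B) z = 0 by [].
transitivity (\sw_(x, y <- w) Bantip_op x (Bantip_op y z)).
  apply: eq_tlift => x y; rewrite tolin_app /= ?tolin_app //; try lin.
  by rewrite !tolinE; [rewrite /comp; lin | lin | lin].
pose m (z : X ⊗ X) := \sw_(x, y <- z) bg x * bg y.
pose D h (z : X ⊗ X) := \sw_(x, y <- z) \sw_(u1, u2 <- cop h) act X x u1 ⊗ act X y u2.
(* For w fixed by Psi the diagonal action [D h] yields a fixed tensor again by [braid_act], and its
   product vanishes in B. *)
transitivity (- \sw_(z0, h <- Coact z) z0 * m (D h (braid w))).
  rewrite /m /D; sweedler w as x y; pureE; rewrite Bantip_op_comp; congr (- _).
  apply: eq_tlift => z0 h; rewrite braidE //.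
  sweedler (coact X y) as y0 y1; pureE; sweedler (cop h) as h1 h2; pureE.
  by rewrite cmod_actM.
rewrite tlift_eq0 ?oppr0 // => z0 h.
by rewrite /m bgen_rel ?mulr0 // /D (braid_act Hh Hc) !e.
Qed.

Definition Bantip (x : B) : B :=
  qalg_lift (fun F G : linmap B B => tolin (F \o G)) (tolin id) opgen x 1.

Lemma Bantip_linear : linear Bantip.
Proof. by move=> a x y; rewrite /Bantip (qalg_lift_linear Ea ol orel). Qed.
Lemma Bantip1 : Bantip 1 = 1.
Proof. by rewrite /Bantip (qalg_lift1 Ea ol orel) tolin_app. Qed.
Lemma Bantip_genM v y : Bantip (bg v * y) = Bantip_op v (Bantip y).
Proof.
have ob := Bantip_op_bilinear.
rewrite /Bantip (qalg_liftM Ea ol orel) (qalg_lift_gen Ea ol orel).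
rewrite tolin_app /= ?tolin_app //; try lin.
by rewrite !tolinE; [rewrite /comp; lin | lin].
Qed.
End AntipodeLift.

Let antl := Bantip_linear.
Let opb := Bantip_op_bilinear.

Lemma Bantip_par x : Bantip (par x) = par (Bantip x).
Proof.
move: x; apply: qalg_eq_ind => [|||v y IH]; [lin | lin | |].
  by rewrite Bpar1 Bantip1 Bpar1.
by rewrite BparM Bpar_gen mulNr (linear_mapN _ antl) !Bantip_genM IH Bantip_op_par.
Qed.

(** The operator is colinear in both arguments jointly. Colinearity of the antipode follows; it
    serves for the left antipode law below and again for the antipode of the smash product. *)
Lemma Bcoact_antip_op v z : Coact (Bantip_op v z) =
  \sw_(v0, v1 <- coact X v) \sw_(z0, z1 <- Coact z) Bantip_op v0 z0 ⊗ (v1 * z1).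
Proof.
pose g z0 h h' := \sw_(w0, w1 <- coact X (act X v h')) (z0 * bg w0) ⊗ (h * w1).
pose g' z0 h h' := \sw_(v0, v1 <- coact X v) (z0 * bg (act X v0 h)) ⊗ (v1 * h').
rewrite {1}/Bantip_op (linear_mapN _ coactl) (linear_tlift _ _ coactl).
transitivity (- \sw_(z0, h <- Coact (par z)) \sw_(z1, h' <- Coact z0) g z1 h' h).
  congr (- _); apply: eq_tlift => z0 h; rewrite BcoactM // coact_gen /g.
  sweedler (coact X (act X v h)) as w0 w1; pureE.
  by sweedler (Coact z0) as z1 h'; pureE; rewrite tmulE.
rewrite (Bcoact_sw_coassoc Hh Hc flat); last by rewrite /g; lin.
transitivity (- \sw_(z0, h <- Coact (par z)) \sw_(h1, h2 <- cop h) g' z0 h1 h2).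
  congr (- _); apply: eq_tlift => z0 h; rewrite /g /g'.
  by rewrite (cmod_compat_sw Hh Hc (f := fun w h => (z0 * bg w) ⊗ h)) //; lin.
rewrite -(Bcoact_sw_coassoc Hh Hc flat); last by rewrite /g'; lin.
rewrite (coact_sw_par Hh Hc flat); last by rewrite /g'; lin.
rewrite /g' /Bantip_op; sweedler (coact X v) as v0 v1; pureE.
sweedler (Coact z) as z0 z1; pureE; rewrite pureNl; congr (- _).
by sweedler (Coact (par z0)) as c h; pureE.
Qed.

Lemma Bcoact_antip x : Coact (Bantip x) = tmap Bantip id (Coact x).
Proof.
move: x; apply: qalg_eq_ind => [|||v y IH]; [lin | lin | |].
  by rewrite Bantip1 Bcoact1 //; pureE; rewrite Bantip1.
rewrite Bantip_genM Bcoact_antip_op IH BcoactM // coact_gen.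
sweedler (coact X v) as v0 v1; pureE; sweedler (Coact y) as y0 y1; pureE.
by rewrite tmulE; pureE; rewrite Bantip_genM.
Qed.

(** The operator is made for this law: on [v * y] the two terms contributed by each pair of legs of
    [y] cancel directly. *)
Lemma Bantip_l x : \sw_(x1, x2 <- Cop x) Bantip x1 * x2 = (Coun x)%:A.
Proof.
move: x; apply: qalg_eq_ind => [|||v y IH]; [lin | lin | |].
  by rewrite Bcop1 //; pureE; rewrite Bantip1 Bcoun1 scale1r mulr1.
rewrite (Bcop_sw_gen_mul K2 Hh Hc flat); last by lin.
rewrite Bcoun_genM scale0r; apply: tlift_eq0 => p q.
rewrite Bantip_genM /Bantip_op -Bantip_par Bcoact_antip mulNr.
apply/eqP; rewrite addrC subr_eq0; apply/eqP.
by sweedler (Coact (par p)) as p0 p1; pureE; rewrite mulrA.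
Qed.

Lemma Bantip_r x : \sw_(x1, x2 <- Cop x) x1 * Bantip x2 = (Coun x)%:A.
Proof.
move: x; apply: qalg_eq_ind => [|||v y IH]; [lin | lin | |].
  by rewrite Bcop1 //; pureE; rewrite Bantip1 Bcoun1 scale1r mulr1.
rewrite (Bcop_sw_gen_mul K2 Hh Hc flat); last by lin.
rewrite Bcoun_genM scale0r tlift_split.
have -> : \sw_(p, q <- Cop y) (bg v * p) * Bantip q = bg v * (Coun y)%:A.
  by rewrite -IH; sweedler (Cop y) as p q; pureE; rewrite mulrA.
(* [F] carries the odd generator to the right of [z]. The second part of the sum is minus [F] of the
   first leg times the antipode of the second, so the induction hypothesis leaves the value of [F]
   at a scalar, where it is multiplication by [v]. *)
pose F z := \sw_(c, h <- Coact (par z)) c * bg (act X v h).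
have Fl : linear F by rewrite /F; lin.
transitivity (bg v * (Coun y)%:A - F ((Coun y)%:A)); last first.
  rewrite (linear_mapZ _ _ Fl) /F Bpar1 Bcoact1 //; pureE.
  by rewrite cmod_act1 // mul1r -scalerAr mulr1 subrr.
congr (_ + _); rewrite -IH (linear_tlift _ _ Fl) [RHS](linear_tlift (h := -%R)); last exact: lin_opp.
apply: eq_tlift => p q; rewrite /F BparM BcoactM //.
transitivity (\sw_(y0, y1 <- Coact (par p)) y0 * Bantip_op (act X v y1) (Bantip q)).
  by apply: eq_tlift => y0 y1; rewrite Bantip_genM.
rewrite /Bantip_op; sweedler (Coact (par p)) as y0 y1; pureE.
rewrite mulrN; congr (- _); sweedler (Coact (par (Bantip q))) as c h; pureE.
by rewrite tmulE; pureE; rewrite cmod_actM // mulrA.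
Qed.

Lemma Bdeg_act n x u : deg n x -> deg n (Act x u).
Proof.
move=> hx; elim/Bdeg_ind: hx u => [k u|k a y z hy hz u|u|k v y _ hy u].
- by rewrite (linear_map0 (bilin_l _ actb)); exact: Bdeg0.
- by rewrite (bilin_l _ actb); exact: Bdeg_linear.
- by rewrite Bact1 //; apply: BdegZ; exact: Bdeg_one.
rewrite BactM //; apply: Bdeg_tlift => u1 u2; rewrite act_gen.
exact: Bdeg_genM.
Qed.

Lemma Bdeg_coact n x : deg n x -> pure_span (fun p => deg n p.1) (Coact x).
Proof.
elim/Bdeg_ind => [k|k a y z hy hz||k v y _ hy].
- by rewrite (linear_map0 coactl); exact: pure_span0.
- by rewrite coactl; apply: pure_span_linear => // c p q /=; exact: BdegZ.
- by rewrite Bcoact1 //; apply: pure_span_pure; exact: Bdeg_one.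
have -> : Coact (bg v * y) = \sw_(y0, y1 <- Coact y) \sw_(v0, v1 <- coact X v)
    (bg v0 * y0) ⊗ (v1 * y1).
  rewrite BcoactM // coact_gen; sweedler (Coact y) as y0 y1; pureE.
  by sweedler (coact X v) as v0 v1; pureE; rewrite tmulE.
apply: pure_span_tlift_in hy _; first by lin.
move=> y0 y1 /= h; apply: pure_span_tlift => v0 v1; apply: pure_span_pure.
exact: Bdeg_genM.
Qed.

Lemma Bdeg_par n x : deg n x -> deg n (par x).
Proof. by move=> hx; rewrite Bquad_parE (Bscale_deg _ hx); exact: BdegZ. Qed.

Lemma Bdeg_cop n x : deg n x -> tens_deg deg n (Cop x).
Proof.
pose R n (p : B * B) := exists k l, [/\ (k + l)%N = n, deg k p.1 & deg l p.2].
have RZ m a v w : R m (v, w) -> R m (a *: v, w).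
  by move=> [k [l [e h1 h2]]]; exists k, l; split=> //; exact: BdegZ.
rewrite -[tens_deg _ _ _]/(pure_span (R n) (Cop x)).
elim/Bdeg_ind => [k|k a y z hy hz||k v y _ hy].
- by rewrite (linear_map0 copl); exact: pure_span0.
- by rewrite copl; apply: pure_span_linear => //; exact: RZ.
- rewrite Bcop1 //; apply: pure_span_pure; exists 0%N, 0%N; split=> //; exact: Bdeg_one.
have [f1 f2 f3] := Bcop_gen_mul_trilinear Hh Hc flat.
rewrite Bcop_gen_mul_sw //; apply: pure_span_tlift_in hy _; first by split.
move=> p q [i [j [<- hp hq]]]; apply: pure_spanD.
  by apply: pure_span_pure; exists i.+1, j; split=> //; exact: Bdeg_genM.
apply: pure_span_tlift_in (Bdeg_coact (Bdeg_par hp)) _; first by lin.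
move=> y0 h /= hy0; apply: pure_span_pure; exists i, j.+1; split=> //.
  by rewrite addnS.
exact: Bdeg_genM.
Qed.

Lemma Bdeg_coun n x : deg n.+1 x -> Coun x = 0.
Proof.
suff h k : deg k x -> (0 < k)%N -> Coun x = 0 by move/h; exact.
elim/Bdeg_ind => [m|m a y z hy hz m0||m v y _ _ _] //.
- by rewrite (linear_map0 Bcoun_linear).
- by rewrite Bcoun_linear hy // hz // scaler0 addr0.
exact: Bcoun_genM.
Qed.

Lemma Bdeg_antip n x : deg n x -> deg n (Bantip x).
Proof.
elim/Bdeg_ind => [k|k a y z hy hz||k v y _ hy].
- by rewrite (linear_map0 antl); exact: Bdeg0.
- by rewrite antl; exact: Bdeg_linear.
- by rewrite Bantip1; exact: Bdeg_one.
rewrite Bantip_genM /Bantip_op; apply: BdegN.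
have [s [-> hs]] := Bdeg_coact (Bdeg_par hy).
rewrite (linear_map_sum (h := tlift _)); last by lin.
rewrite big_seq; elim/big_ind: _ => [|x1 x2|p /hs hp]; [exact: Bdeg0 | exact: BdegD |].
by pureE; rewrite -addn1; apply: BdegM => //; exact: Bdeg_gen.
Qed.

Lemma Bis_braided_super_hopf : is_braided_super_hopf (Bquad X).
Proof.
split=> /=.
- exact: Bc.
- exact: Bis_graded.
- exact: Bdeg_one.
- exact: BdegM.
- exact: Bdeg_act.
- exact: Bdeg_coact.
- exact: Bact1.
- exact: BactM.
- exact: Bcoact1.
- exact: BcoactM.
- exact: copl.
- exact: Bdeg_cop.
- exact: Bcop1.
- exact: BcopM.
- exact: Bcop_coassoc.
- exact: Bcop_act.
- exact: Bcop_coact.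
- exact: Bcoun_linear.
- exact: Bcoun1.
- exact: BcounM.
- exact: Bdeg_coun.
- exact: Bcop_counl.
- exact: Bcop_counr.
- exists Bantip; split; [exact: antl | exact: Bdeg_antip | exact: Bantip_l | exact: Bantip_r].
Qed.

Lemma Bquad_extendsP : Bquad_extends X.
Proof.
split; [exact: act_gen | exact: coact_gen | | exact: Bcoun_gen].
exact: Bcop_gen.
Qed.

End QuadraticAntipode.

(** * Super Hopf structure of the smash product *)

Record super_alg (K : fieldType) (O : shopf_data K) : Prop := SuperAlg {
  sa_alg : is_algebra (@sh_mul K O) (sh_one O);
  sa_par : linear (sh_par O);
  sa_parK : involutive (sh_par O);
  sa_parM : forall z z', sh_par O (z ∙ z') = sh_par O z ∙ sh_par O z'
}.

Section SuperTensorSquare.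
Variables (K : fieldType) (O : shopf_data K).
Hypotheses (K2 : 2%:R != 0 :> K) (OA : super_alg O).

Local Notation par := (sh_par O).
Local Notation tm := (@sh_tmul K O).
Let mulb : bilinear_map (@sh_mul K O) := is_alg_bilinear (sa_alg OA).
Let parl : linear par := sa_par OA.

Lemma sh_mulNl (x y : O) : (- x) ∙ y = - (x ∙ y).
Proof. exact: (linear_mapN x (bilin_l y mulb)). Qed.

Lemma sh_mulNr (x y : O) : x ∙ (- y) = - (x ∙ y).
Proof. exact: (linear_mapN y (bilin_r x mulb)). Qed.

Lemma sh_mulDl (x y z : O) : (x + y) ∙ z = x ∙ z + y ∙ z.
Proof. exact: (linear_mapD x y (bilin_l z mulb)). Qed.

Lemma sh_mulDr (x y z : O) : x ∙ (y + z) = x ∙ y + x ∙ z.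
Proof. exact: (linear_mapD y z (bilin_r x mulb)). Qed.

Lemma sh_mulA (x y z : O) : x ∙ (y ∙ z) = x ∙ y ∙ z.
Proof. exact: is_algA (sa_alg OA) x y z. Qed.

Lemma sh_tmul_bilinear : bilinear_map tm.
Proof. by rewrite /sh_tmul; lin. Qed.
Let tmb := sh_tmul_bilinear.

Lemma sh_tmulE e (a b c d : O) : homog par e b ->
  tm (a ⊗ b) (c ⊗ d) = (a ∙ sgn par e c) ⊗ (b ∙ d).
Proof. by move=> hb; rewrite /sh_tmul; pureE; rewrite (koszulE K2 parl c hb); pureE. Qed.

Lemma sh_homogM e e' (x y : O) :
  homog par e x -> homog par e' y -> homog par (e (+) e') (x ∙ y).
Proof.
rewrite /homog (sa_parM OA) => -> ->.
by case: e e' => -[]; rewrite ?sh_mulNl ?sh_mulNr ?opprK.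
Qed.

Lemma sh_sgnM e (x y : O) : sgn par e (x ∙ y) = sgn par e x ∙ sgn par e y.
Proof. by case: e => //; exact: (sa_parM OA). Qed.

Lemma sh_tmulA : associative tm.
Proof.
move=> x y z; sweedler x as a b; sweedler y as c d; sweedler z as p q.
move: d; apply: (homog_ind K2 parl (sa_parK OA)); [lin | lin | move=> e' d hd].
move: b; apply: (homog_ind K2 parl (sa_parK OA)); [lin | lin | move=> e b hb].
rewrite (sh_tmulE a c d hb) (sh_tmulE c p q hd) (sh_tmulE _ _ _ hb).
rewrite (sh_tmulE _ _ _ (sh_homogM hb hd)) !sh_mulA sh_sgnM.
by rewrite (sgn_addb (sa_parK OA)) sh_mulA.
Qed.

End SuperTensorSquare.

Section SmashProduct.
Variables (K : fieldType) (H : hopf_data K) (L : bsuper_data H).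
Hypotheses (K0 : forall n, n.+1%:R != 0 :> K) (Hh : is_hopf H).
Hypothesis HL : is_braided_super_hopf L.
Hypothesis HA : super_cmod_alg (bs_act L) (bs_coact L) (bs_par L).

Local Notation O := (smash L).
Let K2 : 2%:R != 0 :> K := K0 1.
Let Lc : is_cmod (bs_cmod L) := bs_is_cmod HL.
Let actb : bilinear_map (bs_act L) := cmod_act_bilinear Lc.
Let coactl : linear (bs_coact L) := cmod_coact_linear Lc.
Let copl : linear (bs_cop L) := bs_cop_linear HL.
Let counl : linear (bs_coun L : L -> K^o) := bs_coun_linear HL.
Let parl : linear (bs_par L) := sca_par HA.
Let actM : forall (x : L) (a b : H), bs_act L x (a * b) = bs_act L (bs_act L x a) b :=
  cmod_actM Lc.
Let actr1 : forall x : L, bs_act L x 1 = x := cmod_act1 Lc.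

Lemma bs_coact_sw_coassoc (Z : lmodType K) (f : L -> H -> H -> Z) x : trilinear f ->
  \sw_(y, h <- bs_coact L x) \sw_(z, h' <- bs_coact L y) f z h' h =
  \sw_(y, h <- bs_coact L x) \sw_(h1, h2 <- cop h) f y h1 h2.
Proof. exact: (coact_sw_coassoc Hh Lc). Qed.

Lemma smash_mul_bilinear : bilinear_map (@sh_mul K O).
Proof. by rewrite /= /smash_mul; lin. Qed.
Let mulb := smash_mul_bilinear.

Lemma smash_mulE a x b y : ((a ⊗ x : O) ∙ (b ⊗ y) : O) =
  \sw_(b1, b2 <- cop b) (a * b1) ⊗ (bs_act L x b2 * y).
Proof. by rewrite /= /smash_mul; pureE. Qed.

Lemma smash_mull a b y : ((a ⊗ 1 : O) ∙ (b ⊗ y) : O) = (a * b) ⊗ y.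
Proof.
rewrite smash_mulE -[RHS](cop_sw_counr Hh (f := fun b => (a * b) ⊗ y)); last by lin.
by apply: eq_tlift => b1 b2; rewrite (sca_act1 HA) mulr_algl pureZr.
Qed.

Lemma smash_mulr a x y : ((a ⊗ x : O) ∙ (1 ⊗ y) : O) = a ⊗ (x * y).
Proof. by rewrite smash_mulE (hopf_cop1 Hh); pureE; rewrite mulr1 actr1. Qed.

Lemma smash_pureE a x : a ⊗ x = (a ⊗ 1 : O) ∙ (1 ⊗ x).
Proof. by rewrite smash_mull mulr1. Qed.

Lemma smash_mulA : associative (@sh_mul K O).
Proof.
move=> z z' z''; sweedler z as a x; sweedler z' as b y; sweedler z'' as c t.
rewrite (smash_mulE a x b y) (smash_mulE b y c t).
rewrite (linear_tlift (h := fun z : O => z ∙ (c ⊗ t : O))); last by lin.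
rewrite (linear_tlift (h := sh_mul (a ⊗ x : O))); last by lin.
pose g b1 b2 c1 e1 e2 := (a * b1 * c1) ⊗ (bs_act L x (b2 * e1) * (bs_act L y e2 * t)).
transitivity (\sw_(c1, c2 <- cop c) \sw_(e1, e2 <- cop c1) \sw_(b1, b2 <- cop b) g b1 b2 e1 e2 c2).
  apply: eq_tlift => c1 c2; rewrite smash_mulE (cop_sw_mul Hh); last by lin.
  rewrite /g; sweedler (cop b) as b1 b2; pureE; sweedler (cop c1) as e1 e2; pureE.
  by rewrite !mulrA.
rewrite (cop_sw_coassoc Hh (f := fun e1 e2 c2 => \sw_(b1, b2 <- cop b) g b1 b2 e1 e2 c2)); last first.
  by rewrite /g; lin.
rewrite /g; sweedler (cop b) as b1 b2; pureE; rewrite smash_mulE.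
apply: eq_tlift => c1 c2; rewrite (sca_actM HA); sweedler (cop c2) as e1 e2; pureE.
by rewrite actM !mulrA.
Qed.

Lemma smash_is_algebra : is_algebra (@sh_mul K O) (sh_one O).
Proof.
split; [exact: mulb | exact: smash_mulA | |] => z.
  sweedler z as a x; transitivity ((1 * a) ⊗ x); [exact: smash_mull | by rewrite mul1r].
sweedler z as a x; transitivity (a ⊗ (x * 1)); [exact: smash_mulr | by rewrite mulr1].
Qed.

Lemma smash_cop_linear : linear (sh_cop O).
Proof. by rewrite /= /smash_cop; lin. Qed.
Let scopl := smash_cop_linear.

Lemma smash_copE a x : sh_cop O (a ⊗ x) =
  \sw_(a1, a2 <- cop a) \sw_(x1, x2 <- bs_cop L x) \sw_(x10, x11 <- bs_coact L x1)
    (a1 ⊗ x10) ⊗ ((a2 * x11) ⊗ x2).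
Proof. by rewrite /= /smash_cop; pureE. Qed.

Local Notation par := (sh_par O).

Lemma smash_par_linear : linear par.
Proof. by rewrite /=; lin. Qed.
Let sparl := smash_par_linear.

Lemma smash_parE a x : par (a ⊗ x) = a ⊗ bs_par L x.
Proof. by rewrite /=; pureE. Qed.

Lemma smash_parK : involutive par.
Proof. by move=> z; sweedler z as a x; rewrite !smash_parE (sca_parK HA). Qed.

Lemma smash_parM z z' : par (z ∙ z') = par z ∙ par z'.
Proof.
sweedler z as a x; sweedler z' as b y; rewrite !smash_parE !smash_mulE.
rewrite (linear_tlift _ _ sparl); apply: eq_tlift => b1 b2.
by rewrite smash_parE (sca_parM HA) (sca_act_par HA).
Qed.

Lemma smash_super_alg : super_alg O.
Proof.
split; [exact: smash_is_algebra | exact: sparl | exact: smash_parK | exact: smash_parM].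
Qed.

Local Notation tm := (@sh_tmul K O).
Let tmb : bilinear_map tm := sh_tmul_bilinear smash_super_alg.
Let sh_tmulE := sh_tmulE K2 smash_super_alg.
Let sh_tmulA := sh_tmulA K2 smash_super_alg.

(** Multiplicativity of the coproduct is checked on three kinds of products: an element of H times
    anything, two elements of L, and an element of L times one of H. Splitting a ⊗ x as (a ⊗ 1)(1 ⊗
    x) assembles the general case. *)
Lemma smash_copM_l a z : sh_cop O ((a ⊗ 1 : O) ∙ z) = tm (sh_cop O (a ⊗ 1)) (sh_cop O z).
Proof.
have h1 (c : H) : homog par false (c ⊗ 1 : O) by rewrite /homog smash_parE (sca_par1 HA).
sweedler z as b y; rewrite smash_mull !smash_copE (bs_cop1 HL) (cop_sw_mul Hh); last by lin.
sweedler (cop a) as a1 a2; sweedler (cop b) as b1 b2; pureE.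
sweedler (bs_cop L y) as y1 y2; pureE; rewrite (sca_coact1 HA); pureE.
sweedler (bs_coact L y1) as y10 y11; pureE.
by rewrite mulr1 (sh_tmulE _ _ _ (h1 _)) /sgn !smash_mull mulrA.
Qed.

Lemma smash_homog e (a : H) (x : L) : homog (bs_par L) e x -> homog par e (a ⊗ x : O).
Proof. by rewrite /homog smash_parE => ->; case: e => //; rewrite pureNr. Qed.

(** The braiding in [bs_tmul] reappears on the right as the commutation rule of the smash product,
    applied when the coaction leg of [y1] is moved past [x2]; the two Koszul signs are the same. *)
Lemma smash_copM_ll (x y : L) :
  sh_cop O (1 ⊗ (x * y)) = tm (sh_cop O (1 ⊗ x)) (sh_cop O (1 ⊗ y)).
Proof.
rewrite !smash_copE (hopf_cop1 Hh); pureE; rewrite (bs_copM HL).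
have bb := bs_tmul_bilinear HA.
sweedler (bs_cop L x) as x1 x2; sweedler (bs_cop L y) as y1 y2; pureE.
move: x2; apply: (homog_ind K2 parl (sca_parK HA)); [lin | lin | move=> e x2 hx2].
rewrite (bs_tmulE K2 HA _ _ _ hx2); set y' := sgn _ e y1.
pose g y0 h h' := \sw_(x0, x1' <- bs_coact L x1)
  ((1 : H) ⊗ (x0 * y0)) ⊗ ((x1' * h) ⊗ (bs_act L x2 h' * y2)).
transitivity (\sw_(y0, h <- bs_coact L y') \sw_(y00, h' <- bs_coact L y0) g y00 h' h).
  rewrite (linear_tlift (h := tlift _)); last by lin.
  apply: eq_tlift => y0 h; pureE; rewrite (coact_sw_mul HA); last by lin.
  rewrite /g; sweedler (bs_coact L x1) as x10 x11; pureE.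
  by apply: eq_tlift => y00 h'; pureE; rewrite mul1r.
rewrite (bs_coact_sw_coassoc (f := g)); last by rewrite /g; lin.
have -> : \sw_(y0, h <- bs_coact L y') \sw_(h1, h2 <- cop h) g y0 h1 h2 =
    \sw_(y0, h <- bs_coact L y1) \sw_(h1, h2 <- cop h) g (sgn (bs_par L) e y0) h1 h2.
  rewrite (coact_sgn HA) /g.
  by sweedler (bs_coact L y1) as y0 h; pureE.
rewrite /g; sweedler (bs_coact L x1) as x10 x11; pureE.
sweedler (bs_coact L y1) as y0 h; pureE.
rewrite !mul1r (sh_tmulE _ _ _ (smash_homog x11 hx2)).
have -> : sgn par e (1 ⊗ y0 : O) = 1 ⊗ sgn (bs_par L) e y0.
  by case: (e) => //; exact: smash_parE.
rewrite smash_mulr smash_mulE; sweedler (cop h) as h1 h2; pureE.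
by [].
Qed.

(** Of the four legs of [b] the two middle ones meet [x1], one through the action before the
    coaction and one by multiplication. The crossed module condition interchanges these roles. *)
Lemma smash_copM_lr (x : L) (b : H) :
  sh_cop O ((1 ⊗ x : O) ∙ (b ⊗ 1)) = tm (sh_cop O (1 ⊗ x)) (sh_cop O (b ⊗ 1)).
Proof.
pose f (x1 x2 : L) (c1 c2 d1 d2 : H) := \sw_(x10, x11 <- bs_coact L (bs_act L x1 d1))
  (c1 ⊗ x10) ⊗ ((c2 * x11) ⊗ bs_act L x2 d2).
pose g (x1 x2 : L) (c1 c2 d1 d2 : H) := \sw_(x10, x11 <- bs_coact L x1)
  (c1 ⊗ bs_act L x10 c2) ⊗ ((x11 * d1) ⊗ bs_act L x2 d2).
rewrite smash_mulE (linear_tlift _ _ scopl).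
transitivity (\sw_(x1, x2 <- bs_cop L x) \sw_(b1, b2 <- cop b)
    \sw_(c1, c2 <- cop b1) \sw_(d1, d2 <- cop b2) f x1 x2 c1 c2 d1 d2).
  transitivity (\sw_(b1, b2 <- cop b) \sw_(x1, x2 <- bs_cop L x)
      \sw_(c1, c2 <- cop b1) \sw_(d1, d2 <- cop b2) f x1 x2 c1 c2 d1 d2).
    apply: eq_tlift => b1 b2; rewrite /f mul1r mulr1 smash_copE (bs_cop_act HL).
    sweedler (bs_cop L x) as x1 x2; pureE.
    sweedler (cop b1) as c1 c2; pureE; sweedler (cop b2) as d1 d2; pureE.
    by [].
  exact: tlift_exchange.
transitivity (\sw_(x1, x2 <- bs_cop L x) \sw_(b1, b2 <- cop b)
    \sw_(c1, c2 <- cop b1) \sw_(d1, d2 <- cop b2) g x1 x2 c1 c2 d1 d2).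
  apply: eq_tlift => x1 x2.
  rewrite (cop_sw_coassoc4 Hh (f := f x1 x2)); last by rewrite /f; lin.
  rewrite (cop_sw_coassoc4 Hh (f := g x1 x2)); last by rewrite /g; lin.
  apply: eq_tlift => b1 b2; apply: eq_tlift => c d; rewrite /f /g.
  by rewrite (cmod_compat_sw Hh Lc (f := fun y h => (b1 ⊗ y) ⊗ (h ⊗ bs_act L x2 d))) //; lin.
rewrite !smash_copE (hopf_cop1 Hh) (bs_cop1 HL) /g.
sweedler (bs_cop L x) as x1 x2; pureE.
move: x2; apply: (homog_ind K2 parl (sca_parK HA)); [lin | lin | move=> e x2 hx2].
sweedler (cop b) as b1 b2; pureE; rewrite (sca_coact1 HA).
sweedler (bs_coact L x1) as x10 x11; pureE.
rewrite mul1r mulr1 (sh_tmulE _ _ _ (smash_homog x11 hx2)).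
have -> : sgn par e (b1 ⊗ 1 : O) = b1 ⊗ 1.
  by case: (e) => //; rewrite /sgn smash_parE (sca_par1 HA).
rewrite !smash_mulE; sweedler (cop b1) as c1 c2; pureE.
by sweedler (cop b2) as d1 d2; pureE; rewrite mul1r !mulr1.
Qed.

Lemma smash_copM z z' : sh_cop O (z ∙ z') = tm (sh_cop O z) (sh_cop O z').
Proof.
have xb x b : sh_cop O ((1 ⊗ x : O) ∙ (b ⊗ 1 : O)) = tm (sh_cop O (1 ⊗ x)) (sh_cop O (b ⊗ 1)).
  exact: smash_copM_lr.
have xz x z0 : sh_cop O ((1 ⊗ x : O) ∙ z0) = tm (sh_cop O (1 ⊗ x)) (sh_cop O z0).
  sweedler z0 as b y; rewrite (smash_pureE b y) smash_mulA smash_copM_l sh_tmulA -xb.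
  rewrite smash_mulE (linear_tlift (h := fun t : O => t ∙ (1 ⊗ y : O))); last by lin.
  rewrite !(linear_tlift _ _ scopl) (linear_tlift (h := fun t => tm t (sh_cop O (1 ⊗ y)))); last by lin.
  apply: eq_tlift => b1 b2; rewrite mul1r mulr1 smash_mulr (smash_pureE b1) smash_copM_l.
  by rewrite smash_copM_ll sh_tmulA -smash_copM_l -smash_pureE.
sweedler z as a x; rewrite (smash_pureE a x) -smash_mulA !smash_copM_l xz.
by rewrite sh_tmulA.
Qed.

Lemma smash_coassoc z :
  tassoc (tmap (sh_cop O) id (sh_cop O z)) = tmap id (sh_cop O) (sh_cop O z).
Proof.
sweedler z as a x.
(* [E] is the normal form reached from both sides. The left side needs colinearity of the braided
   coproduct and coassociativity of the coaction; the two coassociativity laws of H and of L then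
   match the legs. *)
pose E (a1 a2 a3 : H) (p q r : L) : O ⊗ (O ⊗ O) :=
  \sw_(p0, h <- bs_coact L p) \sw_(h1, h2 <- cop h) \sw_(q0, q1 <- bs_coact L q)
    (a1 ⊗ p0) ⊗ (((a2 * h1) ⊗ q0) ⊗ ((a3 * (h2 * q1)) ⊗ r)).
have Et a1 a2 a3 : trilinear (E a1 a2 a3) by rewrite /E; lin.
pose W a1 a2 a3 := \sw_(x1, x2 <- bs_cop L x) \sw_(p, q <- bs_cop L x1) E a1 a2 a3 p q x2.
rewrite smash_copE.
transitivity (\sw_(a1, a2 <- cop a) \sw_(b1, b2 <- cop a1) W b1 b2 a2).
  transitivity (\sw_(a1, a2 <- cop a) \sw_(b1, b2 <- cop a1) \sw_(x1, x2 <- bs_cop L x)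
    \sw_(x10, x11 <- bs_coact L x1) \sw_(p, q <- bs_cop L x10) \sw_(p0, p1 <- bs_coact L p)
      (b1 ⊗ p0 : O) ⊗ (((b2 * p1) ⊗ q : O) ⊗ ((a2 * x11) ⊗ x2 : O))).
    sweedler (cop a) as a1 a2; pureE; rewrite [RHS]tlift_exchange.
    sweedler (bs_cop L x) as x1 x2; pureE; rewrite [RHS]tlift_exchange.
    sweedler (bs_coact L x1) as x10 x11; pureE.
    rewrite smash_copE; sweedler (cop a1) as b1 b2; pureE.
    sweedler (bs_cop L x10) as p q; pureE; sweedler (bs_coact L p) as p0 p1; pureE.
    by [].
  apply: eq_tlift => a1 a2; apply: eq_tlift => b1 b2; apply: eq_tlift => x1 x2.
  rewrite (cop_coact_sw copl coactl (bs_cop_coact HL x1) (f := fun p q h =>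
    \sw_(p0, p1 <- bs_coact L p) (b1 ⊗ p0 : O) ⊗ (((b2 * p1) ⊗ q : O) ⊗ ((a2 * h) ⊗ x2 : O))));
    last by lin.
  apply: eq_tlift => p q; rewrite /E.
  transitivity (\sw_(p0, h <- bs_coact L p) \sw_(p00, h' <- bs_coact L p0)
    \sw_(q0, q1 <- bs_coact L q)
      (b1 ⊗ p00 : O) ⊗ (((b2 * h') ⊗ q0 : O) ⊗ ((a2 * (h * q1)) ⊗ x2 : O))).
    apply: eq_tlift => p0 h; exact: tlift_exchange.
  by rewrite (bs_coact_sw_coassoc (f := fun p00 h' h => \sw_(q0, q1 <- bs_coact L q)
      (b1 ⊗ p00 : O) ⊗ (((b2 * h') ⊗ q0 : O) ⊗ ((a2 * (h * q1)) ⊗ x2 : O)))) //; lin.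
rewrite (cop_sw_coassoc Hh (f := W)); last by rewrite /W /E; lin.
transitivity (\sw_(a1, a2 <- cop a) \sw_(b1, b2 <- cop a2)
   \sw_(x1, x2 <- bs_cop L x) \sw_(q, r <- bs_cop L x2) E a1 b1 b2 x1 q r).
  apply: eq_tlift => a1 a2; apply: eq_tlift => b1 b2; rewrite /W.
  exact: (sw_assoc copl copl (bs_coassoc HL x) (Et a1 b1 b2)).
rewrite /E; sweedler (cop a) as a1 a2; pureE.
sweedler (bs_cop L x) as x1 x2; pureE; nested_pureE.
sweedler (bs_coact L x1) as x10 x11; pureE; nested_pureE.
rewrite smash_copE (linear_tlift (h := pure (a1 ⊗ x10 : O))); last by lin.
rewrite (cop_sw_mul Hh); last by lin.
sweedler (cop a2) as b1 b2; pureE; sweedler (cop x11) as h1 h2; pureE; nested_pureE.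
sweedler (bs_cop L x2) as q r; pureE; sweedler (bs_coact L q) as q0 q1; pureE.
by rewrite mulrA.
Qed.

Let Kmulb := is_alg_bilinear (algType_is_algebra K^o).

Let coun_mulb : bilinear_map (fun (a : H) (x : L) => coun a * bs_coun L x : K^o).
Proof.
apply: bilinearP => w.
  exact: (bilin_compl (f := *%R) _ Kmulb (hopf_coun_linear Hh)).
exact: (bilin_compr (f := *%R) _ Kmulb counl).
Qed.

Lemma smash_coun_linear : linear (sh_coun O : O -> K^o).
Proof. exact: tlift_linear coun_mulb. Qed.
Let scounl := smash_coun_linear.

Lemma smash_counE a x : sh_coun O (a ⊗ x) = coun a * bs_coun L x.
Proof. exact: (tliftE _ _ coun_mulb). Qed.

Hypothesis coun_act : forall (x : L) u, bs_coun L (bs_act L x u) = bs_coun L x * coun u.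
Hypothesis coun_coact : forall (Z : lmodType K) (f : H -> Z) (x : L), linear f ->
  \sw_(y, h <- bs_coact L x) bs_coun L y *: f h = bs_coun L x *: f 1.

Lemma smash_counM z z' : sh_coun O (z ∙ z') = sh_coun O z * sh_coun O z'.
Proof.
have ml (c : K) : linear (fun x : K^o => c * x : K^o) by move=> k u v; exact: (bilin_r (c : K^o) Kmulb k u v).
have mr (c : K) : linear (fun x : K^o => x * c : K^o) by move=> k u v; exact: (bilin_l (c : K^o) Kmulb k u v).
move: z; apply: (tens_eq_ind (Z := K^o)) => [||a x].
- exact: (lin_comp scounl (bilin_l z' mulb)).
- exact: (lin_comp (mr _) scounl).
move: z'; apply: (tens_eq_ind (Z := K^o)) => [||b y].
- exact: (lin_comp scounl (bilin_r _ mulb)).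
- exact: (lin_comp (ml _) scounl).
rewrite !smash_counE smash_mulE (linear_tlift _ _ scounl).
pose c := coun a * bs_coun L x * bs_coun L y.
transitivity (\sw_(b1, b2 <- cop b) (coun b1 * (c * coun b2) : K^o)).
  apply: eq_tlift => b1 b2; rewrite smash_counE hopf_counM // (bs_counM HL) coun_act /c.
  change ((coun a * coun b1) * ((bs_coun L x * coun b2) * bs_coun L y) =
    coun b1 * ((coun a * bs_coun L x * bs_coun L y) * coun b2)); ring.
transitivity (c * coun b); last by rewrite /c; ring.
exact: (cop_sw_counl Hh (f := fun b => c * coun b : K^o) b (lin_comp (ml c) (hopf_coun_linear Hh))).
Qed.

Lemma smash_counl z : \sw_(z1, z2 <- sh_cop O z) sh_coun O z1 *: z2 = z.
Proof.
sweedler z as a x; rewrite smash_copE.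
transitivity (\sw_(a1, a2 <- cop a) \sw_(x1, x2 <- bs_cop L x) \sw_(x10, x11 <- bs_coact L x1)
   coun a1 *: (bs_coun L x10 *: ((a2 * x11) ⊗ x2))).
  sweedler (cop a) as a1 a2; pureE; sweedler (bs_cop L x) as x1 x2; pureE.
  by sweedler (bs_coact L x1) as x10 x11; pureE; rewrite smash_counE scalerA.
rewrite -[RHS](cop_sw_counl Hh (f := fun a => a ⊗ x)); last by lin.
apply: eq_tlift => a1 a2; rewrite -[X in _ = _ *: (_ ⊗ X)](bs_counl HL).
sweedler (bs_cop L x) as x1 x2; pureE.
rewrite -(linear_tlift (h := GRing.scale (coun a1))); last by lin.
rewrite (coun_coact (f := fun h => (a2 * h) ⊗ x2)); last by lin.
by rewrite mulr1 pureZr.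
Qed.

Lemma smash_counr z : \sw_(z1, z2 <- sh_cop O z) sh_coun O z2 *: z1 = z.
Proof.
sweedler z as a x; rewrite smash_copE.
transitivity (\sw_(a1, a2 <- cop a) \sw_(x1, x2 <- bs_cop L x) \sw_(x10, x11 <- bs_coact L x1)
   coun a2 *: (bs_coun L x2 *: (coun x11 *: (a1 ⊗ x10)))).
  sweedler (cop a) as a1 a2; pureE; sweedler (bs_cop L x) as x1 x2; pureE.
  sweedler (bs_coact L x1) as x10 x11; pureE.
  by rewrite smash_counE hopf_counM // !scalerA mulrAC -mulrA.
rewrite -[RHS](cop_sw_counr Hh (f := fun a => a ⊗ x)); last by lin.
apply: eq_tlift => a1 a2; rewrite -[X in _ = _ *: (_ ⊗ X)](bs_counr HL).
sweedler (bs_cop L x) as x1 x2; pureE.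
rewrite -(coact_sw_coun Hh Lc (f := fun x => coun a2 *: (a1 ⊗ (bs_coun L x2 *: x)))); last by lin.
apply: eq_tlift => x10 x11.
by rewrite !pureZr !scalerA; congr (_ *: _); ring.
Qed.

Local Notation sdeg := (sh_deg O).

Let sdegZ n (k : K) (a : H) (x : L) : bs_deg L n (a, x).2 -> bs_deg L n (k *: a, x).2.
Proof. by []. Qed.

Lemma smash_deg0 n : sdeg n 0.
Proof. exact: pure_span0. Qed.

Lemma smash_deg_linear n k (z z' : O) : sdeg n z -> sdeg n z' -> sdeg n (k *: z + z').
Proof. exact: (pure_span_linear (@sdegZ n)). Qed.

Lemma smash_deg_pure n (a : H) (x : L) : bs_deg L n x -> sdeg n (a ⊗ x : O).
Proof. by move=> hx; exact: (pure_span_pure (R := fun p => bs_deg L n p.2)). Qed.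

Let Lgr := bs_is_graded HL.

Lemma smash_deg_sum (z : O) : exists N (F : nat -> O),
  (forall n, sdeg n (F n)) /\ z = \sum_(n < N) F n.
Proof.
suff h : exists N (F : nat -> O), [/\ forall n, sdeg n (F n),
    forall n, (N <= n)%N -> F n = 0 & z = \sum_(n < N) F n].
  by have [N [F [hF _ e]]] := h; exists N, F.
have widen N M (F : nat -> O) : (forall n, (N <= n)%N -> F n = 0) -> (N <= M)%N ->
    \sum_(n < M) F n = \sum_(n < N) F n.
  move=> F0 leNM; rewrite -!(big_mkord xpredT F) (big_cat_nat (leq0n N) leNM) /=.
  rewrite [X in _ + X]big1_seq ?addr0 // => n /andP[_].
  by rewrite mem_index_iota => /andP[/F0 ->].
have [s ->] := tensP z; elim: s => [|[a x] s [M [G [hG G0 eG]]]].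
  by exists 0%N, (fun=> 0); rewrite big_nil big_ord0; split=> // n; exact: smash_deg0.
have [N [F [hF eF]]] := deg_sum Lgr x.
pose F' n : O := if (n < N)%N then a ⊗ F n else 0.
have F'0 n : (N <= n)%N -> F' n = 0 by rewrite /F' ltnNge => ->.
exists (maxn N M), (fun n => F' n + G n); split=> [n|n|].
- rewrite -[F' n]scale1r; apply: smash_deg_linear => //; rewrite /F'.
  by case: ifP => _; [exact: smash_deg_pure | exact: smash_deg0].
- by rewrite geq_max => /andP[/F'0 -> /G0 ->]; rewrite addr0.
rewrite big_cons eG big_split /= (widen N (maxn N M) F') ?leq_maxl //.
rewrite (widen M (maxn N M) G) ?leq_maxr //; congr (_ + _).
rewrite eF (linear_map_sum (h := pure a)); last by lin.
by apply: eq_bigr => n _; rewrite /F' ltn_ord.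
Qed.

(* A map with eigenvalue 2^n in degree n separates the degrees. *)
Variable phi : L -> L.
Hypotheses (phil : linear phi) (phi_deg : forall n x, bs_deg L n x -> phi x = 2%:R ^+ n *: x).

Lemma smash_is_graded : is_graded sdeg par.
Proof.
split.
- exact: smash_deg0.
- exact: smash_deg_linear.
- exact: smash_deg_sum.
- have pl : linear (tmap id phi : O -> O) by lin.
  move=> N F; apply: (graded_direct K0 pl) => [n z|n k z hz]; last first.
    rewrite -[_ *: _]addr0.
    by apply: smash_deg_linear => //; exact: smash_deg0.
  case=> s [-> hs]; rewrite (linear_map_sum _ _ _ pl) scaler_sumr.
  apply: eq_big_seq => -[a x] /hs /phi_deg e.
  by pureE; rewrite e pureZr.
- exact: sparl.
- move=> n z [s [-> hs]]; rewrite (linear_map_sum _ _ _ sparl) scaler_sumr.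
  apply: eq_big_seq => -[a x] /hs /(par_deg Lgr) e.
  by rewrite smash_parE e pureZr.
Qed.

Lemma smash_degM m n (z z' : O) : sdeg m z -> sdeg n z' -> sdeg (m + n)%N (z ∙ z').
Proof.
move=> hz hz'; apply: pure_span_tlift_in hz _; first by lin.
move=> a x hx; apply: pure_span_tlift_in hz' _; first by lin.
move=> b y hy; apply: pure_span_tlift => b1 b2; apply: smash_deg_pure.
by apply: (bs_degM HL) => //; exact: (bs_act_deg HL).
Qed.

Lemma smash_deg_cop n (z : O) : sdeg n z -> tens_deg sdeg n (sh_cop O z).
Proof.
move=> hz; apply: pure_span_tlift_in hz _; first by lin.
move=> a x hx; apply: pure_span_tlift => a1 a2.
apply: pure_span_tlift_in (bs_cop_deg HL hx) _; first by lin.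
move=> x1 x2 [k [l [<- hx1 hx2]]].
have [s [-> hs]] := bs_coact_deg HL hx1.
rewrite (linear_map_sum (h := tlift _)); last by lin.
rewrite big_seq; elim/big_ind: _ => [|t1 t2|p /hs hp].
- exact: pure_span0.
- exact: pure_spanD.
pureE; apply: pure_span_pure; exists k, l.
by split=> //; exact: smash_deg_pure.
Qed.

Lemma smash_deg_coun n (z : O) : sdeg n.+1 z -> sh_coun O z = 0.
Proof.
case=> s [-> hs]; rewrite (linear_map_sum _ _ _ scounl) big_seq big1 // => -[a x] /hs hx.
by rewrite smash_counE (bs_coun_deg HL hx) mulr0.
Qed.

Hypothesis antipM : forall a b : H, antip (a * b) = antip b * antip a.
Variable S : L -> L.
Hypotheses (Sl : linear S) (S_deg : forall n x, bs_deg L n x -> bs_deg L n (S x)).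
Hypothesis S_l : forall x, \sw_(x1, x2 <- bs_cop L x) S x1 * x2 = (bs_coun L x)%:A.
Hypothesis S_r : forall x, \sw_(x1, x2 <- bs_cop L x) x1 * S x2 = (bs_coun L x)%:A.
Hypothesis S_coact : forall x, bs_coact L (S x) = tmap S id (bs_coact L x).

(** The antipode of a bosonisation: it reverses the factorisation (a ⊗ 1)(1 ⊗ x), and on 1 ⊗ x the
    braided antipode is corrected by the antipode of the coaction leg. *)
Definition smash_antip (z : O) : O := \sw_(a, x <- z) \sw_(x0, x1 <- bs_coact L x)
  (1 ⊗ S x0 : O) ∙ ((antip x1 * antip a) ⊗ 1 : O).

Lemma smash_antip_linear : linear smash_antip.
Proof. by rewrite /smash_antip; lin. Qed.
Let santl := smash_antip_linear.

Lemma smash_antipE a x : smash_antip (a ⊗ x) = \sw_(x0, x1 <- bs_coact L x)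
  (1 ⊗ S x0 : O) ∙ ((antip x1 * antip a) ⊗ 1 : O).
Proof. by rewrite /smash_antip; pureE. Qed.

Lemma smash_deg_antip n (z : O) : sdeg n z -> sdeg n (smash_antip z).
Proof.
move=> hz; apply: pure_span_tlift_in hz _; first by lin.
move=> a x hx; have [s [-> hs]] := bs_coact_deg HL hx.
rewrite (linear_map_sum (h := tlift _)); last by lin.
rewrite big_seq; elim/big_ind: _ => [|t1 t2|p /hs hp].
- exact: pure_span0.
- exact: pure_spanD.
pureE; rewrite -[n]addn0; apply: smash_degM; apply: smash_deg_pure.
  exact: S_deg.
exact: (bs_deg1 HL).
Qed.

(** Three antipode laws are used from the inside outwards: that of H on the legs of [a], that of H
    on the legs of the coaction of [x1], and finally [S_l]. *)
Lemma smash_antip_l z :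
  \sw_(z1, z2 <- sh_cop O z) smash_antip z1 ∙ z2 = sh_coun O z *: sh_one O.
Proof.
sweedler z as a x; rewrite smash_copE smash_counE.
pose f (x2 y0 : L) (t h1 h2 : H) : O := (1 ⊗ S y0 : O) ∙ ((antip h1 * t * h2) ⊗ x2 : O).
transitivity (\sw_(x1, x2 <- bs_cop L x) \sw_(x10, h <- bs_coact L x1)
   \sw_(y0, h' <- bs_coact L x10) \sw_(a1, a2 <- cop a) f x2 y0 (antip a1 * a2) h' h).
  rewrite /f; sweedler (cop a) as a1 a2; pureE; nested_pureE.
  sweedler (bs_cop L x) as x1 x2; pureE; sweedler (bs_coact L x1) as x10 x11; pureE.
  rewrite smash_antipE (linear_tlift (h := fun z : O => z ∙ ((a2 * x11) ⊗ x2 : O))); last by lin.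
  apply: eq_tlift => y0 y1; rewrite -smash_mulA smash_mull.
  by rewrite !mulrA.
transitivity (\sw_(x1, x2 <- bs_cop L x) coun a *: (1 ⊗ (S x1 * x2)) : O); last first.
  have -> : (coun a * bs_coun L x) *: sh_one O = coun a *: (1 ⊗ ((bs_coun L x)%:A) : O).
    by rewrite pureZr scalerA.
  rewrite -(S_l x).
  by sweedler (bs_cop L x) as x1 x2; pureE.
apply: eq_tlift => x1 x2.
transitivity (\sw_(x10, h <- bs_coact L x1) \sw_(h1, h2 <- cop h) coun a *: f x2 x10 1 h1 h2).
  rewrite (bs_coact_sw_coassoc (f := fun y0 h' h => \sw_(a1, a2 <- cop a) f x2 y0 (antip a1 * a2) h' h)).
    apply: eq_tlift => x10 h; apply: eq_tlift => h1 h2.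
    by rewrite (cop_sw_antipl Hh (f := fun t => f x2 x10 t h1 h2)) // /f; lin.
  by rewrite /f; lin.
rewrite -(coact_sw_coun Hh Lc (f := fun x => coun a *: (1 ⊗ (S x * x2) : O))); last by lin.
apply: eq_tlift => x10 h.
transitivity (\sw_(h1, h2 <- cop h) coun a *: ((1 ⊗ S x10 : O) ∙ ((antip h1 * h2) ⊗ x2 : O))).
  by apply: eq_tlift => h1 h2; rewrite /f mulr1.
rewrite (cop_sw_antipl Hh (f := fun t => coun a *: ((1 ⊗ S x10 : O) ∙ (t ⊗ x2 : O)))); last by lin.
by rewrite smash_mulr.
Qed.

Lemma antip_one : antip (1 : H) = 1.
Proof.
have := hopf_antipl Hh 1; rewrite (hopf_cop1 Hh); pureE.
by rewrite mulr1 hopf_coun1 // scale1r.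
Qed.

(** As [S] is colinear and the coaction multiplicative, the coactions of the two legs merge into the
    coaction of x_1 S(x_2), which is a scalar by [S_r]. Only the antipode law for [a] is then
    left. *)
Lemma smash_antip_r z :
  \sw_(z1, z2 <- sh_cop O z) z1 ∙ smash_antip z2 = sh_coun O z *: sh_one O.
Proof.
sweedler z as a x; rewrite smash_copE smash_counE.
pose f (a1 a2 : H) (c : L) (h : H) : O := (a1 ⊗ c : O) ∙ ((antip h * antip a2) ⊗ 1 : O).
transitivity (\sw_(a1, a2 <- cop a) \sw_(c, h <- bs_coact L ((bs_coun L x)%:A)) f a1 a2 c h).
  rewrite (linear_tlift (h := tlift _)); last by lin.
  apply: eq_tlift => a1 a2; rewrite -(S_r x) (linear_tlift _ _ coactl).
  rewrite [RHS](linear_tlift (h := tlift _)); last by rewrite /f; lin.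
  rewrite (linear_tlift (h := tlift _)); last by lin.
  apply: eq_tlift => x1 x2; rewrite (coact_sw_mul HA); last by rewrite /f; lin.
  rewrite S_coact /f; sweedler (bs_coact L x1) as x10 x11; pureE.
  rewrite smash_antipE (linear_tlift (h := sh_mul (a1 ⊗ x10 : O))); last by lin.
  sweedler (bs_coact L x2) as y0 y1; pureE.
  by rewrite smash_mulA smash_mulr !antipM mulrA.
rewrite (linear_mapZ _ _ coactl) (sca_coact1 HA).
transitivity (\sw_(a1, a2 <- cop a) bs_coun L x *: ((a1 * antip a2) ⊗ 1 : O)).
  apply: eq_tlift => a1 a2; rewrite (linear_mapZ (h := tlift _)); last by rewrite /f; lin.
  by rewrite /f; pureE; rewrite smash_mull antip_one mul1r.
rewrite (cop_sw_antipr Hh (f := fun t => bs_coun L x *: (t ⊗ 1 : O))); last by lin.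
by rewrite scalerA.
Qed.

Lemma smash_is_super_hopf : is_super_hopf O.
Proof.
split.
- exact: smash_is_graded.
- exact: smash_is_algebra.
- by apply: smash_deg_pure; exact: (bs_deg1 HL).
- exact: smash_degM.
- exact: scopl.
- exact: smash_deg_cop.
- rewrite smash_copE (hopf_cop1 Hh) (bs_cop1 HL); pureE.
  by rewrite (sca_coact1 HA); pureE; rewrite mulr1.
- exact: smash_copM.
- exact: smash_coassoc.
- exact: scounl.
- by rewrite smash_counE hopf_coun1 // (bs_coun1 HL) mulr1.
- exact: smash_counM.
- exact: smash_deg_coun.
- exact: smash_counl.
- exact: smash_counr.
- exists smash_antip; split; [exact: santl | exact: smash_deg_antip | |].
    exact: smash_antip_l.
  exact: smash_antip_r.
Qed.

End SmashProduct.

(** * Inner differential and contraction *)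

Section InnerDifferential.
Variables (K : fieldType) (O : shopf_data K).
Hypotheses (K2 : 2%:R != 0 :> K) (OA : super_alg O) (OH : is_super_hopf O).
Hypothesis cop_par : forall z : O, sh_cop O (sh_par O z) = tmap (sh_par O) (sh_par O) (sh_cop O z).
Variable theta : O.
Hypotheses (theta_deg : sh_deg O 1%N theta) (theta_sq : theta ∙ theta = 0).
Hypothesis theta_cop : sh_cop O theta = theta ⊗ sh_one O + sh_one O ⊗ theta.

Local Notation par := (sh_par O).
Local Notation d := (graded_comm theta).
Let mulb : bilinear_map (@sh_mul K O) := is_alg_bilinear (sa_alg OA).
Let parl : linear par := sa_par OA.
Let copl : linear (sh_cop O) := sh_cop_linear OH.
Let tmb := sh_tmul_bilinear OA.
Let mul1x : left_id (sh_one O) (@sh_mul K O) := is_alg1 (sa_alg OA).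
Let mulx1 : right_id (sh_one O) (@sh_mul K O) := is_algr1 (sa_alg OA).

Lemma par_theta : par theta = - theta.
Proof. by rewrite (par_deg (sh_is_graded OH) theta_deg) expr1 scaleN1r. Qed.

Lemma par_one : par (sh_one O) = sh_one O.
Proof. by rewrite (par_deg (sh_is_graded OH) (sh_deg1 OH)) expr0 scale1r. Qed.

Lemma graded_comm_linear : linear d.
Proof. by rewrite /graded_comm; lin. Qed.
Let dl := graded_comm_linear.

Lemma graded_comm_der : super_derivation d.
Proof.
move=> x y; rewrite /graded_comm (sa_parM OA) (sh_mulDl OA) (sh_mulDr OA).
by rewrite (sh_mulNl OA) (sh_mulNr OA) !(sh_mulA OA) addrA subrK.
Qed.

Lemma graded_comm_par z : par (d z) = - d (par z).
Proof.
rewrite /graded_comm (linear_mapD _ _ parl) (linear_mapN _ parl) !(sa_parM OA) par_theta.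
by rewrite (sh_mulNl OA) (sh_mulNr OA) opprK opprB addrC.
Qed.

Lemma graded_comm_sq z : d (d z) = 0.
Proof.
rewrite {1}/graded_comm graded_comm_par /graded_comm (sa_parK OA) (sh_mulDr OA).
rewrite (sh_mulNl OA) (sh_mulDl OA) (sh_mulNr OA) (sh_mulNl OA) !(sh_mulA OA) theta_sq.
rewrite -[z ∙ theta ∙ theta](sh_mulA OA) theta_sq (linear_map0 (bilin_l _ mulb)).
by rewrite (linear_map0 (bilin_r _ mulb)) sub0r oppr0 addr0 opprK addNr.
Qed.

Lemma graded_comm_deg n z : sh_deg O n z -> sh_deg O n.+1 (d z).
Proof.
have gr := sh_is_graded OH.
move=> hz; rewrite /graded_comm (par_deg gr hz) -scaleN1r addrC.
apply: (deg_linear gr); last exact: (sh_degM OH theta_deg hz).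
rewrite -addn1; apply: (sh_degM OH) => //.
by rewrite -[_ *: z]addr0; apply: (deg_linear gr) => //; exact: (deg0 gr).
Qed.

(** With [theta] primitive, multiplying by its coproduct inserts [theta] in one factor or the other;
    the two products in the commutator pair up into a graded commutator in each factor. *)
Lemma graded_comm_coder : super_coderivation d.
Proof.
move=> z; rewrite {1}/graded_comm (linear_mapD _ _ copl) (linear_mapN _ copl).
rewrite !(sh_copM OH) theta_cop cop_par; sweedler (sh_cop O z) as a b; pureE.
move: b; apply: (homog_ind K2 parl (sa_parK OA)); [lin | lin | move=> e b hb].
have h1 : homog par false (sh_one O) by exact: par_one.
have ht : homog par true theta by exact: par_theta.
rewrite (linear_mapD _ _ (bilin_l (a ⊗ b) tmb)) (linear_mapD _ _ (bilin_r _ tmb)).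
rewrite (sh_tmulE K2 OA _ _ _ h1) (sh_tmulE K2 OA _ _ _ ht).
rewrite !(sh_tmulE K2 OA _ _ _ (homogN (sa_parK OA) hb)) /sgn !mul1x mulx1.
have -> : (par a ∙ (if e then par theta else theta)) ⊗ par b =
    (par a ∙ theta) ⊗ b.
  rewrite hb par_theta; case: (e) => //.
  by rewrite (sh_mulNr OA) pureNl pureNr opprK.
have -> : (if e then par (sh_one O) else sh_one O) = sh_one O.
  by case: (e) => //; exact: par_one.
rewrite mulx1 /graded_comm pureDl pureDr pureNl pureNr opprD.
by rewrite addrACA.
Qed.

End InnerDifferential.

Lemma lin_fst (K : fieldType) (V W : lmodType K) : linear (fst : V * W -> V).
Proof. by []. Qed.
Lemma lin_snd (K : fieldType) (V W : lmodType K) : linear (snd : V * W -> W).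
Proof. by []. Qed.
Lemma lin_pair (K : fieldType) (U V W : lmodType K) (f : U -> V) (h : U -> W) :
  linear f -> linear h -> linear (fun x => (f x, h x)).
Proof. by move=> fl hl a x y; rewrite fl hl. Qed.

(** * Odd derivations and coderivations *)

Section OddDerivation.
Variables (K : fieldType) (O : shopf_data K).
Hypotheses (K2 : 2%:R != 0 :> K) (OA : super_alg O) (OH : is_super_hopf O).
Hypothesis cop_par : forall z : O, sh_cop O (sh_par O z) = tmap (sh_par O) (sh_par O) (sh_cop O z).
Variable i : O -> O.
Hypotheses (il : linear i) (i_der : super_derivation i).
Hypothesis i_par : forall z, sh_par O (i z) = - i (sh_par O z).

Local Notation par := (sh_par O).
Local Notation tm := (@sh_tmul K O).
Let parl : linear par := sa_par OA.
Let copl : linear (sh_cop O) := sh_cop_linear OH.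
Let tmb := sh_tmul_bilinear OA.

Definition tens_der (t : O ⊗ O) : O ⊗ O := tmap i id t + tmap par i t.

Lemma tens_der_linear : linear tens_der.
Proof. by rewrite /tens_der; lin. Qed.
Let tdl := tens_der_linear.

Lemma tens_derM s t : tens_der (tm s t) = tm (tens_der s) t + tm (tmap par par s) (tens_der t).
Proof.
have parm : linear (tmap par par) by lin.
sweedler s as a b; sweedler t as c d.
move: b; apply: (homog_ind K2 parl (sa_parK OA)); [lin | lin | move=> e b hb].
have hib : homog par (~~ e) (i b).
  by rewrite /homog i_par hb; case: (e); rewrite ?(linear_mapN _ il) ?opprK.
rewrite (sh_tmulE K2 OA _ _ _ hb) /tens_der; pureE.
rewrite (linear_mapD _ _ (bilin_l (c ⊗ d) tmb)) (linear_mapD _ _ (bilin_r _ tmb)).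
rewrite (sh_tmulE K2 OA _ _ _ hb) (sh_tmulE K2 OA _ _ _ hib).
rewrite !(sh_tmulE K2 OA _ _ _ (homogN (sa_parK OA) hb)) !i_der (sa_parM OA).
have -> : sgn par (~~ e) c = par (sgn par e c) by case: (e) => //=; rewrite (sa_parK OA).
have -> : sgn par e (par c) = par (sgn par e c) by case: (e).
have -> : (par a ∙ sgn par e (i c)) ⊗ (par b ∙ d) = (par a ∙ i (sgn par e c)) ⊗ (b ∙ d).
  rewrite hb; case: (e) => //=.
  by rewrite i_par (sh_mulNl OA) (sh_mulNr OA) pureNl pureNr opprK.
by rewrite pureDl pureDr addrACA.
Qed.

(** [tens_der] is an odd derivation of the graded tensor square, so both sides are derivations along
    the coproduct. The coderivation property thus only has to be tested on algebra generators. *)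
Lemma coder_mul x y : sh_cop O (i x) = tens_der (sh_cop O x) ->
  sh_cop O (i y) = tens_der (sh_cop O y) ->
  sh_cop O (i (x ∙ y)) = tens_der (sh_cop O (x ∙ y)).
Proof.
move=> ex ey; rewrite i_der (linear_mapD _ _ copl) !(sh_copM OH) ex ey cop_par.
by rewrite tens_derM.
Qed.

Lemma cartan_formula theta z : par theta = - theta ->
  graded_comm theta (i z) + i (graded_comm theta z) = i theta ∙ z - z ∙ i theta.
Proof.
move=> ht; rewrite /graded_comm (linear_mapD _ _ il) (linear_mapN _ il) !i_der ht.
rewrite (sa_parK OA) i_par !(sh_mulNl OA) opprK opprD.
by rewrite addrACA [X in X + _]addrCA subrr addr0 [X in _ + X]addrA subrr add0r.
Qed.

End OddDerivation.

(** * Differential and contraction on the smash product *)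

Section QuadraticCalculus.
Variables (K : fieldType) (H : hopf_data K) (X : cmod_data H).
Hypotheses (K0 : forall n, n.+1%:R != 0 :> K) (Hh : is_hopf H) (Hc : is_cmod X).
Hypothesis flat : braid_regular X.
Hypothesis antipM : forall a b : H, antip (a * b) = antip b * antip a.

Local Notation B := (Bquad_alg X).
Local Notation bg := (@bgen K H X).
Local Notation Bpar := (@Bquad_par K H X).
Local Notation Act := (@Bquad_act K H X).
Local Notation Coact := (@Bquad_coact K H X).
Local Notation Cop := (@Bquad_cop K H X).
Local Notation Coun := (@Bquad_coun K H X).
Local Notation O := (smash (Bquad X)).
Let u (a : H) : O := a ⊗ 1.
Let b (x : B) : O := 1 ⊗ x.

Let K2 : 2%:R != 0 :> K := K0 1.
Let Bparl : linear Bpar := @Bpar_linear K H X.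
Let actb : bilinear_map Act := Bact_bilinear Hh Hc.
Let coactl : linear Coact := Bcoact_linear Hh Hc flat.
Let bcounl : linear (Coun : B -> K^o) := @Bcoun_linear K H X.
Let HL : is_braided_super_hopf (Bquad X) := Bis_braided_super_hopf K0 Hh Hc flat.
Let HB : super_cmod_alg (bs_act (Bquad X)) (bs_coact (Bquad X)) (bs_par (Bquad X)) :=
  Bsuper_cmod_alg Hh Hc flat.

Lemma Bcoun_act x a : Coun (Act x a) = Coun x * coun a.
Proof.
move: x a; apply: qalg_ind => [k x y ex ey a|a|a|v y ey a].
- rewrite (linear_mapD _ _ (bilin_l a actb)) (linear_mapZ _ _ (bilin_l a actb)).
  rewrite !(linear_mapD _ _ bcounl) !(linear_mapZ _ _ bcounl) ex ey mulrDl.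
  by congr (_ + _); exact: mulrA.
- by rewrite (linear_map0 (bilin_l a actb)) (linear_map0 bcounl) mul0r.
- by rewrite (Bact1 Hh Hc) (linear_mapZ _ _ bcounl) Bcoun1 mul1r [_ *: _]mulr1.
rewrite (BactM Hh Hc) (linear_tlift _ _ bcounl) Bcoun_genM mul0r.
apply: (tlift_eq0 (Z := K^o)) => a1 a2; rewrite BcounM (Bact_gen Hh Hc) Bcoun_gen.
by rewrite mul0r.
Qed.

Lemma Bsmash_is_super_hopf : is_super_hopf O.
Proof.
apply: (smash_is_super_hopf K0 Hh HL HB Bcoun_act _ (phi := Bscale 2%:R) _ _ antipM (S := Bantip (X := X))).
- move=> Z f x fl; exact: Bcoact_coun_l Hh Hc flat _ _ _ fl.
- exact: Bscale_linear.
- by move=> n x; exact: Bscale_deg.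
- exact: Bantip_linear Hh Hc flat.
- by move=> n x; exact: Bdeg_antip Hh Hc flat _ _.
- exact: Bantip_l K0 Hh Hc flat.
- exact: Bantip_r K0 Hh Hc flat.
exact: Bcoact_antip Hh Hc flat.
Qed.

Let OH := Bsmash_is_super_hopf.
Let OA : super_alg O := smash_super_alg Hh HL HB.
Let mulb : bilinear_map (@sh_mul K O) := is_alg_bilinear (sa_alg OA).
Let parl : linear (sh_par O) := sa_par OA.
Let scopl : linear (sh_cop O) := sh_cop_linear OH.
Local Notation par := (sh_par O).

Let ul : linear u. Proof. by rewrite /u; lin. Qed.
Let bl : linear b. Proof. by rewrite /b; lin. Qed.

Let smash_split (a : H) (x : B) : a ⊗ x = u a ∙ b x.
Proof. exact: (smash_pureE Hh HL HB). Qed.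

Let uM (a c : H) : u (a * c) = u a ∙ u c.
Proof. exact/esym/(smash_mull Hh HL HB). Qed.

Let bM (x y : B) : b (x * y) = b x ∙ b y.
Proof. exact/esym/(smash_mulr Hh HL). Qed.

Let bu (x : B) (a : H) : b x ∙ u a = \sw_(a1, a2 <- cop a) u a1 ∙ b (Act x a2).
Proof.
rewrite (smash_mulE Hh HL); apply: eq_tlift => a1 a2.
by rewrite -smash_split mul1r mulr1.
Qed.

Let par_u (a : H) : par (u a) = u a.
Proof. by rewrite (smash_parE HB) (sca_par1 HB). Qed.

Let par_b (x : B) : par (b x) = b (Bpar x).
Proof. exact: (smash_parE HB). Qed.

Let cop_u (a : H) : sh_cop O (u a) = tmap u u (cop a).
Proof.
rewrite smash_copE //; sweedler (cop a) as a1 a2; pureE.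
rewrite (bs_cop1 HL); pureE; rewrite (sca_coact1 HB); pureE.
by rewrite mulr1.
Qed.

Lemma Bsmash_cop_par (z : O) : sh_cop O (par z) = tmap par par (sh_cop O z).
Proof.
sweedler z as a x; rewrite (smash_parE HB) !(smash_copE Hh HL).
sweedler (cop a) as a1 a2; pureE.
rewrite [bs_cop _ (bs_par _ x)](Bcop_par K2 Hh Hc flat).
change (bs_cop (Bquad X)) with Cop; sweedler (Cop x) as x1 x2; pureE.
change (bs_coact (Bquad X)) with Coact; rewrite (Bcoact_par Hh Hc flat).
sweedler (Coact x1) as x10 x11; pureE.
by rewrite !(smash_parE HB).
Qed.

Lemma Bsmash_degree0 : is_degree0 (fun a : H => a ⊗ 1 : O).
Proof.
split=> [||z||||a].
- exact: ul.
(* [F] applies the counit of B to the second factor, and is a left inverse of the inclusion of H. *)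
- pose F (z : O) : H := \sw_(a, x <- z) Coun x *: a.
  have FE a : F (u a) = a by rewrite /F /u; pureE; rewrite Bcoun1 scale1r.
  by move=> a c e; rewrite -[a]FE -[c]FE /u e.
- split=> [[s [-> hs]]|[a ->]]; last first.
    by apply: (smash_deg_pure (L := Bquad X)); exact: Bdeg_one.
  elim: s hs => [|[a x] s IH] hs.
    by exists 0; rewrite big_nil pure0l.
  have [c ec] : exists c, x = c%:A by apply: Bdeg0P; exact: (hs (a, x) (mem_head _ _)).
  have [a' ea] : exists a, \sum_(p <- s) p.1 ⊗ p.2 = a ⊗ 1 :> O.
    by apply: IH => p hp; apply: hs; rewrite inE hp orbT.
  by exists (c *: a + a'); rewrite big_cons ea ec /= pureDl pureZl pureZr.
- by [].
- exact: uM.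
- exact: cop_u.
by rewrite (smash_counE Hh HL) [bs_coun _ _]Bcoun1 mulr1.
Qed.

Variable incl : X -> H.
Hypothesis incl_map : is_cmod_map_to_aug incl.
Hypothesis incl_rel : forall w : X ⊗ X, braid w = w -> \sw_(x, y <- w) act X x (incl y) = 0.
Let incll : linear incl := aug_linear incl_map.

(** In H the element i(v) passes [a] by the same rule as [v] does in the smash product. This is what
    allows the left linear extension of the contraction to be a derivation on all of [O]. The proof
    inserts a_1 S(a_2). *)
Lemma incl_mul v a : incl v * a = \sw_(a1, a2 <- cop a) a1 * incl (act X v a2).
Proof.
transitivity (\sw_(a1, a2 <- cop a) \sw_(c1, c2 <- cop a2) a1 * (antip c1 * incl v * c2)).
  rewrite -(cop_sw_coassoc Hh (f := fun p q r => p * (antip q * incl v * r))); last by lin.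
  transitivity (\sw_(a1, a2 <- cop a) coun a1 *: (1 * incl v * a2)).
    by rewrite (cop_sw_counl Hh (f := fun h => 1 * incl v * h)) ?mul1r //; lin.
  apply: eq_tlift => a1 a2.
  rewrite -(cop_sw_antipr Hh (f := fun h => h * incl v * a2)); last by lin.
  by apply: eq_tlift => c1 c2; rewrite !mulrA.
apply: eq_tlift => a1 a2; rewrite (aug_act incl_map).
by rewrite (linear_tlift (h := *%R a1)) //; lin.
Qed.

Section Contraction.

(* Algebra maps x |-> (F x, D x) into this algebra are pairs of an algebra map F
   and a super-derivation D along F. *)
Local Notation pmul := (fun p q : O * O => (p.1 ∙ q.1, p.2 ∙ q.1 + par p.1 ∙ q.2)).
Local Notation pone := ((sh_one O, 0) : O * O).
Local Notation pgen := (fun v => (b (bg v), u (incl v)) : O * O).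

Let pa : is_algebra pmul pone.
Proof.
split.
- apply: bilinearP => q; apply: lin_pair.
  + by apply: bilin_compl mulb _; exact: lin_fst.
  + apply: linD; first by apply: bilin_compl mulb _; exact: lin_snd.
    by apply: bilin_compl mulb _; apply: lin_comp parl _; exact: lin_fst.
  + by apply: bilin_compr mulb _; exact: lin_fst.
  apply: linD; first by apply: bilin_compr mulb _; exact: lin_fst.
  by apply: bilin_compr mulb _; exact: lin_snd.
- move=> p q r; cbn [fst snd]; congr pair; first exact: sh_mulA OA _ _ _.
  rewrite (sh_mulDl OA) (sh_mulDr OA) (sa_parM OA) !(sh_mulA OA).
  by rewrite addrA.
- move=> p; cbn [fst snd]; rewrite (is_alg1 (sa_alg OA)) (linear_map0 (bilin_l _ mulb)).
  by rewrite (par_u 1) (is_alg1 (sa_alg OA)) add0r; case: p.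
- move=> p; cbn [fst snd]; rewrite (is_algr1 (sa_alg OA)) (linear_map0 (bilin_r _ mulb)).
  by rewrite (is_algr1 (sa_alg OA)) addr0; case: p.
Qed.

Let pgl : linear pgen.
Proof. by apply: lin_pair; lin. Qed.

Let gen_incl (v w : X) : b (bg v) ∙ u (incl w) =
  tmap incl bg (braid (v ⊗ w)) + b (bg (act X v (incl w))).
Proof.
rewrite bu (braidE _ _ Hc).
have -> : cop (incl w) = tmap incl id (coact X w) + 1 ⊗ incl w.
  by rewrite (aug_coact incl_map) subrK.
rewrite tliftD; last by lin.
pureE; rewrite -smash_split (Bact_gen Hh Hc) /b; congr (_ + _).
sweedler (coact X w) as w0 w1; pureE.
by rewrite -smash_split (Bact_gen Hh Hc).
Qed.

Let prel z : relator (Relators (@quad_relator_aug K H X)) z -> talg_lift pmul pone pgen z = 0.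
Proof.
apply: quad_relator_lift pa pgl _ _ => w hw.
have split_pair (f g : X -> X -> O) : \sw_(x, y <- w) (f x y, g x y) =
    (\sw_(x, y <- w) f x y, \sw_(x, y <- w) g x y) :> O * O.
  by rewrite [LHS]surjective_pairing; congr pair; [exact: (linear_tlift _ _ (@lin_fst K O O)) | exact: (linear_tlift _ _ (@lin_snd K O O))].
rewrite split_pair; cbn [fst snd]; congr pair.
  transitivity (b (\sw_(x, y <- w) bg x * bg y)); last by rewrite bgen_rel // (linear_map0 bl).
  by rewrite (linear_tlift _ _ bl); apply: eq_tlift => x y; rewrite bM.
(* The derivation sends x y to i(x) y - x i(y). By [gen_incl] the second product is the expression
   i(.) ⊗ (.) evaluated on Psi(x ⊗ y), plus the correction x <| i(y) removed by [incl_rel]. *)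
transitivity (tmap incl bg w - (tmap incl bg (braid w) + b (bg (\sw_(x, y <- w) act X x (incl y))))).
  sweedler w as x y; pureE; rewrite par_b Bpar_gen (linear_mapN _ bl) (sh_mulNl OA).
  by rewrite gen_incl -smash_split.
by rewrite hw (incl_rel hw) (linear_map0 (h := bg)) ?(linear_map0 bl) ?addr0 ?subrr //; lin.
Qed.

Local Notation plift := (qalg_lift pmul pone pgen).
Definition Bcontr (x : B) : O := (plift x).2.

Let plift1 x : (plift x).1 = b x.
Proof.
move: x; apply: qalg_eq_ind => [||| v y ey].
- by apply: lin_comp (@lin_fst K O O) _; exact: qalg_lift_linear pa pgl prel.
- exact: bl.
- by rewrite (qalg_lift1 pa pgl prel).
by rewrite (qalg_liftM pa pgl prel); cbn [fst snd]; rewrite ey (qalg_lift_gen pa pgl prel) bM.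
Qed.

Lemma Bcontr_linear : linear Bcontr.
Proof. by apply: lin_comp (@lin_snd K O O) _; exact: qalg_lift_linear pa pgl prel. Qed.

Lemma Bcontr1 : Bcontr 1 = 0.
Proof. by rewrite /Bcontr (qalg_lift1 pa pgl prel). Qed.

Lemma BcontrM (x y : B) : Bcontr (x * y) = Bcontr x ∙ b y + b (Bpar x) ∙ Bcontr y.
Proof. by rewrite /Bcontr (qalg_liftM pa pgl prel) -par_b -!plift1. Qed.

Lemma Bcontr_gen v : Bcontr (bg v) = u (incl v).
Proof. by rewrite /Bcontr (qalg_lift_gen pa pgl prel). Qed.

End Contraction.

Let contrl := Bcontr_linear.

Lemma Bcontr_genM v y : Bcontr (bg v * y) = u (incl v) ∙ b y - b (bg v) ∙ Bcontr y.
Proof. by rewrite BcontrM Bcontr_gen Bpar_gen (linear_mapN _ bl) (sh_mulNl OA). Qed.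

(** The commutation rule of the smash product persists after contraction. On a generator this is
    [incl_mul]; the derivation rule then carries it along words. *)
Lemma Bcontr_mul (x : B) (a : H) :
  Bcontr x ∙ u a = \sw_(a1, a2 <- cop a) u a1 ∙ Bcontr (Act x a2).
Proof.
move: x a; apply: qalg_ind => [k x y ex ey a|a|a|v y ey a].
- have rl : linear (fun x : B => \sw_(a1, a2 <- cop a) u a1 ∙ Bcontr (Act x a2)) by lin.
  rewrite contrl (bilin_l (u a) mulb k) ex ey; exact/esym/(rl k x y).
- rewrite (linear_map0 contrl) (linear_map0 (bilin_l (u a) mulb)); apply/esym/tlift_eq0 => a1 a2.
  by rewrite (linear_map0 (bilin_l _ actb)) (linear_map0 contrl) (linear_map0 (bilin_r _ mulb)).
- rewrite Bcontr1 (linear_map0 (bilin_l (u a) mulb)); apply/esym/tlift_eq0 => a1 a2.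
  rewrite (Bact1 Hh Hc) (linear_mapZ _ _ contrl) Bcontr1 scaler0.
  by rewrite (linear_map0 (bilin_r _ mulb)).
pose f p q r : O := u p ∙ (u (incl (act X v q)) ∙ b (Act y r) - b (bg (act X v q)) ∙ Bcontr (Act y r)).
transitivity (\sw_(a1, a2 <- cop a) \sw_(p, q <- cop a1) f p q a2).
  rewrite Bcontr_genM (sh_mulDl OA) (sh_mulNl OA).
  rewrite -!(sh_mulA OA) bu ey.
  rewrite (linear_tlift _ _ (bilin_r (u (incl v)) mulb)) (linear_tlift _ _ (bilin_r (b (bg v)) mulb)).
  rewrite -scaleN1r (linear_tlift (h := GRing.scale (-1))); last by lin.
  rewrite -tlift_split; apply: eq_tlift => a1 a2.
  rewrite scaleN1r !(sh_mulA OA) -uM incl_mul bu /f (linear_tlift _ _ ul).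
  rewrite (linear_tlift _ _ (bilin_l _ mulb)) (linear_tlift _ _ (bilin_l _ mulb)).
  rewrite -scaleN1r (linear_tlift (h := GRing.scale (-1))); last by lin.
  rewrite -tlift_split; apply: eq_tlift => p q.
  by rewrite scaleN1r uM (sh_mulDr OA) (sh_mulNr OA) !(sh_mulA OA) (Bact_gen Hh Hc).
rewrite (cop_sw_coassoc Hh (f := f)); last by rewrite /f; lin.
apply: eq_tlift => a1 a2; rewrite /f (BactM Hh Hc) (linear_tlift _ _ contrl).
rewrite (linear_tlift _ _ (bilin_r _ mulb)); apply: eq_tlift => p q.
by rewrite (Bact_gen Hh Hc) Bcontr_genM.
Qed.

Lemma Bcontr_par (x : B) : par (Bcontr x) = - Bcontr (Bpar x).
Proof.
move: x; apply: qalg_eq_ind; [lin | lin | |] => [|v y ey].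
  by rewrite Bpar1 Bcontr1 (linear_map0 parl) oppr0.
rewrite BparM Bpar_gen mulNr (linear_mapN _ contrl) opprK !Bcontr_genM.
rewrite (linear_mapD _ _ parl) (linear_mapN _ parl) !(sa_parM OA) par_u !par_b ey.
by rewrite Bpar_gen (linear_mapN _ bl) (sh_mulNl OA) (sh_mulNr OA) !opprK.
Qed.

Definition contr (z : O) : O := \sw_(a, x <- z) u a ∙ Bcontr x.

Lemma contr_linear : linear contr.
Proof. by rewrite /contr; lin. Qed.
Let cl := contr_linear.

Let contrE (a : H) (x : B) : contr (a ⊗ x) = u a ∙ Bcontr x.
Proof. by rewrite /contr; pureE. Qed.

Lemma contr_b (x : B) : contr (b x) = Bcontr x.
Proof. by rewrite contrE; exact: is_alg1 (sa_alg OA) _. Qed.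

Lemma contr_u (a : H) : contr (u a) = 0.
Proof. by rewrite contrE Bcontr1 (linear_map0 (bilin_r _ mulb)). Qed.

Lemma contr_mull (a : H) (z : O) : contr (u a ∙ z) = u a ∙ contr z.
Proof.
sweedler z as c x; rewrite (smash_mull Hh HL HB) !contrE.
by rewrite uM (sh_mulA OA).
Qed.

Lemma contr_par (z : O) : par (contr z) = - contr (par z).
Proof.
sweedler z as a x; rewrite (smash_parE HB) !contrE (sa_parM OA) par_u Bcontr_par.
by rewrite (sh_mulNr OA).
Qed.

Lemma contr_der : super_derivation contr.
Proof.
have xz (x : B) (z : O) : contr (b x ∙ z) = contr (b x) ∙ z + par (b x) ∙ contr z.
  sweedler z as a y; rewrite smash_split contr_mull !contr_b !(sh_mulA OA) Bcontr_mul !bu par_b bu.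
  rewrite !(linear_tlift _ _ (bilin_l _ mulb)) (linear_tlift _ _ cl) -tlift_split.
  apply: eq_tlift => a1 a2; rewrite -!(sh_mulA OA) contr_mull -bM contr_b BcontrM.
  by rewrite (sh_mulDr OA) [Act (Bpar _) _](Bact_par Hh Hc).
move=> z z'; move: z; apply: tens_eq_ind; [lin | lin |] => a x.
rewrite smash_split -(sh_mulA OA) !contr_mull xz (sa_parM OA) par_u.
by rewrite (sh_mulDr OA) !(sh_mulA OA).
Qed.

(** The contraction of a generator lies in H, where the contraction vanishes, and the two remaining
    cross terms for [bg v * y] cancel by sign. *)
Lemma contr_sq (z : O) : contr (contr z) = 0.
Proof.
have contrK (x : B) : contr (Bcontr x) = 0.
  move: x; apply: qalg_eq_ind; [lin | exact: lin0 | |] => [|v y ey].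
    by rewrite Bcontr1 (linear_map0 cl).
  rewrite Bcontr_genM (linear_mapD _ _ cl) (linear_mapN _ cl) contr_mull contr_der !contr_b.
  by rewrite ey Bcontr_gen (linear_map0 (bilin_r _ mulb)) addr0 subrr.
move: z; apply: tens_eq_ind; [lin | exact: lin0 |] => a x.
by rewrite contrE contr_mull contrK (linear_map0 (bilin_r _ mulb)).
Qed.

(** Degree 0 is singled out because its contraction must vanish, while the predecessor of 0 is 0 and
    would give a weaker claim. *)
Let Bcontr_deg n (x : B) : Bquad_deg n x ->
  if n is m.+1 then sh_deg O m (Bcontr x) else Bcontr x = 0.
Proof.
move: n x; apply: Bdeg_ind => [n|n k x y|| n v y hy IH].
- by rewrite (linear_map0 contrl); case: n => // n; exact: smash_deg0.
- rewrite contrl; case: n => [-> ->|n]; first by rewrite scaler0 addr0.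
  exact: smash_deg_linear.
- exact: Bcontr1.
have hb m (x : B) : Bquad_deg m x -> sh_deg O m (b x).
  by move=> hx; exact: (smash_deg_pure (L := Bquad X)).
have hu (a : H) : sh_deg O 0%N (u a).
  by apply: (smash_deg_pure (L := Bquad X)); exact: Bdeg_one.
rewrite Bcontr_genM addrC -scaleN1r; apply: smash_deg_linear; last first.
  by rewrite -[n]add0n; apply: (sh_degM OH) => //; exact: hb.
case: n hy IH => [_ ->|n hy IH].
  by rewrite (linear_map0 (bilin_r _ mulb)); exact: smash_deg0.
by rewrite -add1n; apply: (sh_degM OH) => //; apply: hb; exact: Bdeg_gen.
Qed.

Lemma contr_deg0 (z : O) : sh_deg O 0%N z -> contr z = 0.
Proof. by move=> /(zero_deg Bsmash_degree0) [a ->]; exact: contr_u. Qed.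

Lemma contr_deg n (z : O) : sh_deg O n.+1 z -> sh_deg O n (contr z).
Proof.
case=> s [-> hs]; rewrite (linear_map_sum _ _ _ cl) big_seq.
elim/big_ind: _ => [|x y hx hy|[a x] /hs hx].
- exact: smash_deg0.
- by rewrite -[x]scale1r; exact: smash_deg_linear.
rewrite contrE -[n]add0n; apply: (sh_degM OH); last exact: (Bcontr_deg hx).
by apply: (smash_deg_pure (L := Bquad X)); exact: Bdeg_one.
Qed.

Let cop_gen v : sh_cop O (b (bg v)) =
  tmap (fun x => b (bg x)) u (coact X v) + sh_one O ⊗ b (bg v).
Proof.
rewrite (smash_copE Hh HL) (hopf_cop1 Hh); pureE.
rewrite [bs_cop (Bquad X) _](Bcop_gen K2 Hh Hc flat) tliftD; last by lin.
pureE; rewrite [bs_coact (Bquad X) (bg v)](Bcoact_gen Hh Hc flat).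
rewrite [bs_coact (Bquad X) 1](Bcoact1 Hh Hc flat); pureE; rewrite mul1r; congr (_ + _).
by sweedler (coact X v) as v0 v1; pureE; rewrite mul1r.
Qed.

(** For a generator [v] both sides are the coproduct of i(v), because i is a comodule map for the
    coaction cop - 1 ⊗ id. Elements of H are killed on both sides, and [coder_mul] does the rest. *)
Lemma contr_coder : super_coderivation contr.
Proof.
pose D := tens_der contr; have Dl : linear D := tens_der_linear OA cl.
have DM := coder_mul K2 OA OH Bsmash_cop_par cl contr_der contr_par.
have cu (a : H) : sh_cop O (contr (u a)) = D (sh_cop O (u a)).
  rewrite contr_u (linear_map0 scopl) cop_u /D /tens_der; apply/esym.
  sweedler (cop a) as a1 a2; pureE.
  by rewrite !contr_u pure0l pure0r addr0.
have cb v : sh_cop O (contr (b (bg v))) = D (sh_cop O (b (bg v))).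
  rewrite cop_gen (linear_mapD _ _ Dl) contr_b Bcontr_gen cop_u.
  have -> : cop (incl v) = tmap incl id (coact X v) + 1 ⊗ incl v.
    by rewrite (aug_coact incl_map) subrK.
  rewrite (linear_mapD _ _ (lin_tmap ul ul)); congr (_ + _); rewrite /D /tens_der; last first.
    by pureE; rewrite contr_b Bcontr_gen (contr_u 1) pure0l add0r (par_u 1).
  sweedler (coact X v) as v0 v1; pureE.
  by rewrite contr_b Bcontr_gen contr_u pure0r addr0.
suff e z : sh_cop O (contr z) = D (sh_cop O z) by exact: e.
move: z; apply: tens_eq_ind; [lin | lin |] => a x.
rewrite smash_split; apply: (DM _ _ (cu a)).
move: x; apply: qalg_eq_ind; [lin | lin | exact: cu | move=> v y ey].
rewrite bM; exact: (DM _ _ (cb v) ey).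
Qed.

Lemma contr_gen (x : X) : contr (1 ⊗ bg x : O) = incl x ⊗ 1.
Proof. by rewrite [LHS]contr_b Bcontr_gen. Qed.

Variable theta : X.
Hypothesis theta_coinv : coact X theta = theta ⊗ 1.
Local Notation d := (graded_comm (1 ⊗ bg theta : O)).

Let theta_deg : sh_deg O 1%N (b (bg theta)).
Proof. by apply: (smash_deg_pure (L := Bquad X)); exact: Bdeg_gen. Qed.

(** A coinvariant vector braids with itself by the flip, so theta ⊗ theta is fixed by Psi and its
    product is a relator. Coinvariance also makes theta primitive in the smash product. *)
Let theta_sq : b (bg theta) ∙ b (bg theta) = 0.
Proof.
have fixed : braid (theta ⊗ theta) = theta ⊗ theta.
  by rewrite (braidE _ _ Hc) theta_coinv; pureE; rewrite (cmod_act1 Hc).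
by rewrite -bM; have := bgen_rel fixed; pureE => ->; exact: linear_map0 bl.
Qed.

Let theta_cop : sh_cop O (b (bg theta)) = b (bg theta) ⊗ sh_one O + sh_one O ⊗ b (bg theta).
Proof. by rewrite cop_gen theta_coinv; pureE. Qed.

Lemma Bsmash_calculus : is_aug_inner_calculus (fun a : H => a ⊗ 1 : O) d contr.
Proof.
split.
- exact: OH.
- exact: Bsmash_degree0.
- by exists (b (bg theta)).
- exact: graded_comm_linear OA _.
- by move=> n x; exact: graded_comm_deg.
- exact: graded_comm_sq theta_deg theta_sq.
- exact: graded_comm_der.
- exact (graded_comm_coder K2 OA OH Bsmash_cop_par theta_deg theta_cop).
- exact: contr_linear.
- exact: contr_deg0.
- exact: contr_deg.
- exact: contr_sq.
- exact: contr_der.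
exact: contr_coder.
Qed.

Lemma contr_cartan (z : O) : d (contr z) + contr (d z) =
  (incl theta ⊗ 1 : O) ∙ z - z ∙ (incl theta ⊗ 1 : O).
Proof.
rewrite (cartan_formula OA contr_linear contr_der contr_par); first by rewrite contr_gen.
by rewrite [LHS]par_b Bpar_gen (linear_mapN _ bl).
Qed.

Lemma Bsmash_comm_prim (x : B) (a : H) : cop a = a ⊗ 1 + 1 ⊗ a ->
  (1 ⊗ x : O) ∙ (a ⊗ 1 : O) - (a ⊗ 1 : O) ∙ (1 ⊗ x : O) = 1 ⊗ Act x a.
Proof.
move=> ea; rewrite [X in X - _]bu ea tliftD; last by lin.
by pureE; rewrite (Bact_one Hh Hc) -/(u a) -/(b x) addrC addKr -smash_split.
Qed.

Lemma Bsmash_d_prim (a : H) : cop a = a ⊗ 1 + 1 ⊗ a ->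
  d (a ⊗ 1 : O) = 1 ⊗ bg (act X theta a).
Proof.
by move=> ea; rewrite /graded_comm [X in _ - X ∙ _]par_u Bsmash_comm_prim // (Bact_gen Hh Hc).
Qed.

Lemma Bsmash_d_B (x : B) : d (1 ⊗ x : O) = 1 ⊗ (bg theta * x - Bpar x * bg theta).
Proof.
rewrite /graded_comm [X in _ - X ∙ _]par_b; apply/esym.
by rewrite [LHS](linear_mapD _ _ bl) (linear_mapN _ bl) !bM.
Qed.

End QuadraticCalculus.

(** * Enveloping algebra and Casimir element *)

#[export] Hint Extern 0 (GRing.linear_for _ (@ugen _ _)) => exact: qgen_linear : lin.
#[export] Hint Extern 0 (bilinear_for _ _ (@lbr _ _)) => exact: lbr_bilinear : lin.

Lemma op_is_algebra (K : fieldType) (A : algType K) :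
  is_algebra (fun a b : A => b * a) 1.
Proof.
split; [by lin | | exact: mulr1 | exact: mul1r] => a b c.
by rewrite mulrA.
Qed.

Section LieBracket.
Variables (K : fieldType) (g : lieAlgType K).
Implicit Types x y z : g.

Lemma lbr_linearl y : linear (fun x : g => ⟦x, y⟧).
Proof. exact: bilin_l (@lbr_bilinear K g). Qed.

Lemma lbr_linearr x : linear (lbr x : g -> g).
Proof. exact: bilin_r (@lbr_bilinear K g). Qed.

Lemma lbr_antisym x y : ⟦x, y⟧ = - ⟦y, x⟧.
Proof.
apply/eqP; rewrite -addr_eq0; apply/eqP; have := lbr_alt (x + y).
rewrite (linear_mapD _ _ (lbr_linearl _)) !(linear_mapD _ _ (lbr_linearr _)) !lbr_alt.
by rewrite add0r addr0.
Qed.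

Lemma lbr_jacobi_l x y z : ⟦⟦x, y⟧, z⟧ - ⟦⟦x, z⟧, y⟧ = ⟦x, ⟦y, z⟧⟧.
Proof.
apply/eqP; rewrite -subr_eq0 -(oppr0 g) -(jacobi x y z) !opprD; apply/eqP.
rewrite (lbr_antisym ⟦x, y⟧) (lbr_antisym ⟦x, z⟧) opprK (lbr_antisym x z).
rewrite (linear_mapN _ (lbr_linearr _)) addrC -!addrA; congr (_ + _); exact: addrC.
Qed.

Lemma lbr_jacobi_r x y z : ⟦x, ⟦y, z⟧⟧ - ⟦y, ⟦x, z⟧⟧ = ⟦⟦x, y⟧, z⟧.
Proof.
rewrite [RHS]lbr_antisym -(lbr_jacobi_l z) opprB (lbr_antisym z x) (lbr_antisym z y).
by rewrite !(linear_mapN _ (lbr_linearl _)) -!lbr_antisym.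
Qed.

End LieBracket.

Section Enveloping.
Variables (K : fieldType) (g : lieAlgType K).
Local Notation U := (env_alg g).
Local Notation S := (Relators (@env_relator_aug K g)).
Local Notation ug := (@ugen K g).

Lemma env_relator_lift (Z : lmodType K) mul one (f : g -> Z) :
  is_algebra mul one -> linear f ->
  (forall x y, mul (f x) (f y) - mul (f y) (f x) = f ⟦x, y⟧) ->
  forall z, relator S z -> talg_lift mul one f z = 0.
Proof.
move=> Za fl fr z [x [y ->]]; have ll := talg_lift_linear Za fl.
rewrite !(linear_mapD _ _ ll) !(linear_mapN _ ll) talg_lift_gen // -fr.
rewrite [talg_lift _ _ _ (_ * _)](talg_liftM Za fl) [talg_lift _ _ _ (_ * _)](talg_liftM Za fl).
by rewrite !talg_lift_gen // subrr.
Qed.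

Lemma ugen_lbr (x y : g) : ug x * ug y - ug y * ug x = ug ⟦x, y⟧.
Proof.
apply/eqP; rewrite -subr_eq0; apply/eqP.
pose p (z : talg g) : U := \pi_(qalg S) z.
have pl : linear p.
  by move=> a z z'; rewrite /p qalg_piD [\pi_(qalg S) (_ *: _)]qalg_piZ.
have pM z z' : p (z * z') = p z * p z' by exact: qalg_piM.
rewrite -[ug x]/(p (tgen x)) -[ug y]/(p (tgen y)) -[ug _]/(p (tgen _)) -!pM.
rewrite -!(linear_mapN _ pl) -!(linear_mapD _ _ pl) -(linear_map0 pl).
apply/qalg_eqP; rewrite subr0 -[X in ideal_of _ X]mulr1 -[X in ideal_of _ X]mul1r mulrA.
by apply: IdealM; exists x, y.
Qed.

Let Ta := tmul_is_algebra U U.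
Let Ka := algType_is_algebra K^o.
Let Oa := op_is_algebra U.
Local Notation cgen := (fun x => ug x ⊗ 1 + 1 ⊗ ug x).
Local Notation agen := (fun x => - ug x).

Let cl : linear cgen. Proof. by lin. Qed.
Let al : linear agen. Proof. by lin. Qed.
Let zl : linear (fun _ : g => 0 : K^o). Proof. exact: lin0. Qed.

Let crel z : relator S z -> talg_lift (@tmul K U U) (1 ⊗ 1) cgen z = 0.
Proof.
apply: env_relator_lift Ta cl _ _ => x y.
have tD : bilinear_map (@tmul K U U) := is_alg_bilinear Ta.
rewrite !(linear_mapD _ _ (bilin_l _ tD)) !(linear_mapD _ _ (bilin_r _ tD)) !tmulE.
rewrite !(mulr1, mul1r) -ugen_lbr pureDl pureDr pureNl pureNr !opprD.
set p := ug x ⊗ ug y; set q := ug y ⊗ ug x.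
rewrite addrACA [X in X + _]addrACA [X in _ + X]addrACA -addrA; congr (_ + _).
by rewrite [X in X = _]addrA [X in X + _]addrA subrK subrr add0r.
Qed.

Let arel z : relator S z -> talg_lift (fun a b : U => b * a) 1 agen z = 0.
Proof.
apply: env_relator_lift Oa al _ _ => x y.
by rewrite !mulrNN -ugen_lbr opprB.
Qed.

Let krel z : relator S z -> talg_lift *%R (1 : K^o) (fun _ : g => 0) z = 0.
Proof. by apply: env_relator_lift Ka zl _ _ => x y; rewrite mul0r subrr. Qed.

Local Notation H := (env g).
Local Notation Cop := (@cop K H).
Local Notation Coun := (@coun K H).
Local Notation Ant := (@antip K H).

Lemma env_cop_linear : linear Cop. Proof. exact: qalg_lift_linear Ta cl crel. Qed.
Lemma env_cop1 : Cop 1 = 1 ⊗ 1. Proof. exact: qalg_lift1 Ta cl crel. Qed.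
Lemma env_copM a b : Cop (a * b) = tmul (Cop a) (Cop b).
Proof. exact: qalg_liftM Ta cl crel a b. Qed.
Lemma env_copE x : Cop (ug x) = ug x ⊗ 1 + 1 ⊗ ug x.
Proof. exact: qalg_lift_gen Ta cl crel x. Qed.

Lemma env_coun_linear : linear (Coun : H -> K^o). Proof. exact: qalg_lift_linear Ka zl krel. Qed.
Lemma env_coun1 : Coun 1 = 1. Proof. exact: qalg_lift1 Ka zl krel. Qed.
Lemma env_counM a b : Coun (a * b) = Coun a * Coun b.
Proof. exact: qalg_liftM Ka zl krel a b. Qed.
Lemma env_counE x : Coun (ug x) = 0. Proof. exact: qalg_lift_gen Ka zl krel x. Qed.

Lemma env_antip_linear : linear Ant. Proof. exact: qalg_lift_linear Oa al arel. Qed.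
Lemma env_antip1 : Ant 1 = 1. Proof. exact: qalg_lift1 Oa al arel. Qed.
Lemma env_antipM a b : Ant (a * b) = Ant b * Ant a.
Proof. exact: qalg_liftM Oa al arel a b. Qed.
Lemma env_antipE x : Ant (ug x) = - ug x. Proof. exact: qalg_lift_gen Oa al arel x. Qed.

Let copl := env_cop_linear.
Let antl := env_antip_linear.
Let counl := env_coun_linear.

Lemma env_cop_sw_gen (Z : lmodType K) (f : U -> U -> Z) x y : bilinear_map f ->
  \sw_(a, b <- Cop (ug x * y)) f a b =
  \sw_(a, b <- Cop y) (f (ug x * a) b + f a (ug x * b)).
Proof.
move=> fb; rewrite env_copM env_copE.
sweedler (Cop y) as a b; pureE.
rewrite (linear_mapD _ _ (bilin_l _ (is_alg_bilinear Ta))) !tmulE tliftD //; pureE.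
by rewrite !mul1r.
Qed.

Let env_ind (Z : lmodType K) (F G : U -> Z) : linear F -> linear G ->
  F 1 = G 1 -> (forall x y, F y = G y -> F (ug x * y) = G (ug x * y)) ->
  forall a, F a = G a := @qalg_eq_ind K g S Z F G.

Let env_coassoc a : tassoc (tmap Cop id (Cop a)) = tmap id Cop (Cop a).
Proof.
move: a; apply: env_ind; [lin | lin | |] => [|x y ey].
  by rewrite env_cop1; pureE; rewrite env_cop1; pureE.
(* [M] is left multiplication by the twice iterated coproduct of [x], into which both sides turn
   left multiplication by the generator. *)
pose M (t : U ⊗ (U ⊗ U)) : U ⊗ (U ⊗ U) := \sw_(p, s <- t) \sw_(q, r <- s)
  ((ug x * p) ⊗ (q ⊗ r) + p ⊗ ((ug x * q) ⊗ r) + p ⊗ (q ⊗ (ug x * r))).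
have Ml : linear M by rewrite /M; lin.
have ME (p q r : U) : M (p ⊗ (q ⊗ r)) =
    (ug x * p) ⊗ (q ⊗ r) + p ⊗ ((ug x * q) ⊗ r) + p ⊗ (q ⊗ (ug x * r)).
  by rewrite /M; pureE.
have mg (z : U) : Cop (ug x * z) = \sw_(p, q <- Cop z) ((ug x * p) ⊗ q + p ⊗ (ug x * q)).
  rewrite -(env_cop_sw_gen (f := fun a b => a ⊗ b)); last by lin.
  by rewrite -[LHS]tmap_id.
transitivity (M (tassoc (tmap Cop id (Cop y)))).
  rewrite mg; sweedler (Cop y) as p q; pureE.
  rewrite (linear_mapD _ _ (lin_tmap copl (@lin_id _ _))) (linear_mapD _ _ (@tassoc_linear _ _ _ _)).
  pureE; rewrite mg.
  sweedler (Cop p) as p1 p2; pureE; rewrite ME.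
  by rewrite pureDl (linear_mapD _ _ (@tassoc_linear _ _ _ _)); pureE.
rewrite ey mg; sweedler (Cop y) as p q; pureE.
rewrite (linear_mapD _ _ (lin_tmap (@lin_id _ _) copl)); pureE; rewrite mg.
sweedler (Cop q) as q1 q2; pureE.
by rewrite ME pureDr addrA.
Qed.

Lemma env_is_hopf : is_hopf H.
Proof.
split.
- exact: env_cop_linear.
- exact: env_cop1.
- exact: env_copM.
- exact: env_coassoc.
- exact: env_coun_linear.
- exact: env_coun1.
- exact: env_counM.
- apply: env_ind; [lin | lin | |] => [|x y ey].
    by rewrite env_cop1; pureE; rewrite env_coun1 scale1r.
  rewrite (env_cop_sw_gen (f := fun a b => Coun a *: b)); last by lin.
  rewrite -[in RHS]ey (linear_tlift (h := *%R (ug x))); last by lin.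
  apply: eq_tlift => a b.
  by rewrite env_counM env_counE mul0r scale0r add0r -scalerAr.
- apply: env_ind; [lin | lin | |] => [|x y ey].
    by rewrite env_cop1; pureE; rewrite env_coun1 scale1r.
  rewrite (env_cop_sw_gen (f := fun a b => Coun b *: a)); last by lin.
  rewrite -[in RHS]ey (linear_tlift (h := *%R (ug x))); last by lin.
  apply: eq_tlift => a b.
  by rewrite env_counM env_counE mul0r scale0r addr0 -scalerAr.
- exact: env_antip_linear.
- apply: env_ind; [lin | lin | |] => [|x y ey].
    by rewrite env_cop1; pureE; rewrite env_coun1 env_antip1 mul1r scale1r.
  rewrite (env_cop_sw_gen (f := fun a b => Ant a * b)); last by lin.
  rewrite env_counM env_counE mul0r scale0r; apply: tlift_eq0 => a b.
  by rewrite env_antipM env_antipE mulrN mulNr mulrA addNr.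
apply: env_ind; [lin | lin | |] => [|x y ey].
  by rewrite env_cop1; pureE; rewrite env_coun1 env_antip1 mul1r scale1r.
rewrite (env_cop_sw_gen (f := fun a b => a * Ant b)); last by lin.
transitivity (ug x * (Coun y)%:A - (Coun y)%:A * ug x); last first.
  by rewrite env_counM env_counE mul0r scale0r mulr_algl mulr_algr subrr.
rewrite -ey; sweedler (Cop y) as a b; pureE.
by rewrite env_antipM env_antipE !mulrN !mulrA.
Qed.

Lemma env_extendsP : env_extends g.
Proof. by split; [exact: env_copE | exact: env_counE | exact: env_antipE]. Qed.

End Enveloping.

(** * The Killing form and the split Casimir tensor *)

Section KillingForm.
Variables (K : fieldType) (g : lieAlgType K).
Implicit Types x y z : g.
Local Notation e := (vbasis {:g}).

(** Row i holds the coordinates of the bracket of [x] with the i-th basis vector. With this row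
    convention composition of adjoint maps becomes the reversed matrix product, hence the order of
    factors in [killing_tr] and [adm_lbr]. *)
Definition adm x : 'M[K]_(\dim {:g}) := \matrix_(i, j) coord e j ⟦x, e`_i⟧.

Lemma coord_fullE (v : g) : v = \sum_i coord e i v *: e`_i.
Proof. by rewrite -coord_vbasis ?memvf. Qed.

Lemma lbr_adm x (i : 'I_(\dim {:g})) : ⟦x, e`_i⟧ = \sum_j adm x i j *: e`_j.
Proof.
rewrite [LHS]coord_fullE; apply: eq_bigr => j _.
by rewrite mxE.
Qed.

Lemma killing_tr x y : killing x y = \tr (adm y *m adm x).
Proof.
apply: eq_bigr => i _; rewrite mxE lbr_adm (linear_map_sum _ _ _ (lbr_linearr x)) linear_sum.
by apply: eq_bigr => j _; rewrite (linear_mapZ _ _ (lbr_linearr x)) linearZ /= [adm x j i]mxE.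
Qed.

Lemma killing_sym x y : killing x y = killing y x.
Proof. by rewrite !killing_tr mxtrace_mulC. Qed.

Lemma adm_lbr x y : adm ⟦x, y⟧ = adm y *m adm x - adm x *m adm y.
Proof.
apply/matrixP => i j; rewrite !mxE -lbr_jacobi_r linearB /=.
have E a b : coord e j ⟦a, ⟦b, e`_i⟧⟧ = \sum_k adm b i k * adm a k j.
  rewrite lbr_adm (linear_map_sum _ _ _ (lbr_linearr a)) linear_sum.
  by apply: eq_bigr => k _; rewrite (linear_mapZ _ _ (lbr_linearr a)) linearZ /= [adm a k j]mxE.
by rewrite !E.
Qed.

Lemma killing_inv x y z : killing ⟦x, y⟧ z = killing x ⟦y, z⟧.
Proof.
rewrite !killing_tr !adm_lbr mulmxBl mulmxBr !raddfB /= !mulmxA.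
by rewrite (mxtrace_mulC (adm z *m adm x)) mulmxA.
Qed.

Lemma adm_linear : linear adm.
Proof.
by move=> a x y; apply/matrixP => i j; rewrite !mxE (lbr_linearl _ a x y) linearP.
Qed.

Lemma killing_linearr x : linear (killing x : g -> K^o).
Proof.
by move=> a y z; rewrite !killing_tr (adm_linear a y z) mulmxDl -scalemxAl linearP.
Qed.

Lemma killing_linearl y : linear (fun x => killing x y : K^o).
Proof. by move=> a x z; rewrite !(killing_sym _ y); exact: killing_linearr. Qed.

Section DualBases.
Variables (n : nat) (t t' : 'I_n -> g).
Hypothesis tt' : killing_dual_bases t t'.

Lemma dual_expand x : x = \sum_i killing x (t' i) *: t i.
Proof.
have [/andP[/eqP spt _] kd] := tt'.
have /coord_span : x \in <<[tuple of codom t]>>%VS by rewrite spt memvf.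
set c := coord _ => ex.
have ex' : x = \sum_j c (enum_rank j) x *: t j.
  rewrite [LHS]ex (reindex _ (onW_bij _ (@enum_rank_bij 'I_n))) /=.
  by apply: eq_bigr => j _; rewrite nth_codom enum_rankK.
rewrite {1}ex'; apply: eq_bigr => j _; congr (_ *: _).
rewrite [in RHS]ex' (linear_map_sum (h := fun x => killing x (t' j) : K^o)); last exact: killing_linearl.
rewrite (bigD1 j) //= big1 => [|i /negPf ne].
  by rewrite addr0 (linear_mapZ _ _ (killing_linearl _)) kd eqxx [RHS]mulr1.
by rewrite (linear_mapZ _ _ (killing_linearl _)) kd ne [LHS]mulr0.
Qed.

Lemma killing_nondeg x : (forall y, killing x y = 0) -> x = 0.
Proof. by move=> k0; rewrite (dual_expand x) big1 // => i _; rewrite k0 scale0r. Qed.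

(** The family [t'] is given only by its pairings with [t]. The difference of the two sides pairs to
    zero with every [t j], hence with everything, and nondegeneracy applies. *)
Lemma dual_expand' x : x = \sum_i killing (t i) x *: t' i.
Proof.
apply/eqP; rewrite -subr_eq0; apply/eqP; apply: killing_nondeg => y; rewrite killing_sym.
rewrite [y]dual_expand (linear_map_sum (h := fun y => killing y _ : K^o)); last exact: killing_linearl.
apply: big1 => j _; rewrite (linear_mapZ _ _ (killing_linearl _)).
suff -> : killing (t j) (x - \sum_i killing (t i) x *: t' i) = 0 by rewrite [LHS]mulr0.
rewrite (linear_mapD _ _ (killing_linearr _)) (linear_mapN _ (killing_linearr _)).
rewrite (linear_map_sum _ _ _ (killing_linearr _)) (bigD1 j) //= big1 => [|i /negPf ne].
  rewrite addr0 (linear_mapZ _ _ (killing_linearr _)) tt'.2 eqxx [X in _ - X]mulr1.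
  exact: subrr.
by rewrite (linear_mapZ _ _ (killing_linearr _)) tt'.2 eq_sym ne [LHS]mulr0.
Qed.

(** Expanded in the basis [t], the Casimir tensor has the coefficients [killing (t' i) (t' j)], a
    symmetric matrix. Testing against an arbitrary bilinear [f] lets the lemma serve in U, in U ⊗ U
    and in X. *)
Lemma dual_sym (Z : lmodType K) (f : g -> g -> Z) : bilinear_map f ->
  \sum_i f (t i) (t' i) = \sum_i f (t' i) (t i).
Proof.
move=> fb.
transitivity (\sum_i \sum_j killing (t' i) (t' j) *: f (t i) (t j)).
  apply: eq_bigr => i _; rewrite [X in f _ X]dual_expand (linear_map_sum _ _ _ (bilin_r _ fb)).
  by apply: eq_bigr => j _; rewrite (linear_mapZ _ _ (bilin_r _ fb)).
rewrite exchange_big; apply: eq_bigr => i _.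
rewrite [X in f X _]dual_expand (linear_map_sum _ _ _ (bilin_l (t i) fb)).
by apply: eq_bigr => j _; rewrite (linear_mapZ _ _ (bilin_l _ fb)) killing_sym.
Qed.

(** Both sides are double sums over the [f (t j) (t' i)]; invariance of the Killing form moves [x]
    from one argument of the coefficient to the other. *)
Lemma dual_inv (Z : lmodType K) (f : g -> g -> Z) x : bilinear_map f ->
  \sum_i f ⟦t i, x⟧ (t' i) = - \sum_i f (t i) ⟦t' i, x⟧.
Proof.
move=> fb.
have -> : \sum_i f ⟦t i, x⟧ (t' i) =
    \sum_i \sum_j killing ⟦t i, x⟧ (t' j) *: f (t j) (t' i).
  apply: eq_bigr => i _; rewrite [X in f X _]dual_expand (linear_map_sum _ _ _ (bilin_l (t' i) fb)).
  by apply: eq_bigr => j _; rewrite (linear_mapZ _ _ (bilin_l _ fb)).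
have -> : \sum_i f (t i) ⟦t' i, x⟧ =
    \sum_i \sum_j killing (t j) ⟦t' i, x⟧ *: f (t i) (t' j).
  apply: eq_bigr => i _; rewrite [X in f _ X]dual_expand' (linear_map_sum _ _ _ (bilin_r _ fb)).
  by apply: eq_bigr => j _; rewrite (linear_mapZ _ _ (bilin_r _ fb)).
rewrite exchange_big -sumrN; apply: eq_bigr => j _; rewrite -sumrN.
apply: eq_bigr => i _; rewrite -scaleNr killing_inv lbr_antisym.
by rewrite (linear_mapN _ (killing_linearr _)).
Qed.

End DualBases.

End KillingForm.

#[export] Hint Extern 0 (GRing.linear_for _ fst) => exact: lin_fst : lin.
#[export] Hint Extern 0 (GRing.linear_for _ snd) => exact: lin_snd : lin.
#[export] Hint Extern 1 (GRing.linear_for _ (fun x => pair _ _)) => (apply: lin_pair; lin) : lin.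

(** * The crossed module spanned by the Lie algebra and the Casimir *)

Section CasimirExtension.
Variables (K : fieldType) (g : lieAlgType K) (n : nat) (t t' : 'I_n -> g).
Hypothesis tt' : killing_dual_bases t t'.

Local Notation U := (env g).
Local Notation X := (Lambda1 t t').
Local Notation sp := (Lambda1_sp g).
Local Notation ug := (@ugen K g).
Local Notation G := (Lambda1_g t t').
Local Notation C := (Lambda1_c t t').
Local Notation incl := (@Lambda1_incl K g n t t').
Let Uh := env_is_hopf g.

Lemma Lambda1_g_linear : linear G.
Proof. by move=> a x y; congr pair; rewrite [RHS]addr0 [RHS]mulr0. Qed.
Let Gl := Lambda1_g_linear.

Lemma Lambda1E (x : X) : x = G x.1 + (x.2 : K) *: C.
Proof.
case: x => v a; congr pair; first by rewrite /= scaler0 addr0.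
by rewrite [RHS]add0r [RHS]mulr1.
Qed.

Section Action.
Local Notation mul := (fun F F' : linmap sp sp => tolin (F' \o F)).
Local Notation gen := (fun xi : g => tolin (fun x : sp => (⟦x.1, xi⟧, 0) : sp)).
Let Ea := endop_is_algebra sp.
Let genl (xi : g) : linear (fun x : sp => (⟦x.1, xi⟧, 0) : sp). Proof. by lin. Qed.
Let gl : linear gen.
Proof. by apply: lin_tolin => [xi|x]; lin. Qed.

Let grel z : relator (Relators (@env_relator_aug K g)) z -> talg_lift mul (tolin id) gen z = 0.
Proof.
apply: env_relator_lift Ea gl _ _ => x y; apply: linmapP => v.
have mE (a b : g) : tolin (gen b \o gen a) v = (⟦⟦v.1, a⟧, b⟧, 0) :> sp.
  by rewrite tolin_app /comp; [rewrite !tolin_app; try exact: genl | lin].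
transitivity (tolin (gen y \o gen x) v - tolin (gen x \o gen y) v); first by [].
transitivity ((⟦⟦v.1, x⟧, y⟧, 0) - (⟦⟦v.1, y⟧, x⟧, 0) : sp).
  by congr (_ - _); exact: mE.
rewrite tolin_app; last exact: genl.
by congr pair; [exact: lbr_jacobi_l | exact: subrr].
Qed.

Let lift (u : env_alg g) : linmap sp sp := qalg_lift mul (tolin id) gen u.
Let liftl : linear lift. Proof. exact: qalg_lift_linear Ea gl grel. Qed.
Let lift1 : lift 1 = tolin id. Proof. exact: qalg_lift1 Ea gl grel. Qed.
Let liftM a b : lift (a * b) = tolin (lift b \o lift a).
Proof. exact: qalg_liftM Ea gl grel a b. Qed.
Let lift_gen xi : lift (ug xi) = gen xi.
Proof. exact: qalg_lift_gen Ea gl grel xi. Qed.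

Let actE (x : sp) (u : env_alg g) : act X x u = lift u x. Proof. by []. Qed.

Lemma Lambda1_act_bilinear : bilinear_map (act X).
Proof.
apply: bilinearP => [u|x]; first by move=> a x y; rewrite !actE; exact: linmap_linear.
by move=> a u v; rewrite !actE liftl.
Qed.

Lemma Lambda1_act1 (x : X) : act X x 1 = x.
Proof. by rewrite actE lift1 tolin_app. Qed.

Lemma Lambda1_actM (x : X) (a b : U) : act X x (a * b) = act X (act X x a) b.
Proof. by rewrite !actE liftM tolin_app // /comp; lin. Qed.

Lemma Lambda1_act_gen (x : X) (xi : g) : act X x (ug xi) = G ⟦x.1, xi⟧.
Proof. by rewrite actE lift_gen tolin_app. Qed.
End Action.
Let actb := Lambda1_act_bilinear.

Lemma Lambda1_coactE (x : X) : coact X x =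
  x ⊗ (1 : U) + \sum_i (2%:R * x.2 : K) *: (G (t i) ⊗ (ug (t' i) : U)).
Proof. by []. Qed.

Lemma Lambda1_coact_linear : linear (coact X).
Proof.
move=> a x y; rewrite !Lambda1_coactE pureDl pureZl scalerDr addrACA; congr (_ + _).
rewrite scaler_sumr -big_split; apply: eq_bigr => i _ /=.
by rewrite scalerA -scalerDl; congr (_ *: _); rewrite mulrDr mulrCA.
Qed.
Let coactl := Lambda1_coact_linear.

Lemma Lambda1_coact_g v : coact X (G v) = G v ⊗ 1.
Proof.
rewrite Lambda1_coactE big1 ?addr0 // => i _.
by rewrite mulr0 scale0r.
Qed.

(** So Psi is the flip, up to a term in g ⊗ g that sees only the c-component of the second
    factor. *)
Lemma Lambda1_braidE (x y : X) : braid (x ⊗ y) =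
  y ⊗ x + \sum_i (2%:R * y.2 : K) *: (G (t i) ⊗ G ⟦x.1, t' i⟧).
Proof.
rewrite /braid; pureE; rewrite Lambda1_coactE tliftD; last by lin.
pureE; rewrite Lambda1_act1; congr (_ + _).
rewrite (linear_map_sum (h := tlift _)); last by lin.
apply: eq_bigr => i _; rewrite (linear_mapZ (h := tlift _)); last by lin.
by pureE; rewrite Lambda1_act_gen.
Qed.

Lemma casimir_inv (Z : lmodType K) (f : g -> g -> Z) x : bilinear_map f ->
  \sum_i f (t i) ⟦x, t' i⟧ = \sum_i f ⟦t i, x⟧ (t' i).
Proof.
move=> fb; rewrite (dual_inv tt') // -sumrN; apply: eq_bigr => i _.
by rewrite lbr_antisym (linear_mapN _ (bilin_r _ fb)).
Qed.

Lemma casimir_central xi : casimir t t' * ug xi = ug xi * casimir t t'.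
Proof.
apply/eqP; rewrite -subr_eq0 mulr_suml mulr_sumr -sumrB; apply/eqP.
transitivity (\sum_i (ug (t i) * ug ⟦t' i, xi⟧) + \sum_i (ug ⟦t i, xi⟧ * ug (t' i))).
  rewrite -big_split; apply: eq_bigr => i _ /=.
  by rewrite -!ugen_lbr mulrBr mulrBl !mulrA addrA subrK.
by rewrite (dual_inv tt' (f := fun x y => ug x * ug y)) ?subrr //; lin.
Qed.

Lemma casimir_cop : @cop K U (casimir t t') = casimir t t' ⊗ 1 + 1 ⊗ casimir t t' +
  \sum_i 2%:R *: (ug (t i) ⊗ ug (t' i)).
Proof.
rewrite (linear_map_sum _ _ _ (hopf_cop_linear Uh)).
transitivity (\sum_i ((ug (t i) * ug (t' i)) ⊗ 1 + 1 ⊗ (ug (t i) * ug (t' i)) +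
   (ug (t i) ⊗ ug (t' i) + ug (t' i) ⊗ ug (t i)) : U ⊗ U)).
  apply: eq_bigr => i _; rewrite (hopf_copM Uh) !env_copE.
  rewrite !(linear_mapD _ _ (bilin_l _ (@tmul_bilinear _ _ _))) !(linear_mapD _ _ (bilin_r _ (@tmul_bilinear _ _ _))).
  by rewrite !tmulE !(mulr1, mul1r) [X in _ + X = _]addrC addrACA.
(* The two cross terms agree by symmetry of the Casimir tensor; their sum is the origin of the
   factor 2 in the coaction of c. *)
rewrite !big_split /= -(dual_sym tt' (f := fun x y => ug x ⊗ ug y : U ⊗ U)); last by lin.
congr (_ + _ + _).
- by rewrite (linear_map_sum (h := fun x => x ⊗ 1)) //; lin.
- by rewrite (linear_map_sum (h := pure 1)) //; lin.
by rewrite -mulr2n -scaler_nat scaler_sumr.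
Qed.

(** The antipode-free crossed module condition at a primitive [xi]. On g it is immediate, and in the
    c-component it amounts to the invariance of the Casimir tensor. *)
Lemma Lambda1_compat_gen (x : X) (xi : g) :
  \sw_(y, h <- coact X x) y ⊗ (ug xi * h) + coact X (G ⟦x.1, xi⟧) =
  \sw_(y, h <- coact X x) (G ⟦y.1, xi⟧ ⊗ h + y ⊗ (h * ug xi)).
Proof.
rewrite Lambda1_coact_g Lambda1_coactE !tliftD; try by lin.
pureE; rewrite mulr1 mul1r !(linear_map_sum (h := tlift _)); try by lin.
rewrite addrAC [X in X + _]addrC -!addrA; congr (_ + (_ + _)).
transitivity (\sum_i (2%:R * x.2 : K) *: (G (t i) ⊗ (ug xi * ug (t' i) : U))).
  by apply: eq_bigr => i _; rewrite (linear_mapZ (h := tlift _)); [pureE | lin].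
transitivity (\sum_i (2%:R * x.2 : K) *:
    (G ⟦t i, xi⟧ ⊗ (ug (t' i) : U) + G (t i) ⊗ (ug (t' i) * ug xi : U))); last first.
  by apply: eq_bigr => i _; rewrite (linear_mapZ (h := tlift _)); [pureE | lin].
rewrite -!scaler_sumr; congr (_ *: _).
rewrite big_split -(casimir_inv (f := fun v w => G v ⊗ (ug w : U))); last by lin.
rewrite -big_split; apply: eq_bigr => i _ /=.
by rewrite -ugen_lbr pureDr pureNr subrK.
Qed.

Lemma Lambda1_compat (x : X) (a : U) :
  \sw_(a1, a2 <- cop a) \sw_(y, h <- coact X (act X x a2)) y ⊗ (a1 * h) =
  \sw_(a1, a2 <- cop a) \sw_(y, h <- coact X x) act X y a1 ⊗ (h * a2).
Proof.
move: a x; apply: qalg_ind => [k a b ea eb x|x|x|xi b eb x].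
- have l1 : linear (fun a : U => \sw_(a1, a2 <- cop a) \sw_(y, h <- coact X (act X x a2)) y ⊗ (a1 * h)) by lin.
  have l2 : linear (fun a : U => \sw_(a1, a2 <- cop a) \sw_(y, h <- coact X x) act X y a1 ⊗ (h * a2)) by lin.
  by rewrite [LHS]l1 [RHS]l2 ea eb.
- have l0 (Z : lmodType K) (f : U -> U -> Z) : bilinear_map f -> tlift f (@cop K U 0) = 0.
    by move=> fb; rewrite (linear_map0 (hopf_cop_linear Uh)) (linear_map0 (tlift_linear fb)).
  by rewrite !l0 //; lin.
- rewrite (hopf_cop1 Uh); pureE; rewrite Lambda1_act1.
  by apply: eq_tlift => y h; rewrite Lambda1_act1 mulr1 mul1r.
(* [B] lets the legs of the word [b] act and multiply on the right. The condition for [xi * b] is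
   the condition for [xi] with [B] applied, the induction hypothesis being used on the left-hand
   side. *)
pose B (z : X ⊗ U) : X ⊗ U := \sw_(b1, b2 <- @cop K U b) \sw_(y, h <- z) act X y b1 ⊗ (h * b2).
have Bl : linear B by rewrite /B; lin.
transitivity (B (\sw_(y, h <- coact X x) y ⊗ (ug xi * h) + coact X (G ⟦x.1, xi⟧))).
  rewrite (linear_mapD _ _ Bl) {2}/B -eb.
  have -> : B (\sw_(y, h <- coact X x) y ⊗ (ug xi * h)) =
      tmap id ( *%R (ug xi)) (\sw_(b1, b2 <- @cop K U b) \sw_(y, h <- coact X (act X x b2)) y ⊗ (b1 * h)).
    rewrite eb /B; sweedler (@cop K U b) as b1 b2; pureE.
    by sweedler (coact X x) as y h; pureE; rewrite mulrA.
  rewrite (env_cop_sw_gen (f := fun a b => \sw_(y, h <- coact X (act X x b)) y ⊗ (a * h))); last by lin.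
  sweedler (@cop K U b) as b1 b2; pureE; rewrite Lambda1_actM Lambda1_act_gen; congr (_ + _).
  by sweedler (coact X (act X x b2)) as y h; pureE; rewrite mulrA.
rewrite Lambda1_compat_gen /B.
rewrite (env_cop_sw_gen (f := fun a b => \sw_(y, h <- coact X x) act X y a ⊗ (h * b))); last by lin.
sweedler (@cop K U b) as b1 b2; pureE; sweedler (coact X x) as y h; pureE.
rewrite tliftD; last by lin.
by pureE; rewrite Lambda1_actM Lambda1_act_gen mulrA.
Qed.

Lemma Lambda1_is_cmod : is_cmod X.
Proof.
have C0 := hopf_cop_linear Uh.
split.
- exact: Lambda1_act_bilinear.
- exact: Lambda1_act1.
- exact: Lambda1_actM.
- exact: Lambda1_coact_linear.
- move=> x; rewrite [in RHS]Lambda1_coactE.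
  rewrite (linear_mapD (h := tmap id (@cop K U))); last by lin.
  rewrite (linear_map_sum (h := tmap id (@cop K U))); last by lin.
  have tl : linear (fun z : X ⊗ U => tassoc (tmap (coact X) id z)) by lin.
  rewrite Lambda1_coactE [LHS](linear_mapD (h := fun z : X ⊗ U => tassoc (tmap (coact X) id z))) //.
  rewrite (linear_map_sum _ _ _ tl); pureE.
  rewrite Lambda1_coactE pureDl (linear_mapD _ _ (@tassoc_linear _ _ _ _)); pureE.
  rewrite (hopf_cop1 Uh) -addrA; congr (_ + _).
  rewrite (linear_map_sum (h := fun z : X ⊗ U => tassoc (z ⊗ (1 : U)))); last by lin.
  rewrite -big_split; apply: eq_bigr => i _ /=.
  rewrite (linear_mapZ _ _ tl) pureZl (linear_mapZ _ _ (@tassoc_linear _ _ _ _)).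
  rewrite (linear_mapZ (h := tmap id (@cop K U))); last by lin.
  rewrite -scalerDr; congr (_ *: _); pureE; rewrite Lambda1_coact_g env_copE pureDr.
  by pureE.
- move=> x; rewrite Lambda1_coactE tliftD; last by lin.
  pureE; rewrite (hopf_coun1 Uh) scale1r (linear_map_sum (h := tlift _)); last by lin.
  rewrite big1 ?addr0 // => i _; rewrite (linear_mapZ (h := tlift _)); last by lin.
  by pureE; rewrite env_counE scale0r scaler0.
move=> x a; apply: cmod_compat_of_sw Uh actb coactl _ x a.
exact: Lambda1_compat.
Qed.

Lemma Lambda1_incl_linear : linear incl.
Proof.
move=> a x y; rewrite /Lambda1_incl.
have -> : ug (a *: x + y).1 = a *: ug x.1 + ug y.1 by exact: qgen_linear.
rewrite scalerDl scalerDr scalerA.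
exact: addrACA.
Qed.
Let incll := Lambda1_incl_linear.

Lemma Lambda1_incl_g v : incl (G v) = ug v.
Proof. by rewrite /Lambda1_incl /= scale0r addr0. Qed.

Lemma Lambda1_incl_ad (x : X) xi : incl x * ug xi - ug xi * incl x = ug ⟦x.1, xi⟧.
Proof.
rewrite /Lambda1_incl mulrDl mulrDr -scalerAl -scalerAr casimir_central.
by rewrite opprD addrACA subrr addr0 ugen_lbr.
Qed.

Lemma Lambda1_incl_map : is_cmod_map_to_aug incl.
Proof.
have cl : linear (@coun K U : U -> K^o) := hopf_coun_linear Uh.
split.
- exact: Lambda1_incl_linear.
- move=> x; rewrite /Lambda1_incl (linear_mapD _ _ cl) (linear_mapZ _ _ cl) env_counE.
  rewrite (linear_map_sum _ _ _ cl) big1 ?scaler0 ?addr0 // => i _.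
  by rewrite env_counM env_counE mul0r.
- move=> x a; move: a x; apply: qalg_ind => [k a b ea eb x|x|x|xi b eb x].
  + have l1 : linear (fun a : U => incl (act X x a)) by lin.
    have l2 : linear (fun a : U => \sw_(a1, a2 <- cop a) antip a1 * incl x * a2) by lin.
    by rewrite [LHS]l1 [RHS]l2 ea eb.
  + have l2 : linear (fun a : U => \sw_(a1, a2 <- cop a) antip a1 * incl x * a2) by lin.
    by rewrite (linear_map0 (bilin_r x actb)) (linear_map0 incll) (linear_map0 l2).
  + by rewrite (hopf_cop1 Uh); pureE; rewrite Lambda1_act1 env_antip1 mulr1 mul1r.
  rewrite Lambda1_actM Lambda1_act_gen eb.
  rewrite (env_cop_sw_gen (f := fun a b : U => antip a * incl x * b)); last by lin.
  apply: eq_tlift => b1 b2; rewrite Lambda1_incl_g -Lambda1_incl_ad env_antipM env_antipE.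
  by rewrite mulrBr mulrBl addrC !mulrN !mulNr !mulrA.
move=> x; rewrite Lambda1_coactE (linear_mapD (h := tmap incl id)); last by lin.
rewrite (linear_map_sum (h := tmap incl id)); last by lin.
pureE; rewrite [in RHS]/Lambda1_incl (linear_mapD _ _ (hopf_cop_linear Uh)).
rewrite (linear_mapZ _ _ (hopf_cop_linear Uh)) env_copE casimir_cop !scalerDr pureDr pureZr.
rewrite scaler_sumr /Lambda1_incl pureDl pureZl.
set A := ug x.1 ⊗ 1; set B := 1 ⊗ ug x.1; set P := _ *: (casimir t t' ⊗ 1).
set Q := _ *: (1 ⊗ casimir t t'); set F := \sum_i tmap _ _ _.
have -> : F = \sum_(i < n) x.2 *: (2%:R *: (ug (t i) ⊗ (ug (t' i) : U))).
  apply: eq_bigr => i _; rewrite (linear_mapZ (h := tmap incl id)); last by lin.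
  by pureE; rewrite Lambda1_incl_g scalerA [(_ * _ : K)]mulrC.
set F' := \sum_(i < n) _.
by rewrite [P + Q + _]addrAC [X in _ = X - _]addrACA addrK addrA.
Qed.

End CasimirExtension.

(** * Injectivity, regularity of the braiding and relations *)

Section CasimirCalculus.
Variables (K : fieldType) (g : lieAlgType K) (n : nat) (t t' : 'I_n -> g).
Hypotheses (K0 : forall n, n.+1%:R != 0 :> K) (tt' : killing_dual_bases t t').

Local Notation U := (env g).
Local Notation X := (Lambda1 t t').
Local Notation ug := (@ugen K g).
Local Notation G := (Lambda1_g t t').
Local Notation C := (Lambda1_c t t').
Local Notation incl := (@Lambda1_incl K g n t t').
Let Xc := Lambda1_is_cmod tt'.
Let actb := @Lambda1_act_bilinear K g n t t'.
Let Gl := @Lambda1_g_linear K g n t t'.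
Let incll := @Lambda1_incl_linear K g n t t'.

Section AdjointRepresentation.
Local Notation mul := (fun F F' : linmap g g => tolin (F \o F')).
Local Notation gen := (fun x : g => tolin (lbr x : g -> g)).
Let Ea := end_is_algebra g.
Let gl : linear gen.
Proof. by apply: lin_tolin => x; lin. Qed.

Let grel z : relator (Relators (@env_relator_aug K g)) z -> talg_lift mul (tolin id) gen z = 0.
Proof.
apply: env_relator_lift Ea gl _ _ => x y; apply: linmapP => v.
have mE (a b : g) : tolin (gen a \o gen b) v = ⟦a, ⟦b, v⟧⟧.
  by rewrite tolin_app /comp; [rewrite !tolin_app; try exact: lbr_linearr | lin].
transitivity (tolin (gen x \o gen y) v - tolin (gen y \o gen x) v); first by [].
transitivity (⟦x, ⟦y, v⟧⟧ - ⟦y, ⟦x, v⟧⟧); first by congr (_ - _); exact: mE.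
by rewrite tolin_app ?lbr_jacobi_r //; exact: lbr_linearr.
Qed.

Definition adj (u : env_alg g) : linmap g g := qalg_lift mul (tolin id) gen u.

Lemma adj_linear : linear adj. Proof. exact: qalg_lift_linear Ea gl grel. Qed.

Lemma adjM u v x : adj (u * v) x = adj u (adj v x).
Proof.
have -> : adj (u * v) = tolin (adj u \o adj v) by exact: qalg_liftM Ea gl grel u v.
by rewrite tolin_app // /comp; lin.
Qed.

Lemma adj_gen x y : adj (ug x) y = ⟦x, y⟧.
Proof.
have -> : adj (ug x) = tolin (lbr x : g -> g) by exact: qalg_lift_gen Ea gl grel x.
by rewrite tolin_app //; exact: lbr_linearr.
Qed.
End AdjointRepresentation.

Lemma killing_ad0 (x : g) : (forall y, ⟦x, y⟧ = 0) -> x = 0.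
Proof.
move=> ad0; apply: (killing_nondeg tt') => y; rewrite killing_sym.
rewrite /killing big1 // => i _; rewrite ad0 (linear_map0 (lbr_linearr _)).
by rewrite linear0.
Qed.

Lemma ugen_inj : injective ug.
Proof.
move=> x y e; apply/eqP; rewrite -subr_eq0; apply/eqP; apply: killing_ad0 => z.
have u0 : ug (x - y) = 0.
  have ugl : linear ug by lin.
  by rewrite (linear_mapD _ _ ugl) (linear_mapN _ ugl) e subrr.
by rewrite -adj_gen u0 (linear_map0 adj_linear).
Qed.

(** For g = 0 the Casimir element is zero while Lambda^1 is still a line, whence the condition that
    g has a nonzero element. *)
Lemma Lambda1_incl_inj : (exists x : g, x != 0) -> injective incl.
Proof.
case=> x0 nz; have ug0 v : ug v = 0 -> v = 0.
  by move=> e; apply: ugen_inj; rewrite e; apply/esym/linear_map0; lin.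
suff inj0 x : incl x = 0 -> x = 0.
  move=> x y e; apply/eqP; rewrite -subr_eq0; apply/eqP/inj0.
  by rewrite (linear_mapD _ _ incll) (linear_mapN _ incll) e subrr.
(* As c is central, commuting i(x) with [xi] leaves the bracket of [x.1] with [xi]. So [x.1]
   brackets to zero with everything, and it vanishes by nondegeneracy. *)
move=> ix; have x1 : x.1 = 0.
  apply: killing_ad0 => xi; apply: ug0.
  by rewrite -(Lambda1_incl_ad tt' x) ix mul0r mulr0 subrr.
rewrite (Lambda1E x) x1 (linear_map0 Gl) add0r.
have [->|a0] := eqVneq x.2 0; first by rewrite scale0r.
have cas0 : casimir t t' = 0.
  apply/eqP; have /eqP := ix; rewrite (Lambda1E x) x1 (linear_map0 Gl) add0r.
  rewrite (linear_mapZ _ _ incll) scaler_eq0 (negPf a0) /=.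
  by rewrite /Lambda1_incl /= (linear_map0 (h := ug)) ?add0r ?scale1r //; lin.
(* If c were zero, its trace n in the adjoint representation would vanish in K. Then n = 0, and a
   nonzero g would have an empty basis [t]. *)
suff n0 : n%:R = 0 :> K.
  have n_eq0 : n = 0%N by case: (n) n0 => // m /eqP; rewrite (negPf (K0 m)).
  suff : x0 = 0 by move/eqP; rewrite (negPf nz).
  rewrite (dual_expand tt' x0) big1 // => i _; exfalso; by case: i => m; rewrite n_eq0.
pose Tr (u : env_alg g) : K := \sum_i coord (vbasis {:g}) i (adj u (vbasis {:g})`_i).
have <- : Tr (casimir t t') = n%:R.
  rewrite /Tr -[n in RHS]card_ord -sum1_card natr_sum.
  transitivity (\sum_i (\sum_j coord (vbasis {:g}) i ⟦t j, ⟦t' j, (vbasis {:g})`_i⟧⟧)).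
    apply: eq_bigr => i _.
    rewrite (linear_map_sum _ _ _ adj_linear) (linear_map_sum _ _ _ (@linmap_eval _ _ _ _)) linear_sum.
    by apply: eq_bigr => j _; rewrite adjM !adj_gen.
  rewrite exchange_big; apply: eq_bigr => j _.
  by rewrite -[LHS]/(killing (t j) (t' j)) tt'.2 eqxx.
rewrite /Tr cas0 big1 // => i _; rewrite (linear_map0 adj_linear).
exact: linear0.
Qed.

(** Antisymmetry of s_v, the sum of t_i ⊗ [v, t^i], from the symmetry and the invariance of t. Since
    Psi is the flip on g ⊗ g, it acts on s_v by -1. *)
Lemma dual_lbrr (Z : lmodType K) (f : g -> g -> Z) v : bilinear_map f ->
  \sum_i f ⟦v, t' i⟧ (t i) = - \sum_i f (t i) ⟦v, t' i⟧.
Proof.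
move=> fb; rewrite -(dual_sym tt' (f := fun x y => f ⟦v, x⟧ y)); last by lin.
rewrite (casimir_inv tt') // -sumrN; apply: eq_bigr => i _.
by rewrite lbr_antisym (linear_mapN _ (bilin_l _ fb)).
Qed.

Let half : 2%:R^-1 + 2%:R^-1 = 1 :> K.
Proof. by rewrite -mulr2n -[LHS]mulr_natr mulVf // (K0 1). Qed.

Lemma Lambda1_braid_g (x : X) v : braid (x ⊗ G v) = G v ⊗ x.
Proof.
rewrite Lambda1_braidE big1 ?addr0 // => i _.
by rewrite mulr0 scale0r.
Qed.

(** On g ⊗ g the map id - Psi is twice a projection, which explains the 1/2. The remaining image is
    spanned modulo such tensors by v ⊗ c - c ⊗ v, and id - Psi sends c ⊗ v to its negative; hence
    the value 1 on c ⊗ g and 0 on v ⊗ c. Finally c ⊗ c is fixed by Psi. *)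
Lemma Lambda1_braid_regular : braid_regular X.
Proof.
pose p (x : X) : X := G x.1; pose q (x : X) : X := 2%:R^-1 *: p x + (x.2 : K) *: C.
have pl : linear p by apply: lin_comp Gl _; exact: lin_fst.
have ql : linear q by rewrite /q; apply: linD; [exact: linZ | exact: linZl (@lin_snd K g K^o)].
have Ql : linear (tmap q p) by lin.
exists (tmap q p) => // z; sweedler z as x y.
pose s0 : X ⊗ X := \sum_i G (t i) ⊗ G ⟦x.1, t' i⟧; pose s : X ⊗ X := (y.2 : K) *: s0.
have es : s + s = \sum_i (2%:R * y.2 : K) *: (G (t i) ⊗ G ⟦x.1, t' i⟧).
  by rewrite -scaler_sumr mulr_natl mulr2n scalerDl.
have bl := braid_linear Xc.
have qG v : q (G v) = 2%:R^-1 *: G v by rewrite /q scale0r addr0.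
have Qs : tmap q p (s + s) = s.
  rewrite -scalerDr (linear_mapZ _ _ Ql); congr (_ *: _).
  rewrite (linear_mapD _ _ Ql) (linear_map_sum _ _ _ Ql) -big_split; apply: eq_bigr => i _ /=.
  by pureE; rewrite qG -pureDl -scalerDl half scale1r.
have bs : braid s = - s.
  rewrite (linear_mapZ _ _ bl) -scalerN (linear_map_sum _ _ _ bl); congr (_ *: _).
  rewrite -(dual_lbrr (f := fun v w => G v ⊗ G w)); last by lin.
  by apply: eq_bigr => i _; rewrite Lambda1_braid_g.
(* q ⊗ p + p ⊗ q is the identity up to the C ⊗ C component. That component is the same for x ⊗ y and
   y ⊗ x and cancels in the difference. *)
have N (a b : X) : q a ⊗ p b + p a ⊗ q b = a ⊗ b - (a.2 * b.2 : K) *: (C ⊗ C).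
  have -> : a ⊗ b = (p a + (a.2 : K) *: C) ⊗ (p b + (b.2 : K) *: C) by rewrite -!Lambda1E.
  rewrite /q !pureDl !pureDr !pureZl !pureZr.
  rewrite scalerA !addrA addrK [X in X + _]addrAC -scalerDl half scale1r.
  by rewrite addrAC.
rewrite Lambda1_braidE -es (linear_mapD _ _ Ql) (linear_mapN _ Ql) (linear_mapD _ _ Ql) Qs.
pureE; rewrite !(linear_mapD _ _ bl) !(linear_mapN _ bl) !(linear_mapD _ _ bl) bs !Lambda1_braid_g.
have /eqP := N x y; rewrite eq_sym subr_eq => /eqP ->.
have /eqP := N y x; rewrite eq_sym subr_eq => /eqP ->.
rewrite [(y.2 * _ : K)]mulrC.
set A := q x ⊗ p y; set B := p x ⊗ q y; set A' := q y ⊗ p x; set B' := p y ⊗ q x; set c := _ *: _.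
rewrite [X in _ = _ - X]addrAC [X in _ = _ + X]opprD [RHS]addrACA subrr addr0.
rewrite [X in _ = _ - X]addrACA [X in _ = _ + X]opprD [RHS]addrACA; congr (_ + _).
by rewrite opprB opprD addrA addrAC.
Qed.

Lemma Lambda1_incl_rel (w : X ⊗ X) : braid w = w -> \sw_(x, y <- w) act X x (incl y) = 0.
Proof.
have hl : linear (fun v : g => G (2%:R^-1 *: v)) by apply: lin_comp Gl _; lin.
(* With half the bracket as [R], the map sending x ⊗ y to x <| i(y) is [R] composed with id - Psi.
   The half is doubled by antisymmetry on g ⊗ g, and for y = c it absorbs the factor 2 of the
   coaction. *)
pose R (z : X ⊗ X) : X := \sw_(x, y <- z) G (2%:R^-1 *: ⟦x.1, y.1⟧).
have Rb : bilinear_map (fun x y : X => G (2%:R^-1 *: ⟦x.1, y.1⟧)).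
  by apply: bilinearP => ?; apply: (lin_comp hl); lin.
have Rl : linear R by exact: tlift_linear.
move=> hw; transitivity (R (w - braid w)); last by rewrite hw subrr (linear_map0 Rl).
move: w {hw}; apply: tens_eq_ind; [lin | lin |] => x y.
pureE; rewrite Lambda1_braidE (linear_mapD _ _ Rl) (linear_mapN _ Rl) (linear_mapD _ _ Rl).
rewrite (linear_map_sum _ _ _ Rl) /R !tliftE //.
transitivity (G ⟦x.1, y.1⟧ - \sum_i (y.2 : K) *: G ⟦t i, ⟦x.1, t' i⟧⟧).
  rewrite /Lambda1_incl (linear_mapD _ _ (bilin_r _ actb)) Lambda1_act_gen; congr (_ + _).
  rewrite (linear_mapZ _ _ (bilin_r _ actb)) (linear_map_sum _ _ _ (bilin_r _ actb)).
  rewrite -scaler_sumr -scalerN; congr (_ *: _).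
  rewrite -(dual_lbrr (f := fun x y => G ⟦x, y⟧)); last first.
    by apply: bilinearP => ?; apply: (lin_comp Gl); lin.
  rewrite -(dual_sym tt' (f := fun a b => G ⟦⟦x.1, a⟧, b⟧)); last first.
    by apply: bilinearP => ?; apply: (lin_comp Gl); lin.
  apply: eq_bigr => i _; rewrite Lambda1_actM !Lambda1_act_gen.
  by [].
rewrite opprD addrA; congr (_ - _).
  rewrite (lbr_antisym y.1) scalerN (linear_mapN _ Gl) opprK -(linear_mapD _ _ Gl).
  by rewrite -scalerDl half scale1r.
apply: eq_bigr => i _; rewrite (linear_mapZ (h := tlift _)); last exact: tlift_linear.
rewrite tliftE // (linear_mapZ _ _ Gl) scalerA mulrAC mulfV ?mul1r //; exact: K0 1.
Qed.

Local Notation bg := (@bgen K U X).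

Lemma Bquad_g_anticomm v w : bg (G v) * bg (G w) = - (bg (G w) * bg (G v)).
Proof.
apply/eqP; rewrite -addr_eq0; apply/eqP.
have := bgen_rel (w := G v ⊗ G w + G w ⊗ G v); rewrite tliftD; last by lin.
pureE; apply; rewrite (linear_mapD _ _ (braid_linear Xc)) !Lambda1_braid_g.
exact: addrC.
Qed.

(** The relation comes from the fixed tensor v ⊗ c + c ⊗ v + s_v: the flip of v ⊗ c contributes 2
    s_v, and Psi(s_v) = - s_v brings this back to s_v. *)
Lemma Bquad_c_anticomm v : bg (G v) * bg C + bg C * bg (G v) =
  \sum_i bg (G ⟦v, t i⟧) * bg (G (t' i)).
Proof.
have bl := braid_linear Xc.
pose s : X ⊗ X := \sum_i G (t i) ⊗ G ⟦v, t' i⟧.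
have bs : braid s = - s.
  rewrite (linear_map_sum _ _ _ bl) -(dual_lbrr (f := fun v w => G v ⊗ G w)); last by lin.
  by apply: eq_bigr => i _; rewrite Lambda1_braid_g.
have fixed : braid (G v ⊗ C + C ⊗ G v + s) = G v ⊗ C + C ⊗ G v + s.
  rewrite !(linear_mapD _ _ bl) bs Lambda1_braid_g Lambda1_braidE /= mulr1.
  rewrite -scaler_sumr -/s scaler_nat mulr2n addrAC [C ⊗ G v + _]addrC.
  by rewrite [s + s + _]addrAC addrK addrC [s + _]addrC addrA.
have := bgen_rel fixed; rewrite !tliftD; try by lin.
pureE; move/eqP; rewrite addr_eq0 => /eqP ->.
rewrite (linear_map_sum (h := tlift _)); last by lin.
pose f v w := bg (G v) * bg (G w); have fb : bilinear_map f by rewrite /f; lin.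
transitivity (- \sum_i f (t i) ⟦v, t' i⟧).
  by congr (- _); apply: eq_bigr => i _; rewrite /f; pureE.
rewrite (casimir_inv tt') // -sumrN; apply: eq_bigr => i _.
by rewrite -(linear_mapN _ (bilin_l _ fb)) -lbr_antisym.
Qed.

End CasimirCalculus.

Theorem proposition5p1 (R : realType) (g : lieAlgType R[i]) (n : nat)
    (t t' : 'I_n -> g) (theta : g) :
  semisimple g -> killing_dual_bases t t' ->
  let U : hopf_data R[i] := env g in
  let L1 : cmod_data U := Lambda1 t t' in
  let B : bsuper_data U := Bquad L1 in
  let O : shopf_data R[i] := smash B in
  let u (a : U) : O := a ⊗ 1 in
  let b (x : B) : O := 1 ⊗ x in
  let vB (v : g) : B := bgen (Lambda1_g t t' v) in
  let cB : B := bgen (Lambda1_c t t') in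
  let d : O -> O := graded_comm (b (vB theta)) in
  let delta (x : B) : B := vB theta * x - bs_par B x * vB theta in
  [/\ is_hopf U, env_extends g
    , [/\ is_cmod L1,
          forall (x : L1) (xi : g), act L1 x (ugen xi) = (⟦x.1, xi⟧, 0),
          is_cmod_map_to_aug (@Lambda1_incl _ _ _ t t')
        & (exists x : g, x != 0) -> injective (@Lambda1_incl _ _ _ t t')]
    , is_braided_super_hopf B /\ Bquad_extends L1
    & exists i : O -> O,
      [/\ is_aug_inner_calculus u d i
        , [/\ forall x : L1, i (b (bgen x)) = u (Lambda1_incl x)
            & forall (a : U) (x : O), i (u a ∙ x) = u a ∙ i x]
        , [/\ forall v xi : g,
                b (vB v) ∙ u (ugen xi) - u (ugen xi) ∙ b (vB v) = b (vB ⟦v, xi⟧),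
              forall xi : g, d (u (ugen xi)) = b (bgen (act L1 (Lambda1_g t t' theta) (ugen xi))),
              forall x : B, d (b x) = b (delta x),
              forall v : g, delta (vB v) = 0
            & delta cB = \sum_j vB ⟦theta, t j⟧ * vB (t' j)]
        & forall x : O, d (i x) + i (d x) = u (ugen theta) ∙ x - x ∙ u (ugen theta)]].
Proof.
move=> _ tt'.
have K0 m : m.+1%:R != 0 :> R[i] by rewrite Num.Theory.pnatr_eq0.
have Uh := env_is_hopf g; have Xc := Lambda1_is_cmod tt'.
have flat := Lambda1_braid_regular K0 tt'.
have im := Lambda1_incl_map tt'; have ir := Lambda1_incl_rel K0 tt'.
have aM := @env_antipM _ g.
have th : coact (Lambda1 t t') (Lambda1_g t t' theta) = Lambda1_g t t' theta ⊗ 1.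
  exact: Lambda1_coact_g.
move=> U L1 B O u b vB cB d delta; split.
- exact: Uh.
- exact: env_extendsP.
- split; [exact: Xc | exact: Lambda1_act_gen | exact: im |].
  exact: Lambda1_incl_inj K0 tt'.
- split; first exact: Bis_braided_super_hopf K0 Uh Xc flat.
  exact: Bquad_extendsP K0 Uh Xc flat.
exists (contr (@Lambda1_incl _ _ _ t t')); split.
- exact (Bsmash_calculus K0 Uh Xc flat aM im ir th).
- split; first exact (contr_gen K0 Uh Xc flat im ir).
  exact (contr_mull K0 Uh Xc flat im ir).
- split.
  + move=> v xi; rewrite /b /u (Bsmash_comm_prim K0 Uh Xc flat) ?env_copE //.
    by rewrite [Bquad_act _ _](Bact_gen Uh Xc) Lambda1_act_gen.
  + by move=> xi; rewrite /d /b /u (Bsmash_d_prim K0 Uh Xc flat) ?env_copE.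
  + exact: (Bsmash_d_B K0 Uh Xc flat).
  (* Generators are odd, so [delta] is the anticommutator with theta on them. *)
  + move=> v; rewrite /delta [bs_par B _]Bpar_gen mulNr opprK.
    by rewrite [X in X + _](Bquad_g_anticomm tt') addNr.
  rewrite /delta [bs_par B _]Bpar_gen mulNr opprK.
  exact: Bquad_c_anticomm tt' theta.
move=> x; rewrite /d (contr_cartan K0 Uh Xc flat im ir).
by rewrite Lambda1_incl_g.
Qed.
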